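(* Assume that Han's conjecture holds for local algebras. If an algebra $\Lambda$ admits a strongly co-stratifying chain $\{e_1,\dots,e_n\}$ consisting of primitive idempotents, then Han's conjecture is true for $\Lambda$.
   Context: Throughout, ''algebra'' means a finite dimensional associative unital algebra over a fixed field $k$. For an algebra $\Lambda$, $HH_*(\Lambda)=\mathrm{Tor}_*^{\Lambda\otimes_k\Lambda^{\mathrm{op}}}(\Lambda,\Lambda)$ is its Hochschild homology; it is called finite if there is $N$ with $HH_m(\Lambda)=0$ for all $m>N$. Han's conjecture holds (is true) for an algebra $\Lambda$ if the following implication holds: if $HH_*(\Lambda)$ is finite, then $\Lambda$ has finite global dimension. For an algebra $\Gamma$ with unit $1_\Gamma$ and an idempotent $e\in\Gamma$, put $f=1_\Gamma-e$. The ideal $\Gamma e\Gamma$ is strongly stratifying if: (1) $\mathrm{Tor}_m^{e\Gamma e}(\Gamma e,e\Gamma)=0$ for $m>0$; (2) $f\Gamma e\otimes_{e\Gamma e}e\Gamma f=0$; (3) $\mathrm{Tor}_m^{f\Gamma f}(\Gamma f,f\Gamma)=0$ for $m>0$. Let $\{e_1,\dots,e_n\}$ be an ordered complete set of orthogonal idempotents of $\Lambda$ (pairwise orthogonal idempotents with sum $1$), and for $0\le i\le n-1$ let $f_i=e_{i+1}+\dots+e_n$, so $f_0=1$ and $f_{n-1}=e_n$; the algebra $f_i\Lambda f_i$ has unit $f_i$ and contains $f_{i+1}$. The set is a strongly co-stratifying chain (or $n$-chain) of $\Lambda$ if, for each $0\le i\le n-2$, the two-sided ideal of $f_i\Lambda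 f_i$ generated by the idempotent $f_{i+1}$ is strongly stratifying in $f_i\Lambda f_i$ (with respect to the idempotent $f_{i+1}$). *)

(* Defs.v *)
From HB Require Import structures.
From mathcomp Require Import all_boot all_algebra all_field.
From mathcomp Require Import boolp.

Set Implicit Arguments.
Unset Strict Implicit.
Unset Printing Implicit Defensive.

Import GRing.Theory.
Local Open Scope ring_scope.
Local Open Scope quotient_scope.

(* Right A-modules are left modules over the converse ring: [lmodType A^c].   *)

(* M (x)_A N is the type of finite formal sums of pairs (m, n) modulo the     *)
(* relations below. Free commutative monoids suffice, because the class of    *)
(* (- m, n) is opposite to that of (m, n) by [tens_eqDl] and [tens_eq0].      *)
Section Tensor.
Variables (A : pzRingType) (M : lmodType A^c) (N : lmodType A).

Inductive tens_eq : seq (M * N) -> seq (M * N) -> Prop :=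
| tens_eq_refl s : tens_eq s s
| tens_eq_sym s t : tens_eq s t -> tens_eq t s
| tens_eq_trans s t u : tens_eq s t -> tens_eq t u -> tens_eq s u
| tens_eq_cat s s' t t' :
    tens_eq s s' -> tens_eq t t' -> tens_eq (s ++ t) (s' ++ t')
| tens_eqC s t : tens_eq (s ++ t) (t ++ s)
| tens_eq0 n : tens_eq [:: (0, n)] [::]
| tens_eqDl m m' n : tens_eq [:: (m + m', n)] [:: (m, n); (m', n)]
| tens_eqDr m n n' : tens_eq [:: (m, n + n')] [:: (m, n); (m, n')]
| tens_eqZ (a : A) m n : tens_eq [:: ((a : A^c) *: m, n)] [:: (m, a *: n)].

Definition tens_rel : rel (seq (M * N)) := fun s t => `[< tens_eq s t >].

Lemma tens_rel_refl : reflexive tens_rel.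
Proof. by move=> s; apply/asboolP/tens_eq_refl. Qed.

Lemma tens_rel_sym : symmetric tens_rel.
Proof.
by move=> s t; apply/asboolP/asboolP => /tens_eq_sym.
Qed.

Lemma tens_rel_trans : transitive tens_rel.
Proof.
move=> t s u /asboolP st /asboolP tu; apply/asboolP.
exact: tens_eq_trans st tu.
Qed.

Canonical tens_equiv :=
  EquivRel tens_rel tens_rel_refl tens_rel_sym tens_rel_trans.

Definition tensor : Type := {eq_quot tens_equiv}.
HB.instance Definition _ := Choice.on tensor.
HB.instance Definition _ := EqQuotient.on tensor.

Definition tens_sum (s : seq (M * N)) : tensor := \pi_tensor s.
Definition tens (m : M) (n : N) : tensor := tens_sum [:: (m, n)].

Lemma tens_sumP s t : tens_sum s = tens_sum t <-> tens_eq s t.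
Proof.
split=> [/eqmodP /asboolP // | st]; by apply/eqmodP/asboolP.
Qed.

Lemma tens_sumK x : tens_sum (repr x) = x.
Proof. exact: reprK. Qed.

Lemma repr_tens_sum s : tens_eq (repr (tens_sum s)) s.
Proof. by apply/tens_sumP; rewrite tens_sumK. Qed.

Definition tensor_zero : tensor := tens_sum [::].
Definition tensor_add (x y : tensor) : tensor := tens_sum (repr x ++ repr y).
Definition tensor_opp (x : tensor) : tensor :=
  tens_sum [seq (- p.1, p.2) | p <- repr x].

Lemma tensor_add_sum s t : tensor_add (tens_sum s) (tens_sum t) = tens_sum (s ++ t).
Proof. by apply/tens_sumP/tens_eq_cat; apply: repr_tens_sum. Qed.

Lemma tensor_addA : associative tensor_add.
Proof.
move=> x y z; rewrite -[x]tens_sumK -[y]tens_sumK -[z]tens_sumK.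
by rewrite !tensor_add_sum catA.
Qed.

Lemma tensor_addC : commutative tensor_add.
Proof. by move=> x y; apply/tens_sumP/tens_eqC. Qed.

Lemma tensor_add0 : left_id tensor_zero tensor_add.
Proof. by move=> x; rewrite -[x]tens_sumK tensor_add_sum. Qed.

Lemma tensor_addN : left_inverse tensor_zero tensor_opp tensor_add.
Proof.
move=> x; rewrite -{2}[x]tens_sumK tensor_add_sum /tensor_zero.
apply/tens_sumP; elim: (repr x) => [|[m n] s IHs] /=; first exact: tens_eq_refl.
have mn0 : tens_eq ([:: (- m, n)] ++ [:: (m, n)]) [::].
  apply: tens_eq_trans (tens_eq0 n); apply: tens_eq_sym.
  by rewrite -(addNr m); apply: tens_eqDl.
apply: tens_eq_trans mn0; rewrite -[_ :: _]cat1s.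
apply: tens_eq_cat (tens_eq_refl _) _.
rewrite -[(m, n) :: s]cat1s catA -[[:: (m, n)] in X in tens_eq _ X]cats0.
apply: (@tens_eq_trans _ (([:: (m, n)] ++ [seq (- p.1, p.2) | p <- s]) ++ s)).
  exact: tens_eq_cat (tens_eqC _ _) (tens_eq_refl _).
by rewrite -catA; apply: tens_eq_cat (tens_eq_refl _) IHs.
Qed.

HB.instance Definition _ :=
  GRing.isZmodule.Build tensor tensor_addA tensor_addC tensor_add0 tensor_addN.

Lemma tens_sum_big s : tens_sum s = \sum_(p <- s) tens p.1 p.2.
Proof.
elim: s => [|[m n] s IHs]; first by rewrite big_nil.
rewrite big_cons -IHs /=; exact/esym/(tensor_add_sum [:: (m, n)]).
Qed.

Lemma tens_ind (P : tensor -> Prop) :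
    P 0 -> (forall m n, P (tens m n)) ->
    (forall x y, P x -> P y -> P (x + y)) -> forall x, P x.
Proof.
move=> P0 Pt PD x; rewrite -[x]tens_sumK tens_sum_big.
by apply: big_ind => // p _; apply: Pt.
Qed.

Lemma tensDl m m' n : tens (m + m') n = tens m n + tens m' n.
Proof.
rewrite /tens [RHS]tensor_add_sum; exact/tens_sumP/tens_eqDl.
Qed.

Lemma tensDr m n n' : tens m (n + n') = tens m n + tens m n'.
Proof.
rewrite /tens [RHS]tensor_add_sum; exact/tens_sumP/tens_eqDr.
Qed.

Lemma tensZ (a : A) m n : tens ((a : A^c) *: m) n = tens m (a *: n).
Proof. exact/tens_sumP/tens_eqZ. Qed.

Section Lift.
Variables (G : zmodType) (f : M -> N -> G).

Definition balanced : Prop :=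
  [/\ forall m m' n, f (m + m') n = f m n + f m' n,
      forall m n n', f m (n + n') = f m n + f m n'
    & forall (a : A) m n, f ((a : A^c) *: m) n = f m (a *: n)].

(* Meaningful only for balanced f. *)
Definition tens_lift (x : tensor) : G := \sum_(p <- repr x) f p.1 p.2.

Hypothesis fB : balanced.

Lemma tens_lift_sum s : tens_lift (tens_sum s) = \sum_(p <- s) f p.1 p.2.
Proof.
case: fB => fDl fDr fZ; rewrite /tens_lift.
have eq_sum u v : tens_eq u v ->
    \sum_(p <- u) f p.1 p.2 = \sum_(p <- v) f p.1 p.2.
  elim=> {s u v} //=.
  - by move=> s t u _ -> _ ->.
  - by move=> s s' t t' _ IHs _ IHt; rewrite !big_cat /= IHs IHt.
  - by move=> s t; rewrite !big_cat /= addrC.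
  - move=> n; rewrite big_seq1 big_nil /=.
    by apply: (addrI (f 0 n)); rewrite -fDl !addr0.
  - by move=> m m' n; rewrite big_seq1 big_cons big_seq1 /= fDl.
  - by move=> m n n'; rewrite big_seq1 big_cons big_seq1 /= fDr.
  - by move=> a m n; rewrite !big_seq1 /= fZ.
exact/eq_sum/repr_tens_sum.
Qed.

Lemma tens_liftE m n : tens_lift (tens m n) = f m n.
Proof. by rewrite tens_lift_sum big_seq1. Qed.

Lemma tens_lift0 : tens_lift 0 = 0.
Proof. by rewrite [LHS]tens_lift_sum big_nil. Qed.

Lemma tens_liftD x y : tens_lift (x + y) = tens_lift x + tens_lift y.
Proof.
rewrite -[x]tens_sumK -[y]tens_sumK [_ + _]tensor_add_sum.
by rewrite !tens_lift_sum big_cat.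
Qed.

End Lift.
End Tensor.

(* The map f (x) id_N. *)
Definition tens_mapl (A : pzRingType) (M M' : lmodType A^c) (N : lmodType A)
    (f : {linear M -> M'}) : tensor M N -> tensor M' N :=
  tens_lift (fun m n => tens (f m) n).

Lemma tens_mapl_balanced (A : pzRingType) (M M' : lmodType A^c)
    (N : lmodType A) (f : {linear M -> M'}) :
  balanced (fun (m : M) (n : N) => tens (f m) n).
Proof.
split=> [m m' n|m n n'|a m n]; first by rewrite linearD tensDl.
  exact: tensDr.
by rewrite linearZ tensZ.
Qed.

Definition surjective (X Y : Type) (f : X -> Y) : Prop :=
  forall y, exists x, f x = y.

Definition projective (A : pzRingType) (P : lmodType A) : Prop :=
  forall (X Y : lmodType A) (g : {linear X -> Y}) (f : {linear P -> Y}),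
    surjective g -> exists h : {linear P -> X}, forall p, g (h p) = f p.

Record proj_resolution (A : pzRingType) (M : lmodType A) := ProjResolution {
  res_mod :> nat -> lmodType A;
  res_diff : forall n, {linear res_mod n.+1 -> res_mod n};
  res_aug : {linear res_mod 0%N -> M};
  res_proj : forall n, projective (res_mod n);
  res_aug_surj : surjective res_aug;
  res_exact0 : forall x, res_aug x = 0 <-> exists y, res_diff 0 y = x;
  res_exactS : forall n x,
    res_diff n x = 0 <-> exists y, res_diff n.+1 y = x
}.

(* The m-cycles of the complex P (x)_A N. *)
Definition tens_cycle (A : pzRingType) (M : lmodType A^c)
    (P : proj_resolution M) (N : lmodType A) (m : nat) :
    tensor (P m) N -> Prop :=
  match m with
  | 0 => fun=> True
  | m'.+1 => fun x => tens_mapl (res_diff P m') x = 0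
  end.

(* Tor_m^A(M, N) = 0, i.e. H_m(P (x)_A N) = 0 for a projective resolution P   *)
(* of M.                                                                      *)
Definition Tor_eq0 (A : pzRingType) (M : lmodType A^c) (N : lmodType A)
    (m : nat) : Prop :=
  exists P : proj_resolution M, forall x : tensor (P m) N,
    tens_cycle x -> exists y : tensor (P m.+1) N, tens_mapl (res_diff P m) y = x.

Definition proj_dim_le (A : pzRingType) (M : lmodType A) (d : nat) : Prop :=
  exists P : proj_resolution M, forall n, (d < n)%N -> forall x : P n, x = 0.

(* Global dimension on the left; it is finite if and only if the one on the   *)
(* right is, as finite dimensional algebras are noetherian on both sides.     *)
Definition finite_gldim (A : pzRingType) : Prop :=
  exists d, forall M : lmodType A, proj_dim_le M d.

(* A module V over a commutative ring K, as a right module. *)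
Definition symmetric_mod (K : comPzRingType) (V : lmodType K) : Type := V.

Section SymmetricMod.
Variables (K : comPzRingType) (V : lmodType K).
Local Notation W := (symmetric_mod V).
HB.instance Definition _ := GRing.Zmodule.on W.

Definition symmetric_scale (a : K^c) (v : W) : W := (a : K) *: (v : V).

Lemma symmetric_scaleA a b v :
  symmetric_scale a (symmetric_scale b v) = symmetric_scale (a * b) v.
Proof. by rewrite /symmetric_scale scalerA mulrC. Qed.

Lemma symmetric_scale1 : left_id 1 symmetric_scale.
Proof. exact: scale1r. Qed.

Lemma symmetric_scaleDr : right_distributive symmetric_scale +%R.
Proof. by move=> a v w; apply: (@scalerDr K V). Qed.

Lemma symmetric_scaleDl v : {morph symmetric_scale^~ v : a b / a + b}.
Proof. by move=> a b; apply: (@scalerDl K V). Qed.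

HB.instance Definition _ := GRing.Zmodule_isLmodule.Build K^c W
  symmetric_scaleA symmetric_scale1 symmetric_scaleDr symmetric_scaleDl.
End SymmetricMod.

(* The enveloping algebra L (x)_k L^op: the underlying space is L (x)_k L and *)
(* (a (x) b) (a' (x) b') = a a' (x) b' b.                                     *)
Definition enveloping (k : fieldType) (L : falgType k) : Type :=
  tensor (symmetric_mod L) L.

Section Enveloping.
Variables (k : fieldType) (L : falgType k).
Local Notation Le := (enveloping L).
HB.instance Definition _ := GRing.Zmodule.on Le.

Definition etens (a b : L) : Le := tens (a : symmetric_mod L) b.

Lemma etens_ind (P : Le -> Prop) :
    P 0 -> (forall a b, P (etens a b)) ->
    (forall x y, P x -> P y -> P (x + y)) -> forall x, P x.
Proof. exact: (@tens_ind _ (symmetric_mod L) L). Qed.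

Lemma etensDl a a' b : etens (a + a') b = etens a b + etens a' b.
Proof. exact: (@tensDl _ (symmetric_mod L) L). Qed.

Lemma etensDr a b b' : etens a (b + b') = etens a b + etens a b'.
Proof. exact: (@tensDr _ (symmetric_mod L) L). Qed.

Lemma etensZ (c : k) (a b : L) : etens (c *: a) b = etens a (c *: b).
Proof. exact: (@tensZ _ (symmetric_mod L) L c a b). Qed.

Section ELift.
Variables (G : zmodType) (f : L -> L -> G).

Definition etens_lift : Le -> G :=
  @tens_lift _ (symmetric_mod L) L G f.

Hypotheses (fDl : forall a a' b, f (a + a') b = f a b + f a' b)
  (fDr : forall a b b', f a (b + b') = f a b + f a b')
  (fZ : forall (c : k) a b, f (c *: a) b = f a (c *: b)).

Lemma etens_lift_balanced : @balanced _ (symmetric_mod L) L G f.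
Proof. by []. Qed.

Lemma etens_liftE a b : etens_lift (etens a b) = f a b.
Proof. exact: (tens_liftE etens_lift_balanced). Qed.

Lemma etens_liftD x y : etens_lift (x + y) = etens_lift x + etens_lift y.
Proof. exact: (tens_liftD etens_lift_balanced). Qed.

Lemma etens_lift0 : etens_lift 0 = 0.
Proof. exact: (tens_lift0 etens_lift_balanced). Qed.
End ELift.

Definition enveloping_one : Le := etens 1 1.

Definition enveloping_mul (x y : Le) : Le :=
  etens_lift (fun a b => etens_lift (fun a' b' => etens (a * a') (b' * b)) y) x.

Let mulr_bal a b : [/\ forall u u' v,
    etens (a * (u + u')) (v * b) = etens (a * u) (v * b) + etens (a * u') (v * b),
    forall u v v',
    etens (a * u) ((v + v') * b) = etens (a * u) (v * b) + etens (a * u) (v' * b)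
  & forall (c : k) u v,
    etens (a * (c *: u)) (v * b) = etens (a * u) ((c *: v) * b)].
Proof.
split=> *; first by rewrite mulrDr etensDl.
  by rewrite mulrDl etensDr.
by rewrite -scalerAr -scalerAl etensZ.
Qed.

Let mul_inner a b :=
  let: And3 h1 h2 h3 := mulr_bal a b in
  (etens_liftE h1 h2 h3, etens_lift0 h1 h2 h3).

Let mul_innerD a b :=
  let: And3 h1 h2 h3 := mulr_bal a b in etens_liftD h1 h2 h3.

Let mull_bal y : [/\ forall a a' b,
    etens_lift (fun u v => etens ((a + a') * u) (v * b)) y =
    etens_lift (fun u v => etens (a * u) (v * b)) y +
    etens_lift (fun u v => etens (a' * u) (v * b)) y,
    forall a b b',
    etens_lift (fun u v => etens (a * u) (v * (b + b'))) y =
    etens_lift (fun u v => etens (a * u) (v * b)) y +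
    etens_lift (fun u v => etens (a * u) (v * b')) y
  & forall (c : k) a b,
    etens_lift (fun u v => etens ((c *: a) * u) (v * b)) y =
    etens_lift (fun u v => etens (a * u) (v * (c *: b))) y].
Proof.
split=> [a a' b|a b b'|c a b]; elim/etens_ind: y => [|u v|x y IHx IHy].
- by rewrite !mul_inner addr0.
- by rewrite !mul_inner mulrDl etensDl.
- by rewrite !mul_innerD IHx IHy addrACA.
- by rewrite !mul_inner addr0.
- by rewrite !mul_inner mulrDr etensDr.
- by rewrite !mul_innerD IHx IHy addrACA.
- by rewrite !mul_inner.
- by rewrite !mul_inner -scalerAl -scalerAr etensZ.
- by rewrite !mul_innerD IHx IHy.
Qed.

Lemma enveloping_mulE a b a' b' :
  enveloping_mul (etens a b) (etens a' b') = etens (a * a') (b' * b).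
Proof.
rewrite /enveloping_mul; case: (mull_bal (etens a' b')) => h1 h2 h3.
by rewrite (etens_liftE h1 h2 h3) mul_inner.
Qed.

Lemma enveloping_mulDl : left_distributive enveloping_mul +%R.
Proof.
move=> x y z; case: (mull_bal z) => h1 h2 h3.
exact: (etens_liftD h1 h2 h3).
Qed.

Let mul0e : left_zero 0 enveloping_mul.
Proof.
by move=> z; case: (mull_bal z) => h1 h2 h3; apply: (etens_lift0 h1 h2 h3).
Qed.

Lemma enveloping_mulDr : right_distributive enveloping_mul +%R.
Proof.
move=> x y z; elim/etens_ind: x => [|a b|x x' IHx IHx'].
- by rewrite !mul0e addr0.
- rewrite /enveloping_mul.
  case: (mull_bal y) => h1 h2 h3; rewrite (etens_liftE h1 h2 h3).
  case: (mull_bal z) => g1 g2 g3; rewrite (etens_liftE g1 g2 g3).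
  case: (mull_bal (y + z)) => i1 i2 i3; rewrite (etens_liftE i1 i2 i3).
  exact: mul_innerD.
- by rewrite !enveloping_mulDl IHx IHx' addrACA.
Qed.

Let mule0 : right_zero 0 enveloping_mul.
Proof.
move=> x; apply: (addIr (enveloping_mul x 0)).
by rewrite -enveloping_mulDr !add0r.
Qed.

Lemma enveloping_mulA : associative enveloping_mul.
Proof.
move=> x y z; elim/etens_ind: x => [|a b|x x' IHx IHx'].
- by rewrite !mul0e.
- elim/etens_ind: y => [|a' b'|y y' IHy IHy'].
  + by rewrite !(mul0e, mule0).
  + elim/etens_ind: z => [|a'' b''|z z' IHz IHz'].
    * by rewrite !mule0.
    * by rewrite !enveloping_mulE !mulrA.
    * by rewrite !enveloping_mulDr IHz IHz'.
  + by rewrite !(enveloping_mulDl, enveloping_mulDr) IHy IHy'.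
- by rewrite !enveloping_mulDl IHx IHx'.
Qed.

Lemma enveloping_mul1 : left_id enveloping_one enveloping_mul.
Proof.
elim/etens_ind=> [|a b|x y IHx IHy]; first exact: mule0.
  by rewrite enveloping_mulE mul1r mulr1.
by rewrite enveloping_mulDr IHx IHy.
Qed.

Lemma enveloping_1mul : right_id enveloping_one enveloping_mul.
Proof.
elim/etens_ind=> [|a b|x y IHx IHy]; first exact: mul0e.
  by rewrite enveloping_mulE mulr1 mul1r.
by rewrite enveloping_mulDl IHx IHy.
Qed.

HB.instance Definition _ := GRing.Zmodule_isPzRing.Build Le
  enveloping_mulA enveloping_mul1 enveloping_1mul
  enveloping_mulDl enveloping_mulDr.

Lemma etensM a b a' b' : etens a b * etens a' b' = etens (a * a') (b' * b).
Proof. exact: enveloping_mulE. Qed.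

(* L as a left L^e-module, (a (x) b) x = a x b, and as a right L^e-module,    *)
(* x (a (x) b) = b x a.                                                       *)
Definition left_reg : Type := L.
Definition right_reg : Type := L.
HB.instance Definition _ := GRing.Zmodule.on left_reg.
HB.instance Definition _ := GRing.Zmodule.on right_reg.

Definition left_act (t : Le) (x : left_reg) : left_reg :=
  etens_lift (fun a b => a * (x : L) * b) t.
Definition right_act (t : Le^c) (x : right_reg) : right_reg :=
  etens_lift (fun a b => b * (x : L) * a) t.

Let left_bal (x : L) : [/\ forall a a' b,
    (a + a') * x * b = a * x * b + a' * x * b,
    forall a b b', a * x * (b + b') = a * x * b + a * x * b'
  & forall (c : k) a b, (c *: a) * x * b = a * x * (c *: b)].
Proof. by split=> *; rewrite ?mulrDl ?mulrDr -?scalerAl -?scalerAr. Qed.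

Lemma left_actE a b (x : L) : left_act (etens a b) x = a * x * b.
Proof. by have [? ? ?] := left_bal x; apply: (@etens_liftE L). Qed.

Lemma left_actDl x : {morph left_act^~ x : s t / s + t}.
Proof. by have [? ? ?] := left_bal x; apply: etens_liftD. Qed.

Let left_act0 x : left_act 0 x = 0.
Proof. by have [? ? ?] := left_bal x; apply: etens_lift0. Qed.

Lemma left_actDr : right_distributive left_act +%R.
Proof.
move=> t x y; elim/etens_ind: t => [|a b|s t IHs IHt].
- by rewrite !left_act0 addr0.
- by rewrite !left_actE mulrDr mulrDl.
- by rewrite !left_actDl IHs IHt addrACA.
Qed.

Lemma left_act1 : left_id 1 left_act.
Proof. by move=> x; rewrite [LHS]left_actE mul1r mulr1. Qed.

Lemma left_actA s t x : left_act s (left_act t x) = left_act (s * t) x.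
Proof.
have act0 u : left_act u 0 = 0.
  by apply: (addIr (left_act u 0)); rewrite -left_actDr !add0r.
elim/etens_ind: s => [|a b|s s' IHs IHs'].
- by rewrite mul0r !left_act0.
- elim/etens_ind: t => [|a' b'|t t' IHt IHt'].
  + by rewrite mulr0 !left_act0 act0.
  + by rewrite etensM !left_actE !mulrA.
  + by rewrite mulrDr !left_actDl left_actDr IHt IHt'.
- by rewrite mulrDl !left_actDl IHs IHs'.
Qed.

HB.instance Definition _ := GRing.Zmodule_isLmodule.Build Le left_reg
  left_actA left_act1 left_actDr left_actDl.

Let right_bal (x : L) : [/\ forall a a' b,
    b * x * (a + a') = b * x * a + b * x * a',
    forall a b b', (b + b') * x * a = b * x * a + b' * x * a
  & forall (c : k) a b, b * x * (c *: a) = (c *: b) * x * a].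
Proof. by split=> *; rewrite ?mulrDl ?mulrDr -?scalerAl -?scalerAr. Qed.

Lemma right_actE a b (x : L) : right_act (etens a b) x = b * x * a.
Proof. by have [? ? ?] := right_bal x; apply: (@etens_liftE L). Qed.

Lemma right_actDl x : {morph right_act^~ x : s t / s + t}.
Proof. by have [? ? ?] := right_bal x; apply: etens_liftD. Qed.

Let right_act0 x : right_act 0 x = 0.
Proof. by have [? ? ?] := right_bal x; apply: etens_lift0. Qed.

Lemma right_actDr : right_distributive right_act +%R.
Proof.
move=> t x y; elim/etens_ind: t => [|a b|s t IHs IHt].
- by rewrite !right_act0 addr0.
- by rewrite !right_actE mulrDr mulrDl.
- by rewrite !right_actDl IHs IHt addrACA.
Qed.

Lemma right_act1 : left_id 1 right_act.
Proof. by move=> x; rewrite [LHS]right_actE mul1r mulr1. Qed.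

Lemma right_actA s t x : right_act s (right_act t x) = right_act (s * t) x.
Proof.
have act0 u : right_act u 0 = 0.
  by apply: (addIr (right_act u 0)); rewrite -right_actDr !add0r.
change (right_act s (right_act t x) = right_act ((t : Le) * (s : Le)) x).
elim/etens_ind: s => [|a b|s s' IHs IHs'].
- by rewrite mulr0 !right_act0.
- elim/etens_ind: t => [|a' b'|t t' IHt IHt'].
  + by rewrite mul0r !right_act0 act0.
  + by rewrite etensM !right_actE !mulrA.
  + by rewrite mulrDl !right_actDl right_actDr IHt IHt'.
- by rewrite mulrDr !right_actDl IHs IHs'.
Qed.

HB.instance Definition _ := GRing.Zmodule_isLmodule.Build Le^c right_reg
  right_actA right_act1 right_actDr right_actDl.
End Enveloping.

(* HH_m(L) = 0. *)
Definition HH_eq0 (k : fieldType) (L : falgType k) (m : nat) : Prop :=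
  @Tor_eq0 (enveloping L) (right_reg L) (left_reg L) m.

Definition finite_HH (k : fieldType) (L : falgType k) : Prop :=
  exists N, forall m, (N < m)%N -> HH_eq0 L m.

Definition Han_conjecture (k : fieldType) (L : falgType k) : Prop :=
  finite_HH L -> finite_gldim L.

Definition left_ideal (k : fieldType) (L : falgType k) (I : {vspace L}) : Prop :=
  forall a x : L, x \in I -> a * x \in I.

Definition maximal_left_ideal (k : fieldType) (L : falgType k)
    (I : {vspace L}) : Prop :=
  [/\ left_ideal I, I <> fullv
    & forall J, left_ideal J -> (I <= J)%VS -> J = I \/ J = fullv].

Definition local_algebra (k : fieldType) (L : falgType k) : Prop :=
  exists! I : {vspace L}, maximal_left_ideal I.

Definition is_idempotent (R : pzRingType) (e : R) : Prop := e * e = e.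

Definition primitive_idempotent (R : pzRingType) (e : R) : Prop :=
  [/\ is_idempotent e, e <> 0
    & forall a b : R, is_idempotent a -> is_idempotent b -> a * b = 0 -> b * a = 0 ->
        e = a + b -> a = 0 \/ b = 0].

Record idem (R : pzRingType) := Idem {
  idem_val :> R;
  idemP : is_idempotent idem_val
}.

Section IdemOps.
Variable R : pzRingType.

Lemma idem1_proof : is_idempotent (1 : R).
Proof. exact: mulr1. Qed.
Definition idem1 : idem R := Idem idem1_proof.

Lemma idemC_proof (e : idem R) : is_idempotent (1 - (e : R)).
Proof.
by rewrite /is_idempotent mulrBl mul1r mulrBr mulr1 idemP subrr subr0.
Qed.
Definition idemC (e : idem R) : idem R := Idem (idemC_proof e).
End IdemOps.

(* The Peirce component e R f. *)
Section Peirce.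
Variables (R : pzRingType) (e f : idem R).

Definition in_peirce : {pred R} := fun x => (e : R) * x * (f : R) == x.

Lemma in_peirce_zmod : zmod_closed in_peirce.
Proof.
split=> [|x y]; first by rewrite unfold_in /in_peirce mulr0 mul0r.
rewrite !unfold_in /in_peirce => /eqP ex /eqP ey.
by rewrite mulrBr mulrBl ex ey.
Qed.

HB.instance Definition _ := GRing.isZmodClosed.Build R in_peirce in_peirce_zmod.

Record peirce : Type := Peirce { peirce_val :> R; _ : peirce_val \in in_peirce }.
HB.instance Definition _ := [isSub for peirce_val].
HB.instance Definition _ := [Choice of peirce by <:].
HB.instance Definition _ := [SubChoice_isSubZmodule of peirce by <:].

Lemma peirceP (x : peirce) : (e : R) * (x : R) * (f : R) = (x : R).
Proof. exact/eqP/(valP x). Qed.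

Lemma peirce_l (x : peirce) : (e : R) * (x : R) = (x : R).
Proof. by rewrite -(peirceP x) !mulrA idemP. Qed.

Lemma peirce_r (x : peirce) : (x : R) * (f : R) = (x : R).
Proof. by rewrite -(peirceP x) -mulrA idemP. Qed.
End Peirce.

Lemma in_peirceM (R : pzRingType) (e f g : idem R)
    (x : peirce e f) (y : peirce f g) : (x : R) * (y : R) \in in_peirce e g.
Proof. by rewrite unfold_in /in_peirce mulrA peirce_l -mulrA peirce_r. Qed.

Definition peirce_mul (R : pzRingType) (e f g : idem R)
    (x : peirce e f) (y : peirce f g) : peirce e g :=
  Peirce (in_peirceM x y).

(* The ring e R e, with unit e. *)
Definition corner (R : pzRingType) (e : idem R) : Type := peirce e e.

Section Corner.
Variables (R : pzRingType) (e : idem R).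
HB.instance Definition _ := GRing.Zmodule.on (corner e).

Lemma in_corner1 : (e : R) \in in_peirce e e.
Proof. by rewrite unfold_in /in_peirce !idemP. Qed.

Definition corner_one : corner e := Peirce in_corner1.
Definition corner_mul (x y : corner e) : corner e := peirce_mul x y.

Lemma corner_mulA : associative corner_mul.
Proof. by move=> x y z; apply/val_inj/mulrA. Qed.

Lemma corner_mul1 : left_id corner_one corner_mul.
Proof. by move=> x; apply/val_inj/peirce_l. Qed.

Lemma corner_1mul : right_id corner_one corner_mul.
Proof. by move=> x; apply/val_inj/peirce_r. Qed.

Lemma corner_mulDl : left_distributive corner_mul +%R.
Proof. by move=> x y z; apply/val_inj/mulrDl. Qed.

Lemma corner_mulDr : right_distributive corner_mul +%R.
Proof. by move=> x y z; apply/val_inj/mulrDr. Qed.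

HB.instance Definition _ := GRing.Zmodule_isPzRing.Build (corner e)
  corner_mulA corner_mul1 corner_1mul corner_mulDl corner_mulDr.
End Corner.

(* e R f as a left e R e-module and, under another name, as a right           *)
(* f R f-module.                                                              *)
Definition lpeirce (R : pzRingType) (e f : idem R) : Type := peirce e f.
Definition rpeirce (R : pzRingType) (e f : idem R) : Type := peirce e f.

Section PeirceModules.
Variables (R : pzRingType) (e f : idem R).
HB.instance Definition _ := GRing.Zmodule.on (lpeirce e f).
HB.instance Definition _ := GRing.Zmodule.on (rpeirce e f).

Definition lpeirce_scale (a : corner e) (x : lpeirce e f) : lpeirce e f :=
  peirce_mul a x.
Definition rpeirce_scale (a : (corner f)^c) (x : rpeirce e f) : rpeirce e f :=
  peirce_mul x a.

Lemma lpeirce_scaleA a b x :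
  lpeirce_scale a (lpeirce_scale b x) = lpeirce_scale (a * b) x.
Proof. exact/val_inj/mulrA. Qed.

Lemma lpeirce_scale1 : left_id 1 lpeirce_scale.
Proof. by move=> x; apply/val_inj/peirce_l. Qed.

Lemma lpeirce_scaleDr : right_distributive lpeirce_scale +%R.
Proof. by move=> a x y; apply/val_inj/mulrDr. Qed.

Lemma lpeirce_scaleDl x : {morph lpeirce_scale^~ x : a b / a + b}.
Proof. by move=> a b; apply/val_inj/mulrDl. Qed.

HB.instance Definition _ := GRing.Zmodule_isLmodule.Build (corner e) (lpeirce e f)
  lpeirce_scaleA lpeirce_scale1 lpeirce_scaleDr lpeirce_scaleDl.

Lemma rpeirce_scaleA a b x :
  rpeirce_scale a (rpeirce_scale b x) = rpeirce_scale (a * b) x.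
Proof. by apply/val_inj; rewrite /= -mulrA. Qed.

Lemma rpeirce_scale1 : left_id 1 rpeirce_scale.
Proof. by move=> x; apply/val_inj/peirce_r. Qed.

Lemma rpeirce_scaleDr : right_distributive rpeirce_scale +%R.
Proof. by move=> a x y; apply/val_inj/mulrDl. Qed.

Lemma rpeirce_scaleDl x : {morph rpeirce_scale^~ x : a b / a + b}.
Proof. by move=> a b; apply/val_inj/mulrDr. Qed.

HB.instance Definition _ :=
  GRing.Zmodule_isLmodule.Build (corner f)^c (rpeirce e f)
  rpeirce_scaleA rpeirce_scale1 rpeirce_scaleDr rpeirce_scaleDl.
End PeirceModules.

(* The ideal R e R is strongly stratifying (with respect to e). *)
Definition strongly_stratifying (R : pzRingType) (e : idem R) : Prop :=
  let f := idemC e in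
  let one := idem1 R in
  [/\ forall m, (0 < m)%N ->
        @Tor_eq0 (corner e) (rpeirce one e) (lpeirce e one) m,
      forall x : @tensor (corner e) (rpeirce f e) (lpeirce e f), x = 0
    & forall m, (0 < m)%N ->
        @Tor_eq0 (corner f) (rpeirce one f) (lpeirce f one) m].

Record complete_idempotents (R : pzRingType) (n : nat) := CompleteIdempotents {
  ci_val :> 'I_n -> R;
  ci_idem : forall i, is_idempotent (ci_val i);
  ci_orth : forall i j, i != j -> ci_val i * ci_val j = 0;
  ci_sum : \sum_i ci_val i = 1
}.

Section Chain.
Variables (R : pzRingType) (n : nat) (e : complete_idempotents R n).

(* Indices start at 0: e j is e_{j+1}, and tail i is f_i = e_{i+1}+...+e_n. *)
Definition tail (i : nat) : R := \sum_(j < n | (i <= j)%N) e j.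

Lemma tailM i j : tail i * tail j = tail (maxn i j).
Proof.
rewrite /tail big_distrl /= [RHS](eq_bigl (fun l : 'I_n => (i <= l) && (j <= l))%N);
  last by move=> l; rewrite geq_max.
rewrite [RHS]big_mkcondr; apply: eq_bigr => l _.
rewrite big_distrr big_mkcond (bigD1 l) //= big1 ?addr0 ?ci_idem //.
by move=> m ml; case: ifP => // _; rewrite ci_orth // eq_sym.
Qed.

Lemma tail_idem_proof i : is_idempotent (tail i).
Proof. by rewrite /is_idempotent tailM maxnn. Qed.

Definition tail_idem i : idem R := Idem (tail_idem_proof i).

Lemma in_corner_tailS i : tail i.+1 \in in_peirce (tail_idem i) (tail_idem i).
Proof.
rewrite unfold_in /in_peirce /= !tailM (maxn_idPr (leqnSn i)).
by rewrite (maxn_idPl (leqnSn i)).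
Qed.

(* f_{i+1} as an element of f_i R f_i. *)
Definition corner_tailS i : corner (tail_idem i) := Peirce (in_corner_tailS i).

Lemma corner_tailS_idem_proof i : is_idempotent (corner_tailS i : corner (tail_idem i)).
Proof. by apply/val_inj; rewrite /= tailM maxnn. Qed.

Definition corner_tailS_idem i : idem (corner (tail_idem i)) :=
  Idem (@corner_tailS_idem_proof i).

Definition strongly_costratifying_chain : Prop :=
  forall i, (i.+1 < n)%N -> strongly_stratifying (corner_tailS_idem i).
End Chain.

(* Main.v *)
(* Let e be an idempotent of G, B = eGe, f = 1 - e and A = fGf. By duality    *)
(* over k, Tor_m^B(Ge, eG) = 0 if and only if                                 *)
(* H^m(B; Hom_k(Ge, Hom_k(eG, Y))) = 0 for all Y, HH_m(G) = 0 if and only if  *)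
(* H^m(G; Hom_k(G, k)) = 0, and Ext_G^m(X, Y) = H^m(G; Hom_k(X, Y)), so the   *)
(* argument is about the vanishing of Hochschild cohomology, for which        *)
(* H^(m+1)(G; X) is the H^m of another bimodule on Hom_k(G, X).               *)
(* If GeG is strongly stratifying, then A = G/GeG, there are exact sequences  *)
(*   0 -> Hom(A, Y) -> Hom(G, Y) -> Hom(Ge (x)_B eG, Y) -> 0,                 *)
(* and if X has commuting structures of an acyclic G-bimodule and an acyclic  *)
(* B-bimodule, then H^m(G; X^B) and H^m(B; X^G) vanish together. This yields  *)
(* H^*(A; X) = H^*(G; X) for A-bimodules X. The ring A is a retract of G, so  *)
(* if HH_*(G) is finite, then HH_*(A) is, and HH_*(B) is by the sequence for  *)
(* Y = k. Conversely, if A and B have finite global dimension, then A-modules *)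
(* have bounded dimension over G, and so has every G-module X, by comparison  *)
(* with Ge (x)_k eX and induction on the dimension of eX over B.              *)
(* Along the chain, A = e_i L e_i and B is the next corner. The algebras      *)
(* e_i L e_i are local because their only idempotents are 0 and 1.            *)

From HB Require Import structures.
Require Import Defs.
From mathcomp Require Import all_boot all_algebra all_field.
From mathcomp Require Import boolp classical_sets.

Set Implicit Arguments.
Unset Strict Implicit.
Unset Printing Implicit Defensive.

Import GRing.Theory.
Local Open Scope ring_scope.

(** The proof is an induction along the chain ([Han_tail]). It rests on two facts about a strongly
    stratifying ideal GeG, where B = eGe, f = 1 - e and A = fGf. Finiteness of Hochschild homology
    descends from G to A and B ([finHH_strat]), and finiteness of global dimension ascends from A
    and B to G ([fin_extdim_strat]). For G = f_i L f_i and e = f_(i+1), the algebra A is the corner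
    at one primitive idempotent. It is local ([corner_falg_local]), so the assumption on local
    algebras applies to it, while B is the next algebra of the chain.

    Both facts come from one exact sequence ([bal_ses]). Since fGe (x)_B eGf = 0, the map x |-> f x
    f is multiplicative ([rAM]) with kernel GeG, and the multiplication Ge (x)_B eG -> G is
    injective ([bal_pqm], in dual form). Moreover Tor^B(Ge, eG) vanishes in positive degrees and Ge
    is projective over G. A double complex argument ([inv_double]) therefore shows that the
    G-cohomology of the balanced maps on Ge x eG and the B-cohomology of the G-linear maps Ge ->
    Hom(eG, Y) vanish together.

    For Y = k, the dual of B is a retract of these G-linear maps. Vanishing for the duals of G and A
    thus gives vanishing for the dual of B ([HV_dualB]); coefficients pass from A to G by [HV_pull],
    and A is an algebra retract of G ([HV_dualA]). For a G-module Y, the G-linear maps are Hom(eG,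
    eY), so Ext over G out of Ge (x)_B eG is controlled by Ext over B. This bounds the dimension of
    A over G ([Pd_A]), then of all A-modules ([Pd_pull]), then of all G-modules ([Pd_epart]).

    The definitions by projective resolutions are linked to cohomology through acyclic resolutions
    ([HV_acyclic_res]), which give [Tor_HV], [HH_HV], [finite_gldim_extdim] and
    [extdim_finite_gldim]. *)

(** * Identities in abelian groups, by reflection *)

Inductive zexp := ZVar of nat | ZZero | ZAdd of zexp & zexp | ZOpp of zexp.

Fixpoint zeval (V : zmodType) (env : seq V) e : V :=
  match e with
  | ZVar i => nth 0 env i
  | ZZero => 0
  | ZAdd e1 e2 => zeval env e1 + zeval env e2
  | ZOpp e1 => - zeval env e1
  end.

Fixpoint zcoef e (i : nat) : int :=
  match e with
  | ZVar j => (i == j)%:Z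
  | ZZero => 0
  | ZAdd e1 e2 => zcoef e1 i + zcoef e2 i
  | ZOpp e1 => - zcoef e1 i
  end.

Lemma zeval_sum (V : zmodType) (env : seq V) e :
  zeval env e = \sum_(i < size env) nth 0 env i *~ zcoef e i.
Proof.
elim: e => [j||e1 IH1 e2 IH2|e IH] /=.
- have [jn|nj] := ltnP j (size env).
    rewrite (bigD1 (Ordinal jn)) //= eqxx mulr1z big1 ?addr0 // => i /eqP ij.
    by case: eqP => [ji|]; [case: ij; apply: val_inj|rewrite mulr0z].
  rewrite nth_default // big1 // => i _; case: eqP => [ij|]; last by rewrite mulr0z.
  by have := ltn_ord i; rewrite ij ltnNge nj.
- by rewrite big1 // => i _; rewrite mulr0z.
- by rewrite IH1 IH2 -big_split; apply: eq_bigr => i _; rewrite mulrzDr.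
- by rewrite IH -sumrN; apply: eq_bigr => i _; rewrite mulrNz.
Qed.

(** By [zeval_sum] both sides are integer combinations of the atoms. Indices beyond [env] evaluate
    to the default 0, so only coefficients below [size env] are compared. *)
Lemma zevalP (V : zmodType) (env : seq V) e1 e2 :
  all (fun i => zcoef e1 i == zcoef e2 i) (iota 0 (size env)) ->
  zeval env e1 = zeval env e2.
Proof.
move=> /allP e12; rewrite !zeval_sum; apply: eq_bigr => i _.
by rewrite (eqP (e12 i _)) // mem_iota ltn_ord.
Qed.

(** The inner match runs [unify] while the index is being computed, so that convertible atoms share
    one variable. *)
Ltac zmod_index env x :=
  lazymatch env with
  | ?y :: ?env' => match constr:(tt) with
    | _ => let _ := match constr:(tt) with _ => unify x y end in constr:(0%N)
    | _ => let i := zmod_index env' x in constr:(i.+1)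
    end
  end.
Ltac zmod_env env e :=
  lazymatch e with
  | 0 => env
  | ?x + ?y => let env := zmod_env env x in zmod_env env y
  | - ?x => zmod_env env x
  | _ => match constr:(tt) with
    | _ => let _ := zmod_index env e in env
    | _ => constr:(e :: env)
    end
  end.
Ltac zmod_reify env e :=
  lazymatch e with
  | 0 => constr:(ZZero)
  | ?x + ?y =>
    let x := zmod_reify env x in let y := zmod_reify env y in constr:(ZAdd x y)
  | - ?x => let x := zmod_reify env x in constr:(ZOpp x)
  | _ => let i := zmod_index env e in constr:(ZVar i)
  end.
(* Decides identities that hold in every abelian group. *)
Ltac zmod :=
  lazymatch goal with
  | |- @eq ?T ?a ?b =>
    let env := zmod_env (@nil T) a in
    let env := zmod_env env b in
    let ea := zmod_reify env a in
    let eb := zmod_reify env b in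
    apply: (@zevalP _ env ea eb); vm_compute; reflexivity
  end.

(** * Linear algebra over a field in arbitrary dimension *)

Section Hom.
Variables (k : fieldType) (U V : lmodType k).

(** The type of linear maps is made a k-module itself, so that spaces such as Hom(P, Hom(Q, Y)) can
    be formed and the cochain construction can be iterated. *)
Record hom := Hom {
  hom_fun :> U -> V;
  hom_subproof : forall (c : k) x y, hom_fun (c *: x + y) = c *: hom_fun x + hom_fun y
}.

HB.instance Definition _ := gen_eqMixin hom.
HB.instance Definition _ := gen_choiceMixin hom.
HB.instance Definition _ (f : hom) :=
  GRing.isLinear.Build k U V *:%R (hom_fun f) (@hom_subproof f).

Lemma homP (f g : hom) : f =1 g -> f = g.
Proof.
case: f g => f Lf [g Lg] /= /funext fg; rewrite -{}fg in Lg *.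
by congr Hom; apply: Prop_irrelevance.
Qed.

Lemma happly (f g : hom) x : f = g -> f x = g x.
Proof. by move->. Qed.

Fact hom0_subproof (c : k) (x y : U) : (0 : V) = c *: 0 + 0.
Proof. by rewrite scaler0 addr0. Qed.
Definition hom0 : hom := @Hom (fun=> 0) hom0_subproof.

Fact homD_subproof (f g : hom) (c : k) x y :
  f (c *: x + y) + g (c *: x + y) = c *: (f x + g x) + (f y + g y).
Proof. by rewrite !linearP scalerDr addrACA. Qed.
Definition homD (f g : hom) : hom := Hom (homD_subproof f g).

Fact homN_subproof (f : hom) (c : k) x y : - f (c *: x + y) = c *: (- f x) + - f y.
Proof. by rewrite linearP opprD scalerN. Qed.
Definition homN (f : hom) : hom := Hom (homN_subproof f).

Fact homZ_subproof (a : k) (f : hom) (c : k) x y :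
  a *: f (c *: x + y) = c *: (a *: f x) + a *: f y.
Proof. by rewrite linearP scalerDr !scalerA mulrC. Qed.
Definition homZ a (f : hom) : hom := Hom (homZ_subproof a f).

Fact hom_addA : associative homD.
Proof. by move=> f g h; apply: homP => x; apply: addrA. Qed.
Fact hom_addC : commutative homD.
Proof. by move=> f g; apply: homP => x; apply: addrC. Qed.
Fact hom_add0 : left_id hom0 homD.
Proof. by move=> f; apply: homP => x; apply: add0r. Qed.
Fact hom_addN : left_inverse hom0 homN homD.
Proof. by move=> f; apply: homP => x; apply: addNr. Qed.
HB.instance Definition _ :=
  GRing.isZmodule.Build hom hom_addA hom_addC hom_add0 hom_addN.

Fact hom_scaleA a b f : homZ a (homZ b f) = homZ (a * b) f.
Proof. by apply: homP => x; apply: scalerA. Qed.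
Fact hom_scale1 : left_id 1 homZ.
Proof. by move=> f; apply: homP => x; apply: scale1r. Qed.
Fact hom_scaleDr : right_distributive homZ +%R.
Proof. by move=> a f g; apply: homP => x; apply: scalerDr. Qed.
Fact hom_scaleDl f : {morph homZ^~ f : a b / a + b}.
Proof. by move=> a b; apply: homP => x; apply: scalerDl. Qed.
HB.instance Definition _ := GRing.Zmodule_isLmodule.Build k hom
  hom_scaleA hom_scale1 hom_scaleDr hom_scaleDl.

Lemma homDE (f g : hom) x : (f + g) x = f x + g x. Proof. by []. Qed.
Lemma homNE (f : hom) x : (- f) x = - f x. Proof. by []. Qed.
Lemma homZE a (f : hom) x : (a *: f) x = a *: f x. Proof. by []. Qed.
Lemma hom0E x : (0 : hom) x = 0. Proof. by []. Qed.
Definition homE := (homDE, homNE, homZE, hom0E).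

Variable f : hom.
Lemma hom_lin (c : k) x y : f (c *: x + y) = c *: f x + f y.
Proof. exact: hom_subproof. Qed.
Lemma hom_0 : f 0 = 0. Proof. exact: linear0. Qed.
Lemma hom_D x y : f (x + y) = f x + f y. Proof. exact: linearD. Qed.
Lemma hom_N x : f (- x) = - f x. Proof. exact: linearN. Qed.
Lemma hom_B x y : f (x - y) = f x - f y. Proof. exact: linearB. Qed.
Lemma hom_Z (c : k) x : f (c *: x) = c *: f x. Proof. exact: linearZ. Qed.
End Hom.

Section Sub.
Variables (R : pzRingType) (V : lmodType R).

Record subsp := Subsp {
  in_subsp :> V -> Prop;
  subsp0 : in_subsp 0;
  subspP : forall (c : R) x y, in_subsp x -> in_subsp y -> in_subsp (c *: x + y)
}.

Definition subsp_pred (S : subsp) : {pred V} := fun x => `[< S x >].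

Fact subsp_closed S : subsemimod_closed (subsp_pred S).
Proof.
split=> [|c x /asboolP Sx].
  split=> [|x y /asboolP Sx /asboolP Sy]; apply/asboolP; first exact: subsp0.
  by rewrite -[x]scale1r; apply: subspP.
by apply/asboolP; rewrite -[_ *: _]addr0; apply: subspP => //; apply: subsp0.
Qed.
HB.instance Definition _ S := GRing.isSubmodClosed.Build R V (subsp_pred S) (subsp_closed S).

Record sub (S : subsp) := Sub_ { sub_val :> V; _ : sub_val \in subsp_pred S }.
HB.instance Definition _ S := [isSub for @sub_val S].
HB.instance Definition _ S := [Choice of sub S by <:].
HB.instance Definition _ S := [SubChoice_isSubLmodule of sub S by <:].

Definition mksub (S : subsp) x (Sx : S x) : sub S := Sub_ (asboolT Sx : x \in subsp_pred S).
Lemma subP (S : subsp) (x : sub S) : S x.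
Proof. by case: x => x /= /asboolP. Qed.
Lemma sub_inj S : injective (@sub_val S). Proof. exact: val_inj. Qed.

Lemma subsp_lin (S : subsp) : forall (c : R) x y, sub_val (c *: x + y : sub S) = c *: sub_val x + sub_val y.
Proof. by []. Qed.

Lemma subspB (S : subsp) x y : S x -> S y -> S (x - y).
Proof. by move=> Sx Sy; rewrite addrC -scaleN1r; apply: subspP. Qed.
Lemma subspZ (S : subsp) c x : S x -> S (c *: x).
Proof. by move=> Sx; rewrite -[_ *: _]addr0; apply: subspP => //; apply: subsp0. Qed.
End Sub.

Definition sub_hom (k : fieldType) (V : lmodType k) (S : subsp V) : hom (sub S) V :=
  Hom (@subsp_lin k V S).

Section HomComp.
Variables (k : fieldType) (U V W : lmodType k).

Fact hcomp_subproof (g : hom V W) (f : hom U V) (c : k) x y :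
  g (f (c *: x + y)) = c *: g (f x) + g (f y).
Proof. by rewrite !hom_lin. Qed.
Definition hcomp (g : hom V W) (f : hom U V) : hom U W := Hom (hcomp_subproof g f).
Lemma hcompE g f x : hcomp g f x = g (f x). Proof. by []. Qed.

Fact ker_subproof (f : hom U V) (c : k) x y : f x = 0 -> f y = 0 -> f (c *: x + y) = 0.
Proof. by move=> fx fy; rewrite hom_lin fx fy scaler0 addr0. Qed.
Definition ker (f : hom U V) : subsp U := Subsp (hom_0 f) (@ker_subproof f).

Fact im0_subproof (f : hom U V) : exists x, f x = 0.
Proof. by exists 0; rewrite hom_0. Qed.
Fact im_subproof (f : hom U V) (c : k) y z :
  (exists x, f x = y) -> (exists x, f x = z) -> exists x, f x = c *: y + z.
Proof. by move=> [x <-] [x' <-]; exists (c *: x + x'); rewrite hom_lin. Qed.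
Definition im (f : hom U V) : subsp V := Subsp (im0_subproof f) (@im_subproof f).
End HomComp.

Fact idh_subproof (k : fieldType) (U : lmodType k) (c : k) (x y : U) :
  c *: x + y = c *: x + y.
Proof. by []. Qed.
Definition idh (k : fieldType) (U : lmodType k) : hom U U := Hom (@idh_subproof k U).

Section Complement.
Variables (k : fieldType) (V : lmodType k) (S : subsp V).

Let good (A : set V) := (forall (c : k) x y, A x -> A y -> A (c *: x + y)) /\
  forall x, A x -> S x -> x = 0.

(** Zorn's lemma for sets closed under linear combinations that meet S at most in 0. *)
Lemma complement_exists : exists A : subsp V,
  (forall x, A x -> S x -> x = 0) /\
  forall x, exists s, S s /\ A (x - s).
Proof.
have [F Fgood Ftot|A [[Alin Adis] Amax]] := @Zorn_bigcup V good.
  split=> [c x y [X FX Xx] [Y FY Yy]|x [X FX Xx]]; last exact: (Fgood X FX).2.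
  have [XY|YX] := Ftot _ _ FX FY.
    by exists Y => //; apply: (Fgood Y FY).1 => //; apply: XY.
  by exists X => //; apply: (Fgood X FX).1 => //; apply: YX.
(* [good] admits the empty set, which covers the union of the empty chain; a maximal good set is not
   empty because {0} would be larger. *)
have A0 : A 0.
  have [[x Ax]|noA] := pselect (exists x, A x).
    by rewrite -(subrr x) addrC -scaleN1r; apply: Alin.
  exfalso; apply: (Amax [set 0]%classic).
    split=> [x Ax|A0]; first by case: noA; exists x.
    by apply: noA; exists 0; apply: A0.
  by split=> [c x y -> ->|x -> //]; rewrite scaler0 addr0.
exists (Subsp A0 Alin); split=> // x.
have [//|nox] := pselect (exists s, S s /\ A (x - s)); exfalso.
(* If x is not in S + A, then kx + A is still good: an element c x + a of S with c nonzero would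
   write x as an element of S plus one of A. *)
pose B := [set c *: x + a | c in [set: k] & a in A]%classic.
have Bx : B x by exists 1 => //; exists 0 => //; rewrite scale1r addr0.
apply: (Amax B); first split.
- by move=> a Aa; exists 0 => //; exists a => //; rewrite scale0r add0r.
- by move=> BA; apply: nox; exists 0; split; [exact: subsp0|rewrite subr0; apply: BA].
split.
  move=> c _ _ [a _ [u Au <-]] [b _ [v Av <-]]; exists (c * a + b) => //.
  exists (c *: u + v); first exact: Alin.
  by rewrite scalerDr scalerDl scalerA addrACA.
move=> _ [c _ [a Aa <-]] Sxa; have [c0|c0] := eqVneq c 0.
  by rewrite c0 scale0r add0r in Sxa *; apply: Adis.
case: nox; exists (c^-1 *: (c *: x + a)); split; first exact: subspZ.
rewrite scalerDr scalerA mulVf // scale1r opprD addNKr -scalerN -[_ *: _]addr0.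
by apply: (Alin) => //; rewrite -[- a]addr0 -scaleN1r; apply: (Alin).
Qed.

Lemma lin_proj : exists p : hom V V, (forall x, S (p x)) /\ forall x, S x -> p x = x.
Proof.
have [A [Adis Asum]] := complement_exists.
have uniq x s t : S s -> A (x - s) -> S t -> A (x - t) -> s = t.
  move=> Ss As St At; apply/eqP; rewrite -subr_eq0; apply/eqP.
  apply: Adis; last exact: subspB.
  have -> : s - t = (x - t) - (x - s) by rewrite opprB [RHS]addrC addrA subrK.
  exact: subspB.
have [p pP] := choice Asum.
have p_lin (c : k) x y : p (c *: x + y) = c *: p x + p y.
  apply: (@uniq (c *: x + y)); try exact: (pP _).1; try exact: (pP _).2.
    by apply: subspP; apply: (pP _).1.
  have -> : c *: x + y - (c *: p x + p y) = c *: (x - p x) + (y - p y).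
    by rewrite opprD scalerBr addrACA.
  by apply: subspP; apply: (pP _).2.
exists (Hom p_lin); split=> x /=; first exact: (pP x).1.
move=> Sx; apply: (@uniq x) => //; [exact: (pP x).1|exact: (pP x).2|].
by rewrite subrr; apply: subsp0.
Qed.
End Complement.

Section Lifting.
Variables (k : fieldType).

(** Vector spaces are projective. A set-theoretic lift becomes linear once its component in the
    kernel of g is subtracted, since x - p x depends only on g x. *)
Lemma lin_lift (X Y Z : lmodType k) (g : hom X Y) (h : hom Z Y) :
  (forall z, exists x, g x = h z) -> exists l : hom Z X, forall z, g (l z) = h z.
Proof.
move=> /choice [r gr]; have [p [pK pid]] := lin_proj (ker g).
have u_eq x x' : g x = g x' -> x - p x = x' - p x'.
  move=> gx; have pd : p (x - x') = x - x' by apply: pid; rewrite /= hom_B gx subrr.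
  have -> : x - p x = x - x' + x' - p x by zmod.
  by rewrite -pd hom_B; zmod.
have l_lin (c : k) x y : r (c *: x + y) - p (r (c *: x + y)) =
    c *: (r x - p (r x)) + (r y - p (r y)).
  rewrite (u_eq _ (c *: r x + r y)); last by rewrite !hom_lin !gr hom_lin.
  by rewrite hom_lin scalerBr opprD addrACA.
exists (Hom l_lin) => z /=; rewrite hom_B /= gr; move: (pK (r z)) => /= ->.
by rewrite subr0.
Qed.

(** Vector spaces are injective: f descends to the image of g, and a projection onto that image
    extends it to Y. *)
Lemma lin_factor (X Y V : lmodType k) (g : hom X Y) (f : hom X V) :
  (forall x, g x = 0 -> f x = 0) -> exists h : hom Y V, forall x, f x = h (g x).
Proof.
move=> gf; have [p [pI pid]] := lin_proj (im g).
have [r gr] := lin_lift pI.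
exists (hcomp f r) => x /=; apply/eqP; rewrite -subr_eq0 -hom_B; apply/eqP/gf.
by rewrite hom_B gr pid ?subrr //; exists x.
Qed.

(** This is what allows a return from statements about duals to statements about tensor products. *)
Lemma lin_sep (V : lmodType k) (S : subsp V) x : ~ S x ->
  exists f : hom V k^o, (forall s, S s -> f s = 0) /\ f x <> 0.
Proof.
move=> Sx; have [p [pS pid]] := lin_proj S.
have y0 : x - p x != 0 by apply/eqP=> /subr0_eq xp; apply: Sx; rewrite xp.
have q_lin (c : k) u v : (c *: u + v) - p (c *: u + v) = c *: (u - p u) + (v - p v).
  by rewrite hom_lin scalerBr opprD addrACA.
have g_lin (c : k) (u v : k^o) :
    (c *: u + v) *: (x - p x) = c *: (u *: (x - p x)) + v *: (x - p x).
  by rewrite scalerDl scalerA.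
have [c /= /eqP|h hP] := @lin_factor _ _ _ (Hom g_lin) (idh k^o).
  by rewrite scaler_eq0 (negPf y0) orbF => /eqP.
exists (hcomp h (Hom q_lin)); split=> [s Ss|] /=; first by rewrite pid // subrr hom_0.
have /= := hP 1; rewrite scale1r => <-; exact/eqP/oner_neq0.
Qed.
End Lifting.

Definition linE := (hom_D, hom_N, hom_Z, hom_0, hcompE, homE, scalerDr, scalerN, scaler0).

Section Hom2.
Variables (k : fieldType) (U V W : lmodType k) (f : U -> V -> W).
Hypothesis f2 : forall u (c : k) v v', f u (c *: v + v') = c *: f u v + f u v'.
Hypothesis f1 : forall (c : k) u u' v, f (c *: u + u') v = c *: f u v + f u' v.
Fact hom2_subproof (c : k) u u' :
  Hom (f2 (c *: u + u')) = c *: Hom (f2 u) + Hom (f2 u').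
Proof. by apply: homP => v; rewrite !homE /= f1. Qed.
Definition hom2 : hom U (hom V W) := Hom hom2_subproof.
End Hom2.

Section Hom3.
Variables (k : fieldType) (U V W X : lmodType k) (f : U -> V -> W -> X).
Hypothesis f3 : forall u v (c : k) w w', f u v (c *: w + w') = c *: f u v w + f u v w'.
Hypothesis f2 : forall u (c : k) v v' w, f u (c *: v + v') w = c *: f u v w + f u v' w.
Hypothesis f1 : forall (c : k) u u' v w, f (c *: u + u') v w = c *: f u v w + f u' v w.
Fact hom3_subproof (c : k) u u' :
  hom2 (f3 (c *: u + u')) (f2 (c *: u + u')) =
  c *: hom2 (f3 u) (f2 u) + hom2 (f3 u') (f2 u').
Proof. by apply: homP => v; apply: homP => w; rewrite !homE /= f1. Qed.
Definition hom3 : hom U (hom V (hom W X)) := Hom hom3_subproof.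
End Hom3.

Ltac linz := intros; rewrite ?linE /=; rewrite ?linE; zmod.

Section Swap.
Variables (k : fieldType) (U V X : lmodType k).
Definition hswap (f : hom U (hom V X)) : hom V (hom U X).
refine (@hom2 _ _ _ _ (fun v u => f u v) _ _); by abstract linz.
Defined.
Definition hswaph : hom (hom U (hom V X)) (hom V (hom U X)).
refine (@Hom _ _ _ hswap _); by abstract (move=> *; do 2!apply: homP => ?; linz).
Defined.

Definition hev (u : U) : hom (hom U V) V.
refine (@Hom _ _ _ (fun f : hom U V => f u) _); by abstract linz.
Defined.
End Swap.

Section Actions.
Variables (k : fieldType) (G W X : lmodType k).

Definition pt_act (l : hom G (hom X X)) : hom G (hom (hom W X) (hom W X)).
refine (@hom3 _ _ _ _ _ (fun (a : G) (F : hom W X) (w : W) => l a (F w)) _ _ _);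
by abstract linz.
Defined.

Definition pre_act (l : hom G (hom W W)) : hom G (hom (hom W X) (hom W X)).
refine (@hom3 _ _ _ _ _ (fun (a : G) (F : hom W X) (w : W) => F (l a w)) _ _ _);
by abstract linz.
Defined.
End Actions.

(** * Hochschild cohomology *)

Section Algebra.
Variable k : fieldType.

(** Neither finite dimension nor 1 <> 0 is required, so that corners, converse rings and enveloping
    algebras all fit. *)
Record kalg := KAlg {
  kcar :> lmodType k;
  kmul : hom kcar (hom kcar kcar);
  kone : kcar;
  kmulA : forall a b c, kmul a (kmul b c) = kmul (kmul a b) c;
  kmul1l : forall a, kmul kone a = a;
  kmul1r : forall a, kmul a kone = a
}.

Arguments kmul {_}.

Section Bimodule.
Variable G : kalg.

(* No unitality is asked for: the right action of [homtw] below is not unital. *)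
Record bimod (X : lmodType k) := Bimod {
  la : hom G (hom X X);
  ra : hom G (hom X X);
  laA : forall a b x, la a (la b x) = la (kmul a b) x;
  raA : forall a b x, ra b (ra a x) = ra (kmul a b) x;
  lara : forall a b x, la a (ra b x) = ra b (la a x)
}.

Definition invt X (s : bimod X) (x : X) : Prop := forall a, la s a x = ra s a x.

Definition ad X (s : bimod X) (x : X) : hom G X.
refine (@Hom _ _ _ (fun a => la s a x - ra s a x) _).
by abstract linz.
Defined.

Section HomTw.
Variables (X : lmodType k) (s : bimod X).

Definition tw_la : hom G (hom (hom G X) (hom G X)) := pt_act G (la s).
Definition tw_ra : hom G (hom (hom G X) (hom G X)).
refine (@hom3 _ _ _ _ _ (fun (a : G) (F : hom G X) (b : G) =>
  F (kmul a b) - ra s b (F a)) _ _ _); by abstract linz.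
Defined.

Fact tw_laA a b F : tw_la a (tw_la b F) = tw_la (kmul a b) F.
Proof. by apply: homP => c; apply: laA. Qed.
Fact tw_raA a b F : tw_ra b (tw_ra a F) = tw_ra (kmul a b) F.
Proof. by apply: homP => c /=; rewrite !linE kmulA raA; zmod. Qed.
Fact tw_lara a b F : tw_la a (tw_ra b F) = tw_ra b (tw_la a F).
Proof. by apply: homP => c /=; rewrite !linE lara. Qed.

(* C^(n+1)(G; X) = C^n(G; homtw X), differentials included. *)
Definition homtw : bimod (hom G X) := Bimod tw_laA tw_raA tw_lara.
End HomTw.

(* H^(n+1)(G; X) = 0: derivations are the invariants of [homtw]. *)
Fixpoint HV (n : nat) (X : lmodType k) (s : bimod X) : Prop :=
  match n with
  | 0 => forall D, invt (homtw s) D -> exists x, D = ad s x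
  | n'.+1 => HV n' (homtw s)
  end.

Definition bmap X Y (s : bimod X) (t : bimod Y) (f : hom X Y) : Prop :=
  (forall a x, f (la s a x) = la t a (f x)) /\
  (forall a x, f (ra s a x) = ra t a (f x)).

Definition hpost (W X Y : lmodType k) (f : hom X Y) : hom (hom W X) (hom W Y).
refine (@Hom _ _ _ (fun F => hcomp f F) _).
by abstract (move=> *; apply: homP => ?; linz).
Defined.

Definition hpre (W X Y : lmodType k) (f : hom X Y) : hom (hom Y W) (hom X W).
refine (@Hom _ _ _ (fun F => hcomp F f) _).
by abstract (move=> *; apply: homP => ?; linz).
Defined.

Lemma bmap_tw X Y (s : bimod X) (t : bimod Y) f :
  bmap s t f -> bmap (homtw s) (homtw t) (hpost G f).
Proof.
move=> [fl fr]; split=> a F; apply: homP => b /=; first exact: fl.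
by rewrite !linE fr.
Qed.

Lemma bmap_inv X Y (s : bimod X) (t : bimod Y) f x :
  bmap s t f -> invt s x -> invt t (f x).
Proof. by move=> [fl fr] sx a; rewrite -fl sx fr. Qed.

Lemma bmap_ad X Y (s : bimod X) (t : bimod Y) f x :
  bmap s t f -> ad t (f x) = hcomp f (ad s x).
Proof. by move=> [fl fr]; apply: homP => a /=; rewrite !linE fl fr. Qed.

Lemma inv_ad X (s : bimod X) x : invt (homtw s) (ad s x).
Proof. by move=> a; apply: homP => b /=; rewrite !linE laA lara raA; zmod. Qed.

Lemma ad0_inv X (s : bimod X) x : ad s x = 0 -> invt s x.
Proof. by move=> sx a; apply/eqP; rewrite -subr_eq0 -[_ - _]/(ad s x a) sx. Qed.

Lemma inv_ad0 X (s : bimod X) x : invt s x -> ad s x = 0.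
Proof. by move=> sx; apply: homP => a /=; rewrite sx subrr. Qed.

Lemma adB X (s : bimod X) x y : ad s (x - y) = ad s x - ad s y.
Proof. by apply: homP => a /=; rewrite !linE; zmod. Qed.

Lemma invtB X (s : bimod X) x y : invt s x -> invt s y -> invt s (x - y).
Proof. by move=> sx sy; apply: ad0_inv; rewrite adB !inv_ad0 // subrr. Qed.

Lemma HV_retract n X Y (s : bimod X) (t : bimod Y) i p :
  bmap s t i -> bmap t s p -> (forall x, p (i x) = x) -> HV n t -> HV n s.
Proof.
elim: n X Y s t i p => [|n IHn] X Y s t i p si ps pi; last first.
  by apply: IHn (bmap_tw si) (bmap_tw ps) _ => F; apply: homP => b; apply: pi.
move=> Vt D /(bmap_inv (bmap_tw si))/Vt [y iD]; exists (p y).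
by rewrite (bmap_ad _ ps) -iD; apply: homP => a /=; rewrite pi.
Qed.

Record ses X' X X'' (s' : bimod X') (s : bimod X) (s'' : bimod X'')
    (i : hom X' X) (p : hom X X'') : Prop := Ses {
  ses_i : bmap s' s i;
  ses_p : bmap s s'' p;
  ses_inj : forall x, i x = 0 -> x = 0;
  ses_surj : forall z, exists x, p x = z;
  ses_pi : forall x, p (i x) = 0;
  ses_exact : forall x, p x = 0 -> exists x', i x' = x
}.

Arguments ses_i {X' X X'' s' s s'' i p}.
Arguments ses_p {X' X X'' s' s s'' i p}.
Arguments ses_inj {X' X X'' s' s s'' i p} _ {x}.
Arguments ses_surj {X' X X'' s' s s'' i p}.
Arguments ses_pi {X' X X'' s' s s'' i p}.
Arguments ses_exact {X' X X'' s' s s'' i p} _ {x}.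

Section LES.
Variables (X' X X'' : lmodType k) (s' : bimod X') (s : bimod X) (s'' : bimod X'').
Variables (i : hom X' X) (p : hom X X'').
Hypothesis E : ses s' s s'' i p.

(** Exact sequences of vector spaces stay exact under Hom(G, -) by [lin_lift]. This is what makes
    dimension shifting along [homtw] possible. *)
Lemma ses_tw : ses (homtw s') (homtw s) (homtw s'') (hpost G i) (hpost G p).
Proof.
case: E => si sp i0 p1 pi ex; split; try exact: bmap_tw.
- by move=> F iF; apply: homP => a; apply: i0; rewrite -[LHS]/(hpost G i F a) iF.
- move=> F; have [a|F' F'P] := @lin_lift _ _ _ _ p F; first exact: p1.
  by exists F'; apply: homP.
- by move=> F; apply: homP => a; apply: pi.
- move=> F pF; have [a|F' F'P] := @lin_lift _ _ _ _ i F.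
    by apply: ex; rewrite -[LHS]/(hpost G p F a) pF.
  by exists F'; apply: homP.
Qed.

Lemma ses_injB x y : i x = i y -> x = y.
Proof.
move=> xy; apply/eqP; rewrite -subr_eq0; apply/eqP/(ses_inj E).
by rewrite hom_B xy subrr.
Qed.

Lemma inv_ses_inj x : invt s (i x) -> invt s' x.
Proof. by case: (ses_i E) => il ir ix a; apply: ses_injB; rewrite il ir. Qed.

(** Exactness of H^0(X) -> H^0(X'') -> H^1(X'). For a preimage x of z, the derivation [ad s x] takes
    values in X', so it is inner there, and subtracting its potential makes x invariant. *)
Lemma inv_lift : HV 0 s' -> forall z, invt s'' z -> exists x, invt s x /\ p x = z.
Proof.
move=> V z z_inv; have [x px] := ses_surj E z.
have xz : forall a, exists x', i x' = ad s x a.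
  move=> a; apply: (ses_exact E); rewrite -[LHS]/(hcomp p (ad s x) a).
  by rewrite -(bmap_ad _ (ses_p E)) px inv_ad0.
have [D iD] := lin_lift xz.
have [|x' Dx'] := V D.
  move=> a; apply: homP => b; apply: ses_injB; have [il ir] := ses_i E.
  move: (congr1 (fun F : hom G X => F b) (inv_ad s x a)) => /=.
  by rewrite !linE il ir !iD !linE /= => ->.
exists (x - i x'); split; last by rewrite hom_B px (ses_pi E) subr0.
apply: ad0_inv; rewrite adB (bmap_ad _ (ses_i E)) -Dx'.
by apply: homP => a; rewrite [LHS]/= iD /= subrr.
Qed.

Lemma HV0_ker : HV 0 s ->
  (forall z, invt s'' z -> exists x, invt s x /\ p x = z) -> HV 0 s'.
Proof.
move=> V lift D D_inv.
have [x iDx] := V _ (bmap_inv (bmap_tw (ses_i E)) D_inv).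
have [|y [y_inv py]] := lift (p x).
  apply: ad0_inv; rewrite (bmap_ad _ (ses_p E)) -iDx.
  by apply: homP => a; apply: (ses_pi E).
have [|x' ix'] := ses_exact E (x := x - y); first by rewrite hom_B py subrr.
exists x'; apply: homP => a; apply: ses_injB.
rewrite -[i (ad _ _ _)]/(hcomp i (ad s' x') a) -(bmap_ad _ (ses_i E)) ix'.
by rewrite adB [ad s y]inv_ad0 // subr0 -iDx.
Qed.
End LES.

Section LESn.
Variables (X' X X'' : lmodType k) (s' : bimod X') (s : bimod X) (s'' : bimod X'').
Variables (i : hom X' X) (p : hom X X'').
Hypothesis E : ses s' s s'' i p.

(** This lemma, [HV_ext] and [HV_ker] are the three kinds of vanishing read off the long exact
    sequence. Each is reduced to the lowest degree by [ses_tw], where it is checked by hand. *)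
Lemma HV_coker n : HV n s -> HV n.+1 s' -> HV n s''.
Proof.
elim: n X' X X'' s' s s'' i p E => [|n IHn] Y' Y Y'' t' t t'' j q F; last first.
  exact: IHn (ses_tw F).
move=> V V' D /(inv_lift (ses_tw F) V') [D' [/V [x ->] <-]].
by exists (q x); rewrite (bmap_ad _ (ses_p F)).
Qed.

Lemma HV_ext n : HV n s' -> HV n s'' -> HV n s.
Proof.
elim: n X' X X'' s' s s'' i p E => [|n IHn] Y' Y Y'' t' t t'' j q F; last first.
  exact: IHn (ses_tw F).
move=> V' V'' D D_inv.
have [z Dz] := V'' _ (bmap_inv (bmap_tw (ses_p F)) D_inv).
have [x px] := ses_surj F z.
have [|D' jD'] := ses_exact (ses_tw F) (x := D - ad t x).
  by rewrite hom_B Dz -px (bmap_ad _ (ses_p F)) subrr.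
have [|x' D'x'] := V' D'.
  by apply: (inv_ses_inj (ses_tw F)); rewrite jD'; apply: invtB => //; apply: inv_ad.
exists (x + j x'); have -> : D = (D - ad t x) + ad t x by zmod.
rewrite -jD' D'x' -[hpost _ _ _]/(hcomp _ _) -(bmap_ad _ (ses_i F)).
by apply: homP => a /=; rewrite !linE; zmod.
Qed.

Lemma HV_ker n : HV n s'' -> HV n.+1 s -> HV n.+1 s'.
Proof.
elim: n X' X X'' s' s s'' i p E => [|n IHn] Y' Y Y'' t' t t'' j q F; last first.
  exact: IHn (ses_tw F).
move=> V V1; apply: (HV0_ker (ses_tw F) V1) => D /V [z ->].
have [x <-] := ses_surj F z; exists (ad t x); split; first exact: inv_ad.
by rewrite (bmap_ad _ (ses_p F)).
Qed.
End LESn.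
End Bimodule.
End Algebra.
Arguments kmul {_ _}.
Arguments kone {_ _}.

Section Param.
Variables (k : fieldType) (G : kalg k).

Definition hparam (W X : lmodType k) (s : bimod G X) : bimod G (hom W X).
refine (@Bimod _ G _ (pt_act W (la s)) (pt_act W (ra s)) _ _ _).
- by abstract (move=> a b F; apply: homP => w; apply: laA).
- by abstract (move=> a b F; apply: homP => w; apply: raA).
- by abstract (move=> a b F; apply: homP => w; apply: lara).
Defined.

Definition adh X (s : bimod G X) : hom X (hom G X).
refine (@Hom _ _ _ (ad s) _); by abstract (move=> *; apply: homP => ?; linz).
Defined.

(** Hom(W, -) is exact and G acts on values only. In degree one the potentials of the derivations
    D(-)(w) are chosen linearly in w by [lin_lift]; exchanging the arguments w and b identifies the
    two shifted bimodules. *)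
Lemma HV_param n (W X : lmodType k) (s : bimod G X) : HV n s -> HV n (hparam W s).
Proof.
elim: n X s => [|n IHn] X s.
  move=> V D D_inv; have [w|l lP] := @lin_lift _ _ _ _ (adh s) (hswap D).
    have [|x Dx] := V (hswap D w); last by exists x.
    by move=> a; apply: homP => b; apply: (happly w (happly b (D_inv a))).
  exists l; apply: homP => a; apply: homP => w.
  exact/esym/(happly a (lP w)).
move/IHn => V; apply: HV_retract (hswaph _ _ _) (hswaph _ _ _) _ _ _ V.
- by split=> a F; apply: homP => w; apply: homP => b.
- by split=> a F; apply: homP => w; apply: homP => b.
- by move=> F; apply: homP => w; apply: homP => b.
Qed.
End Param.

Section Coinduced.
Variables (k : fieldType) (G : kalg k).

(* [lam] is a contracting homotopy of the Hochschild complex in degree 1; it   *)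
(* induces one for [homtw s], hence in all higher degrees.                    *)
Definition rcoind (X : lmodType k) (s : bimod G X) : Prop :=
  exists lam : hom (hom G X) X,
    (forall a F, lam (la (homtw s) a F) = la s a (lam F)) /\
    (forall a (F : hom G X), F a = lam (ra (homtw s) a F) - ra s a (lam F)).

Lemma HV_rcoind n X (s : bimod G X) : rcoind s -> HV n s.
Proof.
elim: n X s => [|n IHn] X s [lam [laml lamr]].
  move=> D D_inv; exists (lam D); apply: homP => a.
  by rewrite [LHS]lamr -D_inv laml.
apply: IHn; exists (- hpost G lam); split=> a F; apply: homP => b.
  change (- lam (la (homtw s) a (F b)) = la s a (- lam (F b))).
  by rewrite laml hom_N.
change (F a b = - lam (F (kmul a b) - ra (homtw s) b (F a)) -
  (- lam (F (kmul a b)) - ra s b (- lam (F a)))).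
by rewrite [LHS]lamr !linE; zmod.
Qed.

(** X is a bimodule summand of the coinduced bimodule Hom(G, X): [lam] splits x |-> (a |-> a x), is
    left linear for (a F)(b) = F(b a) and right linear for the action on values. Applied to a
    derivation, it yields a potential. *)
Definition lcoind (X : lmodType k) (s : bimod G X) : Prop :=
  exists lam : hom (hom G X) X,
    [/\ forall x, lam (hswap (la s) x) = x,
        forall a F, lam (hcomp F (hswap kmul a)) = la s a (lam F)
      & forall a F, lam (hcomp (ra s a) F) = ra s a (lam F)].

Lemma HV_lcoind n X (s : bimod G X) : lcoind s -> HV n s.
Proof.
elim: n X s => [|n IHn] X s [lam [lam1 lam2 lam3]].
  move=> D D_inv; exists (lam D); apply: homP => b.
  rewrite /= -lam2 -lam3 -[LHS]lam1 -hom_B; congr (lam _); apply: homP => a /=.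
  exact: (happly b (D_inv a)).
apply: IHn; exists (hcomp (hpost G lam) (hswaph _ _ _)).
split=> [F|a F|a F]; apply: homP => c.
- by rewrite -[RHS]lam1 /=; congr (lam _); apply: homP.
- by rewrite /= -lam2; congr (lam _); apply: homP.
- rewrite /= -lam3 -hom_B; congr (lam _).
  by apply: homP.
Qed.
End Coinduced.

Section SubBimod.
Variables (k : fieldType) (G : kalg k) (X : lmodType k) (s : bimod G X) (S : subsp X).
Hypotheses (Sl : forall a x, S x -> S (la s a x)) (Sr : forall a x, S x -> S (ra s a x)).

Definition sub_act (l : hom G (hom X X)) (Hl : forall a x, S x -> S (l a x)) :
  hom G (hom (sub S) (sub S)).
refine (@hom2 _ _ _ _ (fun a (x : sub S) => mksub (Hl a x (subP x))) _ _);
by abstract (intros; apply: sub_inj => /=; linz).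
Defined.

Definition sub_bimod : bimod G (sub S).
refine (@Bimod _ G _ (sub_act Sl) (sub_act Sr) _ _ _).
- by abstract (intros; apply: sub_inj; apply: laA).
- by abstract (intros; apply: sub_inj; apply: raA).
- by abstract (intros; apply: sub_inj; apply: lara).
Defined.
End SubBimod.

Section Double.
Variable k : fieldType.

Record commb (G B : kalg k) (X : lmodType k) (s : bimod G X) (t : bimod B X) : Prop := Commb {
  cll : forall a b x, la s a (la t b x) = la t b (la s a x);
  clr : forall a b x, la s a (ra t b x) = ra t b (la s a x);
  crl : forall a b x, ra s a (la t b x) = la t b (ra s a x);
  crr : forall a b x, ra s a (ra t b x) = ra t b (ra s a x)
}.

Lemma commb_sym G B X (s : bimod G X) (t : bimod B X) : commb s t -> commb t s.
Proof. by case=> *; split. Qed.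

Definition invs (G : kalg k) (X : lmodType k) (s : bimod G X) : subsp X.
refine (@Subsp _ _ (invt s) _ _).
- by abstract (by move=> a; rewrite !hom_0).
- by abstract (by move=> c x y sx sy a; rewrite !linE sx sy).
Defined.

Section Restr.
Variables (G B : kalg k) (X : lmodType k) (s : bimod G X) (t : bimod B X).
Hypothesis C : commb s t.
Fact invs_la a x : invs t x -> invs t (la s a x).
Proof. by move=> tx b; rewrite -(cll C) -(clr C) tx. Qed.
Fact invs_ra a x : invs t x -> invs t (ra s a x).
Proof. by move=> tx b; rewrite -(crl C) -(crr C) tx. Qed.
Definition invb : bimod G (sub (invs t)) := sub_bimod invs_la invs_ra.
End Restr.

Lemma commb_tw G B X (s : bimod G X) (t : bimod B X) :
  commb s t -> commb (hparam B s) (homtw t).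
Proof.
by case=> ll lr rl rr; split=> a b F; apply: homP => c /=; rewrite ?linE ?lr ?rr.
Qed.

(* The double complex Hom(G^i x B^j, X) computes both H^m(G; X^B) and          *)
(* H^m(B; X^G).                                                               *)
Lemma inv_double m G B X (s : bimod G X) (t : bimod B X) (C : commb s t) :
  (forall n, HV n s) -> (forall n, HV n t) ->
  HV m (invb C) -> HV m (invb (commb_sym C)).
Proof.
elim: m X s t C => [|m IHm] X s t C Vs Vt VC.
  move=> D D_inv.
  (* A chase in the corner of the double complex: D = [ad t x] with x in X, then [ad s x] takes
     values in X^B and equals [ad s x'] with x' in X^B, so x - x' is in X^G and still gives D. *)
  have [|x Dx] := Vt 0%N (hcomp (sub_hom _) D).
    by move=> b; apply: homP => b'; apply: (congr1 (@sub_val _ _ _) (happly b' (D_inv b))).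
  have sx a : invs t (ad s x a).
    move=> b; have Db : ad t x b = D b by rewrite -Dx.
    have := subP (D b) a; rewrite -Db /= !linE (cll C) (clr C) (crl C) (crr C).
    set u := la t b (la s a x); set v := ra t b (la s a x).
    set u' := la t b _; set v' := ra t b _ => uv.
    have -> : u - u' = (u - v) - (u' - v') + (v - v') by zmod.
    by rewrite uv; zmod.
  have D'_lin (c : k) a a' : mksub (sx (c *: a + a')) = c *: mksub (sx a) + mksub (sx a').
    by apply: sub_inj; rewrite /= !linE; zmod.
  have [|x' D'x] := VC (Hom D'_lin).
    move=> a; apply: homP => a'; apply: sub_inj.
    exact: (happly a' (inv_ad s x a)).
  have inv_x : invs s (x - sub_val x').
    apply: ad0_inv; rewrite adB; apply: homP => a.
    have e : ad s x a = ad s (sub_val x') a.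
      exact: (congr1 (@sub_val _ _ _) (happly a D'x)).
    by rewrite -[LHS]/(ad s x a - ad s (sub_val x') a) e subrr.
  exists (mksub inv_x); apply: homP => b; apply: sub_inj.
  rewrite -[LHS]/(hcomp (sub_hom _) D b) Dx /= !linE.
  by rewrite (subP x' b); zmod.
(* As H^1(B; X) = 0, the sequence 0 -> X^B -> X -> Der(B, X) -> 0 is exact, and Der(B, X) is the
   space of B-invariants of Hom(B, X). This lowers the degree by one. *)
have [p p1] : exists p : hom X (sub (invs (homtw t))), forall x, sub_val (p x) = ad t x.
  have p_lin (c : k) x y : mksub (inv_ad t (c *: x + y) : invs (homtw t) _) =
      c *: mksub (inv_ad t x : invs (homtw t) _) + mksub (inv_ad t y : invs (homtw t) _).
    by apply: sub_inj; rewrite -[LHS]/(adh t _) hom_lin.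
  by exists (Hom p_lin).
have C1 := commb_tw C.
have E : ses (invb C) s (invb C1) (sub_hom _) p.
  split=> //.
  - split=> a x; apply: sub_inj; rewrite p1 /=.
      by rewrite p1; apply: homP => b /=; rewrite !linE (cll C) (clr C).
    by rewrite p1; apply: homP => b /=; rewrite !linE (crl C) (crr C).
  - by move=> x x0; apply: sub_inj.
  - move=> F; have [x Fx] := Vt 0%N _ (subP F); exists x.
    by apply: sub_inj; rewrite p1.
  - by move=> x; apply: sub_inj; rewrite p1; apply/inv_ad0/(subP x).
  - move=> x px; have x_inv : invs t x by apply: ad0_inv; rewrite -p1 px.
    by exists (mksub x_inv).
have {}IHm := IHm _ _ _ C1 (fun n => HV_param B (Vs n)) (fun n => Vt n.+1)
  (HV_coker E (Vs m) VC).
(* The G-invariants of Hom(B, X) are Hom(B, X^G), with the same B-bimodule structure; the maps below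
   are this identification. *)
have F_inv (F : hom B (sub (invs s))) : invs (hparam B s) (hcomp (sub_hom _) F).
  by move=> a; apply: homP => b; apply: (subP (F b)).
have i_lin (c : k) F F' : mksub (F_inv (c *: F + F')) = c *: mksub (F_inv F) + mksub (F_inv F').
  by apply: sub_inj; apply: homP.
have g_inv (g : sub (invs (hparam B s))) b : invs s (sub_val g b).
  by move=> a; apply: (happly b (subP g a)).
have g_lin g (c : k) b b' : mksub (g_inv g (c *: b + b')) =
    c *: mksub (g_inv g b) + mksub (g_inv g b').
  by apply: sub_inj; rewrite /= hom_lin.
have p_lin (c : k) g g' : Hom (g_lin (c *: g + g')) = c *: Hom (g_lin g) + Hom (g_lin g').
  by apply: homP => b; apply: sub_inj.
apply: HV_retract (Hom i_lin) (Hom p_lin) _ _ _ IHm.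
- by split=> b F; apply: sub_inj; apply: homP.
- by split=> b F; apply: homP => c; apply: sub_inj.
- by move=> F; apply: homP => b; apply: sub_inj.
Qed.
End Double.

Section Transfer.
Variable k : fieldType.

(** Cochains are pulled back along r and j. Units need not be preserved, since the inclusion of a
    corner sends its unit to an idempotent. *)
Lemma HV_retract_alg n (A G : kalg k) (j : hom A G) (r : hom G A)
    (X Y : lmodType k) (s : bimod A X) (t : bimod G Y) (u : hom X Y) (v : hom Y X) :
  (forall a b, j (kmul a b) = kmul (j a) (j b)) ->
  (forall a b, r (kmul a b) = kmul (r a) (r b)) ->
  (forall a, r (j a) = a) ->
  (forall g x, u (la s (r g) x) = la t g (u x)) ->
  (forall g x, u (ra s (r g) x) = ra t g (u x)) ->
  (forall a y, v (la t (j a) y) = la s a (v y)) ->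
  (forall a y, v (ra t (j a) y) = ra s a (v y)) ->
  (forall x, v (u x) = x) -> HV n t -> HV n s.
Proof.
move=> jM rM rj; elim: n X Y s t u v => [|n IHn] X Y s t u v ul ur vl vr vu.
  move=> Vt D D_inv.
  have [|y Dy] := Vt (hcomp u (hcomp D r)).
    move=> g; apply: homP => h /=.
    rewrite -ul -ur rM -hom_B; congr (u _); exact: (happly (r h) (D_inv (r g))).
  exists (v y); apply: homP => a; rewrite -[LHS]vu -{1}(rj a).
  by rewrite -[u _]/(hcomp u (hcomp D r) (j a)) Dy /= hom_B vl vr.
apply: (IHn _ _ _ _ (hcomp (hpre _ r) (hpost _ u)) (hcomp (hpre _ j) (hpost _ v))).
- by move=> g F; apply: homP => h /=.
- by move=> g F; apply: homP => h /=; rewrite hom_B rM ur.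
- by move=> a F; apply: homP => b /=.
- by move=> a F; apply: homP => b /=; rewrite hom_B -jM vr.
- by move=> F; apply: homP => b /=; rewrite vu rj.
Qed.

Lemma HV_zero n (G : kalg k) X (s : bimod G X) : (forall x : X, x = 0) -> HV n s.
Proof.
elim: n X s => [|n IHn] X s X0.
  by move=> D _; exists 0; apply: homP => a; rewrite [LHS]X0 [RHS]X0.
by apply: IHn => F; apply: homP => a; apply: X0.
Qed.

Definition pull (G A : kalg k) (r : hom G A) (rM : forall a b, r (kmul a b) = kmul (r a) (r b))
  X (s : bimod A X) : bimod G X.
refine (@Bimod _ G _ (hcomp (la s) r) (hcomp (ra s) r) _ _ _).
- abstract (by move=> a b x; rewrite !hcompE rM; apply: laA).
- abstract (by move=> a b x; rewrite !hcompE rM; apply: raA).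
- abstract (by move=> a b x; apply: lara).
Defined.

Definition dual_la (G : kalg k) := pre_act k^o (hswap (@kmul _ G)).
Definition dual_ra (G : kalg k) := pre_act k^o (@kmul _ G).
Definition dualb (G : kalg k) : bimod G (hom G k^o).
refine (@Bimod _ G _ (dual_la G) (dual_ra G) _ _ _).
- abstract (by move=> a b F; apply: homP => x; rewrite /= kmulA).
- abstract (by move=> a b F; apply: homP => x; rewrite /= kmulA).
- abstract (by move=> a b F; apply: homP => x; rewrite /= kmulA).
Defined.
End Transfer.

(** * Strongly stratifying ideals and Hochschild homology *)

Section Strat.
Variable k : fieldType.

(* A = f G f and B = e G e, where f = 1 - e, P = G e and Q = e G; the maps j   *)
(* are the inclusions into G and the maps r the projections x |-> f x f, etc. *)
Record peirce_data (G A B : kalg k) (P Q : lmodType k) := PeirceData {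
  pd_e : G;
  jA : hom A G; rA : hom G A;
  jB : hom B G; rB : hom G B;
  jP : hom P G; rP : hom G P;
  jQ : hom Q G; rQ : hom G Q;
  pd_ee : kmul pd_e pd_e = pd_e;
  rAK : forall a, rA (jA a) = a; rBK : forall a, rB (jB a) = a;
  rPK : forall a, rP (jP a) = a; rQK : forall a, rQ (jQ a) = a;
  jAK : forall x, jA (rA x) = kmul (kmul (kone - pd_e) x) (kone - pd_e);
  jBK : forall x, jB (rB x) = kmul (kmul pd_e x) pd_e;
  jPK : forall x, jP (rP x) = kmul x pd_e;
  jQK : forall x, jQ (rQ x) = kmul pd_e x;
  jAM : forall a b, jA (kmul a b) = kmul (jA a) (jA b);
  jBM : forall a b, jB (kmul a b) = kmul (jB a) (jB b);
  jB1 : jB kone = pd_e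
}.

Variables (G A B : kalg k) (P Q : lmodType k) (H : peirce_data G A B P Q).
Local Notation e := (pd_e H).
Local Notation "x ** y" := (kmul x y) (at level 40, left associativity).

Lemma jP_e p : jP H p ** e = jP H p.
Proof. by rewrite -jPK rPK. Qed.
Lemma e_jQ q : e ** jQ H q = jQ H q.
Proof. by rewrite -jQK rQK. Qed.
Lemma e_jB b : e ** jB H b = jB H b.
Proof. by rewrite -[b in RHS](rBK H) -[b in LHS](rBK H) jBK !kmulA pd_ee. Qed.
Lemma jB_e b : jB H b ** e = jB H b.
Proof. by rewrite -[b in RHS](rBK H) -[b in LHS](rBK H) jBK -!kmulA pd_ee. Qed.

Definition P_rB : hom B (hom P P).
refine (@hom2 _ _ _ _ (fun b p => rP H (jP H p ** jB H b)) _ _); by abstract linz.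
Defined.
Definition Q_lB : hom B (hom Q Q).
refine (@hom2 _ _ _ _ (fun b q => rQ H (jB H b ** jQ H q)) _ _); by abstract linz.
Defined.
Definition P_lG : hom G (hom P P).
refine (@hom2 _ _ _ _ (fun a p => rP H (a ** jP H p)) _ _); by abstract linz.
Defined.
Definition Q_rG : hom G (hom Q Q).
refine (@hom2 _ _ _ _ (fun a q => rQ H (jQ H q ** a)) _ _); by abstract linz.
Defined.

Lemma jP_rB b p : jP H (P_rB b p) = jP H p ** jB H b.
Proof. by rewrite /= jPK -kmulA jB_e. Qed.
Lemma jQ_lB b q : jQ H (Q_lB b q) = jB H b ** jQ H q.
Proof. by rewrite /= jQK kmulA e_jB. Qed.
Lemma jP_lG a p : jP H (P_lG a p) = a ** jP H p.
Proof. by rewrite /= jPK -kmulA jP_e. Qed.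
Lemma jQ_rG a q : jQ H (Q_rG a q) = jQ H q ** a.
Proof. by rewrite /= jQK kmulA e_jQ. Qed.

Lemma jP_inj p p' : jP H p = jP H p' -> p = p'.
Proof. by move=> pp; rewrite -[p](rPK H) pp rPK. Qed.
Lemma jQ_inj q q' : jQ H q = jQ H q' -> q = q'.
Proof. by move=> qq; rewrite -[q](rQK H) qq rQK. Qed.
Lemma jA_inj a a' : jA H a = jA H a' -> a = a'.
Proof. by move=> aa; rewrite -[a](rAK H) aa rAK. Qed.
Lemma jB_inj b b' : jB H b = jB H b' -> b = b'.
Proof. by move=> bb; rewrite -[b](rBK H) bb rBK. Qed.

(* The invariants are the balanced maps P x Q -> Y. *)
Section BalB.
Variable Y : lmodType k.

Definition bal_la := pre_act (hom Q Y) P_rB.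
Definition bal_ra := pt_act P (pre_act Y Q_lB).
Definition balb : bimod B (hom P (hom Q Y)).
refine (@Bimod _ B _ bal_la bal_ra _ _ _).
- abstract (move=> a b F; apply: homP => p; congr (F _); apply: jP_inj;
  by rewrite !jP_rB jBM kmulA).
- abstract (move=> a b F; apply: homP => p; apply: homP => q; congr (F _ _); apply: jQ_inj;
  by rewrite !jQ_lB jBM kmulA).
- abstract (by move=> a b F; apply: homP => p; apply: homP => q).
Defined.
End BalB.

(** The first two conditions on a strongly stratifying ideal in dual form. In the second, e p = 0
    and q e = 0 say that p lies in fGe and q in eGf. *)
Hypothesis Tor_vanish : forall n Y, HV n (balb Y).
Hypothesis tens_vanish : forall Y (F : hom P (hom Q Y)), invt (balb Y) F ->
  forall p q, e ** jP H p = 0 -> jQ H q ** e = 0 -> F p q = 0.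

Local Notation f := (kone - e).

Lemma fe0 : f ** e = 0.
Proof. by rewrite !linE kmul1l pd_ee; zmod. Qed.
Lemma ef0 : e ** f = 0.
Proof. by rewrite !linE kmul1r pd_ee; zmod. Qed.
Lemma ff : f ** f = f.
Proof. by rewrite (hom_B (kmul f)) fe0 kmul1r subr0. Qed.

Definition pq : hom P (hom Q G).
refine (@hom2 _ _ _ _ (fun p q => jP H p ** jQ H q) _ _); by abstract linz.
Defined.
Lemma pq_bal : invt (balb G) pq.
Proof.
move=> b; apply: homP => p; apply: homP => q.
by rewrite [LHS]/= -/(P_rB b p) jP_rB /= -/(Q_lB b q) jQ_lB kmulA.
Qed.

(** The product Ge x eG -> G is balanced over B, hence vanishes on fGe x eGf. *)
Lemma feef0 x y : f ** x ** e ** y ** f = 0.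
Proof.
have : pq (rP H (f ** x)) (rQ H (y ** f)) = 0.
  apply: (tens_vanish pq_bal); first by rewrite jPK !kmulA ef0 !linE.
  by rewrite jQK -!kmulA fe0 !linE.
by rewrite /= jPK jQK !kmulA -[_ ** e ** e]kmulA pd_ee.
Qed.

(* By [feef0], f G e G f = 0. *)
Lemma rAM x y : rA H (x ** y) = rA H x ** rA H y.
Proof.
have xE : x = x ** e + x ** f by rewrite (hom_B (kmul x)) kmul1r; zmod.
apply: jA_inj; rewrite jAM !jAK {1}xE (hom_D kmul (x ** e)) homDE.
rewrite (hom_D (kmul f) (x ** e ** y)) (hom_D kmul (f ** _)) homDE !kmulA feef0 add0r.
by rewrite -!kmulA [f ** (f ** _)]kmulA ff.
Qed.

Lemma rA_eG x : rA H (e ** x) = 0.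
Proof. by apply: jA_inj; rewrite jAK kmulA fe0 !linE subr0. Qed.
Lemma rA_GeG x y : rA H (x ** e ** y) = 0.
Proof. by rewrite -kmulA rAM rA_eG !linE. Qed.
Lemma rA_pq p q : rA H (jP H p ** jQ H q) = 0.
Proof. by rewrite -jP_e rA_GeG. Qed.
Lemma rA_e : rA H e = 0.
Proof. by rewrite -[e]pd_ee rA_eG. Qed.
Lemma rA1 : rA H kone = kone.
Proof.
by rewrite -[LHS]kmul1r -[X in _ ** X](rAK H) -rAM kmul1l rAK.
Qed.

(* G acts on the right through P = G e, hence H^n(G; -) = 0 for n > 0, and on *)
(* the left by an action [l] on hom Q Y that is B-linear.                     *)
Section BalG.
Variables (Y : lmodType k) (l : hom G (hom (hom Q Y) (hom Q Y))).
Hypothesis lA : forall a b z, l a (l b z) = l (a ** b) z.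
Hypothesis l_lin : forall a b z, l a (pre_act Y Q_lB b z) = pre_act Y Q_lB b (l a z).

Definition dbl_la := pt_act P l.
Definition dbl_ra := pre_act (hom Q Y) P_lG.
Definition dblb : bimod G (hom P (hom Q Y)).
refine (@Bimod _ G _ dbl_la dbl_ra _ _ _).
- abstract (by move=> a b F; apply: homP => p; apply: lA).
- abstract (by move=> a b F; apply: homP => p; congr (F _); apply: jP_inj;
  rewrite !jP_lG kmulA).
- abstract (by move=> a b F; apply: homP => p).
Defined.

Lemma dbl_comm : commb dblb (balb Y).
Proof.
split=> a b F; apply: homP => p //.
- exact: l_lin.
- by congr (F _); apply: jP_inj; rewrite !(jP_rB, jP_lG) kmulA.
Qed.

(** Ge is generated by the idempotent e, which is [rP H kone], and p e = p. The homotopy is F |-> (p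
    |-> - F(p)(e)). *)
Lemma dbl_rcoind : rcoind dblb.
Proof.
have lam2 (F : hom G (hom P (hom Q Y))) (c : k) p p' :
    - F (jP H (c *: p + p')) (rP H kone) =
    c *: (- F (jP H p) (rP H kone)) + - F (jP H p') (rP H kone).
  by linz.
have lam1 (c : k) (F F' : hom G (hom P (hom Q Y))) p :
    - (c *: F + F') (jP H p) (rP H kone) =
    c *: (- F (jP H p) (rP H kone)) + - F' (jP H p) (rP H kone).
  by linz.
exists (hom2 lam2 lam1); split=> a F; apply: homP => p.
  by rewrite /= linE.
have Pe : P_lG (jP H p) (rP H kone) = p.
  by apply: jP_inj; rewrite jP_lG jPK kmul1l jP_e.
rewrite -[LHS]/(F a p) -{1}Pe.
change (F a (P_lG (jP H p) (rP H kone)) =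
  - (F (a ** jP H p) (rP H kone) - F a (P_lG (jP H p) (rP H kone))) -
  - F (jP H (P_lG a p)) (rP H kone)).
by rewrite jP_lG; zmod.
Qed.

(** [inv_double] applies to Hom(P, Hom(Q, Y)), acyclic over B by [Tor_vanish] and over G by
    [dbl_rcoind]. One side consists of the balanced maps, dual to Ge (x)_B eG, with G acting; the
    other of the G-linear maps Ge -> Hom(Q, Y), with B acting. *)
Lemma HV_bal_of_lin m : HV m (invb (commb_sym dbl_comm)) -> HV m (invb dbl_comm).
Proof.
move/(inv_double (fun n => Tor_vanish n Y) (fun n => HV_rcoind n dbl_rcoind)).
by rewrite (Prop_irrelevance (commb_sym (commb_sym dbl_comm)) dbl_comm).
Qed.

Lemma HV_lin_of_bal m : HV m (invb dbl_comm) -> HV m (invb (commb_sym dbl_comm)).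
Proof. exact: (inv_double (fun n => HV_rcoind n dbl_rcoind) (fun n => Tor_vanish n Y)). Qed.
End BalG.

Definition pqm (Y : lmodType k) (F : hom G Y) : hom P (hom Q Y) := hcomp (hpost Q F) pq.
Lemma pqm_bal Y F : invt (balb Y) (pqm F).
Proof.
move=> b; apply: homP => p; apply: homP => q; congr (F _).
exact: (happly q (happly p (pq_bal b))).
Qed.

(** Dual form of the injectivity of Ge (x)_B eG -> G. The extension is x |-> F(xe, e) + F(e, xf): at
    x = pq, moving elements of B across gives F(p, qe) + F(ep, qf), and this is F(p, q) because
    F(fp, qf) = 0. *)
Lemma bal_pqm Y (F : hom P (hom Q Y)) : invt (balb Y) F -> exists F', pqm F' = F.
Proof.
move=> F_bal.
have g_lin (c : k) x x' :
    F (rP H (c *: x + x')) (rQ H e) + F (rP H e) (rQ H ((c *: x + x') ** f)) =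
    c *: (F (rP H x) (rQ H e) + F (rP H e) (rQ H (x ** f))) +
    (F (rP H x') (rQ H e) + F (rP H e) (rQ H (x' ** f))).
  by linz.
exists (Hom g_lin); apply: homP => p; apply: homP => q /=.
have bal b p' q' : F (P_rB b p') q' = F p' (Q_lB b q').
  exact: (happly q' (happly p' (F_bal b))).
have -> : rP H (jP H p ** jQ H q) = P_rB (rB H (jQ H q)) p.
  by apply: jP_inj; rewrite jP_rB jPK jBK (e_jQ q) kmulA.
have -> : rQ H (jP H p ** jQ H q ** f) =
    Q_lB (rB H (jP H p)) (rQ H (jQ H q ** f)).
  apply: jQ_inj; rewrite jQ_lB !jQK jBK !kmulA -[_ ** e ** e]kmulA pd_ee.
  by rewrite -[e ** jP H p ** e]kmulA (jP_e p).
rewrite bal -(bal (rB H (jP H p))).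
have -> : Q_lB (rB H (jQ H q)) (rQ H e) = rQ H (jQ H q ** e).
  by apply: jQ_inj; rewrite jQ_lB !jQK jBK pd_ee -!kmulA pd_ee.
have -> : P_rB (rB H (jP H p)) (rP H e) = rP H (e ** jP H p).
  by apply: jP_inj; rewrite jP_rB !jPK jBK pd_ee !kmulA pd_ee.
have F0 : F (rP H (f ** jP H p)) (rQ H (jQ H q ** f)) = 0.
  apply: (tens_vanish F_bal); first by rewrite jPK !kmulA ef0 !linE.
  by rewrite jQK -!kmulA fe0 !linE.
have pE : p = rP H (e ** jP H p) + rP H (f ** jP H p).
  by rewrite -hom_D -homDE -hom_D addrC subrK kmul1l rPK.
have qE : q = rQ H (jQ H q ** e) + rQ H (jQ H q ** f).
  by rewrite -hom_D -(hom_D (kmul _)) addrC subrK kmul1r rQK.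
have split p1 p2 q1 q2 : F p2 q2 = 0 -> F (p1 + p2) q1 + F p1 q2 = F (p1 + p2) (q1 + q2).
  by move=> F20; rewrite !linE F20; zmod.
by have := split (rP H (e ** jP H p)) _ (rQ H (jQ H q ** e)) _ F0; rewrite -pE -qE; apply.
Qed.

(** The difference x - f x f lies in GeG, where F vanishes, so F depends only on f x f. *)
Lemma pqm0 Y (F : hom G Y) : pqm F = 0 -> exists F', hpre Y (rA H) F' = F.
Proof.
move=> F0; have FGeG u v : F (u ** e ** v) = 0.
  have := happly (rQ H v) (happly (rP H u) F0).
  by rewrite /= jPK jQK kmulA -[_ ** e ** e]kmulA pd_ee.
exists (hcomp F (jA H)); apply: homP => x; rewrite /= jAK.
have -> : f ** x ** f = x - kone ** e ** x - x ** e ** kone + kone ** e ** (x ** e).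
  by rewrite !kmulA !(kmul1l, kmul1r, linE); zmod.
by rewrite !(hom_D, hom_N) !FGeG; zmod.
Qed.

Section BalSes.
Variables (Y : lmodType k) (l : hom G (hom (hom Q Y) (hom Q Y))).
Hypothesis lA : forall a b z, l a (l b z) = l (a ** b) z.
Hypothesis l_lin : forall a b z, l a (pre_act Y Q_lB b z) = pre_act Y Q_lB b (l a z).
Variables (s1 : bimod G (hom A Y)) (s2 : bimod G (hom G Y)).
Hypothesis s12 : bmap s1 s2 (hpre Y (rA H)).
Hypothesis s2l : forall a F p, pqm (la s2 a F) p = l a (pqm F p).
Hypothesis s2r : forall a F p, pqm (ra s2 a F) p = pqm F (P_lG a p).

(* 0 -> Hom(A, Y) -> Hom(G, Y) -> Hom(Ge (x)_B eG, Y) -> 0 *)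
Lemma bal_ses : exists p, ses s1 s2 (invb (dbl_comm lA l_lin)) (hpre Y (rA H)) p.
Proof.
pose pF (F : hom G Y) : sub (invs (balb Y)) := mksub (S := invs (balb Y)) (pqm_bal F).
have p_lin (c : k) F F' : pF (c *: F + F') = c *: pF F + pF F'.
  by apply: sub_inj; apply: homP => p; apply: homP.
exists (Hom p_lin); split=> //.
- by split=> a F; apply: sub_inj; apply: homP => p; [apply: s2l|apply: s2r].
- move=> F F0; apply: homP => a.
  by rewrite -[a](rAK H); apply: (happly (jA H a) F0).
- move=> F; have [F' FF'] := bal_pqm (subP F); exists F'.
  exact: sub_inj.
- move=> F; apply: sub_inj; apply: homP => p; apply: homP => q /=.
  by rewrite -jP_e rA_GeG linE.
- by move=> F /(congr1 (@sub_val _ _ _)); apply: pqm0.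
Qed.
End BalSes.

Lemma dbl_invP Y (l : hom G (hom (hom Q Y) (hom Q Y)))
    (lA : forall a b z, l a (l b z) = l (a ** b) z)
    (F : hom P (hom Q Y)) : invt (dblb lA) F ->
  forall p, F p = l (jP H p) (l e (F (rP H e))).
Proof.
move=> F_inv p; have Fl a p' : F (P_lG a p') = l a (F p').
  exact/esym/(happly p' (F_inv a)).
rewrite -!Fl; congr (F _); apply: jP_inj.
by rewrite !jP_lG jPK !pd_ee jP_e.
Qed.

Section ModuleCoefficients.
Variables (Y : lmodType k) (m : hom G (hom Y Y)).
Hypothesis mA : forall a b y, m a (m b y) = m (a ** b) y.

Lemma mod_lA a b (z : hom Q Y) : pt_act Q m a (pt_act Q m b z) = pt_act Q m (a ** b) z.
Proof. by apply: homP => q; apply: mA. Qed.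
Lemma mod_l_lin a b (z : hom Q Y) :
  pt_act Q m a (pre_act Y Q_lB b z) = pre_act Y Q_lB b (pt_act Q m a z).
Proof. by apply: homP => q. Qed.
Definition mod_comm := dbl_comm mod_lA mod_l_lin.
End ModuleCoefficients.

Section DualCoefficients.
Variable Y : lmodType k.
Definition dual_l : hom G (hom (hom Q Y) (hom Q Y)) := pre_act Y Q_rG.
Lemma dual_lA a b z : dual_l a (dual_l b z) = dual_l (a ** b) z.
Proof. by apply: homP => q; congr (z _); apply: jQ_inj; rewrite !jQ_rG kmulA. Qed.
Lemma dual_l_lin a b z : dual_l a (pre_act Y Q_lB b z) = pre_act Y Q_lB b (dual_l a z).
Proof.
by apply: homP => q; congr (z _); apply: jQ_inj; rewrite !(jQ_rG, jQ_lB) kmulA.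
Qed.
End DualCoefficients.

(** Inflation from A = G/GeG to G. The cochain bimodules Hom(A, X) and Hom(G, X) differ by the
    balanced maps on Ge x eG, which contribute nothing because e acts as zero on X. *)
Lemma HV_pull n X (s : bimod A X) : HV n s -> HV n (pull rAM s).
Proof.
elim: n X s => [|n IHn] X s V.
  move=> D D_inv; have [|x Dx] := V (hcomp D (jA H)).
    move=> a; apply: homP => b; have := happly (jA H b) (D_inv (jA H a)).
    by rewrite /= !rAK jAM.
  have DM a b : la s (rA H a) (D b) = D (a ** b) - ra s (rA H b) (D a).
    exact: (happly b (D_inv a)).
  (* As e acts by zero on both sides, D kills e, eG and Ge, so D(g) = D(f g f) and D comes from a
     derivation of A. *)
  have De : D e = 0.
    by have := DM e e; rewrite rA_e pd_ee !linE subr0.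
  have Deg g : D (e ** g) = 0.
    by have := DM e g; rewrite rA_e De !linE subr0.
  have Dge g : D (g ** e) = 0.
    by have := DM g e; rewrite rA_e De !linE subr0.
  exists x; apply: homP => g; have := happly (rA H g) Dx; rewrite /= => <-.
  rewrite jAK; have -> : f ** g ** f = g - e ** g - g ** e + e ** (g ** e).
    by rewrite !kmulA !(kmul1l, kmul1r, linE); zmod.
  by rewrite !(hom_D, hom_N) !(Deg, Dge); zmod.
pose m := hcomp (la s) (rA H).
have mA a b y : m a (m b y) = m (a ** b) y by rewrite /= rAM laA.
have [|||p E] := @bal_ses X _ (mod_lA mA) (mod_l_lin m) (pull rAM (homtw s))
  (homtw (pull rAM s)).
- by split=> a F; apply: homP => b //=; rewrite rAM.
- by move=> a F p; apply: homP.
(* The correction term of the right action on [homtw] disappears on GeG, because [rA] vanishes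
   there. *)
- move=> a F p0; apply: homP => q /=.
  by rewrite -[rP H _]/(P_lG a p0) jP_lG rA_pq !linE subr0 kmulA.
apply: (HV_ext E) => //; first exact: IHn.
(* A G-linear map on Ge is determined by its value at e, which is fixed by e; here e acts as zero,
   so there is no such map but 0. *)
apply: HV_bal_of_lin; apply: HV_zero => F; apply: sub_inj; apply: homP => p0.
rewrite (dbl_invP (subP F)) -[RHS](hom_0 (pt_act Q m (jP H p0))); congr (pt_act Q m _ _).
by apply: homP => q; rewrite /= rA_e !linE.
Qed.

Lemma HV_dualA n : HV n (dualb G) -> HV n (dualb A).
Proof.
apply: (HV_retract_alg (j := jA H) (r := rA H) (u := hpre _ (rA H)) (v := hpre _ (jA H))) => //.
- exact: jAM.
- exact: rAM.
- exact: rAK.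
- by move=> a F; apply: homP => x /=; rewrite rAM.
- by move=> a F; apply: homP => x /=; rewrite rAM.
- by move=> a F; apply: homP => x /=; rewrite jAM.
- by move=> a F; apply: homP => x /=; rewrite jAM.
- by move=> F; apply: homP => a /=; rewrite rAK.
Qed.

(** For Y = k the exact sequence starts with the duals of A and G, so their vanishing gives that of
    the balanced maps, hence that of the G-linear maps Ge -> Hom(eG, k). The dual of B is a retract
    of the latter. *)
Lemma HV_dualB n : HV n (dualb G) -> HV n.+1 (dualb A) -> HV n (dualb B).
Proof.
move=> VG VA.
have [|||p E] := @bal_ses k^o _ (@dual_lA _) (@dual_l_lin _) (pull rAM (dualb A)) (dualb G).
- by split=> a F; apply: homP => b //=; rewrite rAM.
- move=> a F p; apply: homP => q /=.
  by rewrite -[rQ H _]/(Q_rG a q) jQ_rG kmulA.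
- move=> a F p0; apply: homP => q /=.
  by rewrite -[rP H _]/(P_lG a p0) jP_lG kmulA.
have := HV_lin_of_bal (HV_coker E VG (HV_pull VA)).
set t := invb _.
(* A functional th on B = eGe goes to (p, q) |-> th(e q p e), and [v] recovers it by evaluating at p
   = b and q = e. *)
have u2 (th : hom B k^o) p' (c : k) q q' : th (rB H (jQ H (c *: q + q') ** jP H p')) =
    c *: th (rB H (jQ H q ** jP H p')) + th (rB H (jQ H q' ** jP H p')).
  by linz.
have u1 (th : hom B k^o) (c : k) p' p'' q : th (rB H (jQ H q ** jP H (c *: p' + p''))) =
    c *: th (rB H (jQ H q ** jP H p')) + th (rB H (jQ H q ** jP H p'')).
  by linz.
have u_inv th : invs (dblb (@dual_lA _)) (hom2 (u2 th) (u1 th)).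
  move=> a; apply: homP => p'; apply: homP => q /=.
  by rewrite -[rQ H _]/(Q_rG a q) jQ_rG -[rP H _]/(P_lG a p') jP_lG kmulA.
have u_lin (c : k) th th' : mksub (u_inv (c *: th + th')) = c *: mksub (u_inv th) + mksub (u_inv th').
  by apply: sub_inj; apply: homP => p'; apply: homP.
pose v := hcomp (hcomp (hpre k^o (hcomp (rP H) (jB H)))
  (hpost P (hev k^o (rQ H e)))) (sub_hom (invs (dblb (@dual_lA k^o)))).
have rB_qp q p' b : rB H (jQ H q ** jP H p' ** jB H b) = rB H (jQ H q ** jP H p') ** b.
  by apply: jB_inj; rewrite jBM !jBK -!kmulA jB_e e_jB.
have rB_pq q p' b : rB H (jB H b ** (jQ H q ** jP H p')) = b ** rB H (jQ H q ** jP H p').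
  by apply: jB_inj; rewrite jBM !jBK !kmulA e_jB jB_e.
apply: (HV_retract (i := Hom u_lin) (p := v)).
- split=> b th; apply: sub_inj; apply: homP => p'; apply: homP => q /=.
    by rewrite -[rP H _]/(P_rB b p') jP_rB kmulA rB_qp.
  by rewrite -[rQ H _]/(Q_lB b q) jQ_lB -kmulA rB_pq.
- split=> b F; apply: homP => c /=.
    congr (sub_val F _ _); apply: jP_inj.
    by rewrite !jPK jB_e jB_e -jBM jB_e.
  have -> : rQ H (jB H b ** jQ H (rQ H e)) = Q_rG (jB H b) (rQ H e).
    by apply: jQ_inj; rewrite jQ_rG !jQK pd_ee jB_e.
  rewrite [LHS](happly (rQ H e) (happly (rP H (jB H c)) (subP F (jB H b)))) /=.
  by congr (sub_val F _ _); apply: jP_inj; rewrite !jPK !jB_e -jBM jB_e.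
- move=> th; apply: homP => b /=; congr (th _).
  by rewrite jQK jPK jB_e pd_ee e_jB rBK.
Qed.
End Strat.

(** * Modules and Ext *)

Section KTensor.
Variables (k : fieldType) (U V : lmodType k).
Definition ktens : Type := tensor (symmetric_mod U) V.
HB.instance Definition _ := GRing.Zmodule.on ktens.
Local Notation st u v := (@tens k (symmetric_mod U) V u v).

Lemma st_scale c u v : st (c *: (u : U)) v = st u (c *: v).
Proof. exact: (@tensZ k (symmetric_mod U) V c). Qed.

Section Lift.
Variables (W : lmodType k) (f : hom U (hom V W)).
Fact klift_balanced : @balanced k (symmetric_mod U) V W (fun u v => f u v).
Proof.
split=> [u u' v|u v v'|c u v]; rewrite ?hom_D //.
by rewrite -[_ *: u]/(c *: (u : U)) !hom_Z.
Qed.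
Definition klift_fun (x : ktens) : W :=
  @tens_lift k (symmetric_mod U) V W (fun u v => f u v) x.
Lemma klift_funE u v : klift_fun (st u v) = f u v.
Proof. exact: tens_liftE klift_balanced _ _. Qed.
Lemma klift_funD x y : klift_fun (x + y) = klift_fun x + klift_fun y.
Proof. exact: tens_liftD klift_balanced _ _. Qed.
Lemma klift_fun0 : klift_fun 0 = 0.
Proof. exact: tens_lift0 klift_balanced. Qed.
End Lift.

Fact kscale_balanced c : @balanced k (symmetric_mod U) V ktens (fun u v => st (c *: (u : U)) v).
Proof.
split=> [u u' v|u v v'|d u v].
- by rewrite scalerDr; exact: tensDl.
- exact: tensDr.
- by rewrite -[_ *: u]/(d *: (u : U)) scalerA mulrC -scalerA st_scale.
Qed.
Definition kscale (c : k) (x : ktens) : ktens :=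
  @tens_lift k (symmetric_mod U) V ktens (fun u v => st (c *: (u : U)) v) x.
Lemma kscaleE c u v : kscale c (st u v) = st (c *: (u : U)) v.
Proof. exact: tens_liftE (kscale_balanced c) _ _. Qed.
Lemma kscaleDr : right_distributive kscale +%R.
Proof. by move=> c x y; exact: tens_liftD (kscale_balanced c) _ _. Qed.
Lemma kscale0 c : kscale c 0 = 0.
Proof. exact: tens_lift0 (kscale_balanced c). Qed.
Lemma kscaleA a b x : kscale a (kscale b x) = kscale (a * b) x.
Proof.
elim/tens_ind: x => [|u v|x y IHx IHy]; rewrite ?kscale0 ?kscaleE ?scalerA //.
by rewrite !kscaleDr IHx IHy.
Qed.
Lemma kscale1 : left_id 1 kscale.
Proof.
by elim/tens_ind=> [|u v|x y IHx IHy]; rewrite ?kscale0 ?kscaleE ?scale1r // kscaleDr IHx IHy.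
Qed.
Lemma kscaleDl x : {morph kscale^~ x : a b / a + b}.
Proof.
move=> a b; elim/tens_ind: x => [|u v|x y IHx IHy]; rewrite ?kscale0 ?kscaleE ?addr0 //.
  by rewrite scalerDl; exact: tensDl.
by rewrite !kscaleDr IHx IHy addrACA.
Qed.
HB.instance Definition _ := GRing.Zmodule_isLmodule.Build k ktens
  kscaleA kscale1 kscaleDr kscaleDl.

Definition tn : hom U (hom V ktens).
refine (@hom2 _ _ _ _ (fun u v => st u v : ktens) _ _).
- abstract (by move=> u c v v'; rewrite [LHS]tensDr -st_scale -kscaleE).
- abstract (by move=> c u u' v; rewrite [LHS]tensDl -kscaleE).
Defined.

Lemma ktens_ind (S : ktens -> Prop) : S 0 -> (forall u v, S (tn u v)) ->
  (forall x y, S x -> S y -> S (x + y)) -> forall x, S x.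
Proof. exact: (@tens_ind k (symmetric_mod U) V S). Qed.

Lemma ktens_ext (W : lmodType k) (f g : hom ktens W) :
  (forall u v, f (tn u v) = g (tn u v)) -> forall x, f x = g x.
Proof.
move=> fg; elim/ktens_ind=> [|u v|x y IHx IHy]; [by rewrite !hom_0|exact: fg|].
by rewrite !hom_D IHx IHy.
Qed.

Section Lift2.
Variables (W : lmodType k) (f : hom U (hom V W)).
Fact klift_subproof (c : k) x y :
  klift_fun f (c *: x + y) = c *: klift_fun f x + klift_fun f y.
Proof.
rewrite klift_funD; congr (_ + _).
elim/tens_ind: x => [|u v|x x' IHx IHx'].
- by rewrite scaler0 !klift_fun0 scaler0.
- by rewrite [X in klift_fun f X]kscaleE !klift_funE hom_Z.
- by rewrite scalerDr !klift_funD scalerDr IHx IHx'.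
Qed.
Definition klift : hom ktens W := Hom klift_subproof.
Lemma kliftE u v : klift (tn u v) = f u v.
Proof. exact: klift_funE. Qed.
End Lift2.
End KTensor.

Section Modules.
Variables (k : fieldType) (G : kalg k).

Record lmodst (X : lmodType k) := Lmodst {
  lm : hom G (hom X X);
  lmA : forall a b x, lm a (lm b x) = lm (kmul a b) x;
  lm1 : forall x, lm kone x = x
}.

Definition homb_la X Y (b : lmodst Y) : hom G (hom (hom X Y) (hom X Y)) := pt_act X (lm b).
Definition homb_ra X Y (a : lmodst X) := pre_act Y (lm a).

(* Its cohomology is Ext_G(X, Y). *)
Definition homb X Y (a : lmodst X) (b : lmodst Y) : bimod G (hom X Y).
refine (@Bimod _ G _ (homb_la X b) (homb_ra Y a) _ _ _).
- abstract (by move=> g h F; apply: homP => x; apply: lmA).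
- abstract (by move=> g h F; apply: homP => x; rewrite /= lmA).
- abstract (by move=> g h F; apply: homP => x).
Defined.

Definition mlin X Y (a : lmodst X) (b : lmodst Y) (f : hom X Y) : Prop :=
  forall g x, f (lm a g x) = lm b g (f x).

Lemma mlinP X Y (a : lmodst X) (b : lmodst Y) f : mlin a b f <-> invt (homb a b) f.
Proof.
split=> [f_lin g|f_inv g x]; first by apply: homP => x /=; rewrite f_lin.
exact/esym/(happly x (f_inv g)).
Qed.

Record mod_ses X' X X'' (a' : lmodst X') (a : lmodst X) (a'' : lmodst X'')
    (i : hom X' X) (p : hom X X'') : Prop := Mes {
  mod_ses_i : mlin a' a i;
  mod_ses_p : mlin a a'' p;
  mod_ses_inj : forall x, i x = 0 -> x = 0;
  mod_ses_surj : forall z, exists x, p x = z;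
  mod_ses_pi : forall x, p (i x) = 0;
  mod_ses_exact : forall x, p x = 0 -> exists x', i x' = x
}.

Section Mes.
Variables (X' X X'' : lmodType k) (a' : lmodst X') (a : lmodst X) (a'' : lmodst X'').
Variables (i : hom X' X) (p : hom X X'').
Hypothesis E : mod_ses a' a a'' i p.

Lemma mod_ses_contra Y (b : lmodst Y) :
  ses (homb a'' b) (homb a b) (homb a' b) (hpre Y p) (hpre Y i).
Proof.
case: E => ilin plin i0 p1 pi ex; split.
- by split=> g F; apply: homP => x //=; rewrite plin.
- by split=> g F; apply: homP => x //=; rewrite ilin.
- by move=> F F0; apply: homP => z; have [x <-] := p1 z; apply: (happly x F0).
- move=> F; have [x /i0 ->|F' FF'] := @lin_factor _ _ _ _ i F; first exact: hom_0.
  by exists F'; apply: homP => x; rewrite FF'.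
- by move=> F; apply: homP => x /=; rewrite pi hom_0.
- move=> F F0; have [x /ex [x' <-]|F' FF'] := @lin_factor _ _ _ _ p F.
    exact: (happly x' F0).
  by exists F'; apply: homP => x; rewrite FF'.
Qed.

Lemma mod_ses_cov Z (c : lmodst Z) :
  ses (homb c a') (homb c a) (homb c a'') (hpost Z i) (hpost Z p).
Proof.
case: E => ilin plin i0 p1 pi ex; split.
- by split=> g F; apply: homP => x //=; rewrite ilin.
- by split=> g F; apply: homP => x //=; rewrite plin.
- by move=> F F0; apply: homP => z; apply: i0; apply: (happly z F0).
- move=> F; have [z|F' FF'] := @lin_lift _ _ _ _ p F; first exact: p1.
  by exists F'; apply: homP.
- by move=> F; apply: homP => x; apply: pi.
- move=> F F0; have [z|F' FF'] := @lin_lift _ _ _ _ i F.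
    by apply: ex; apply: (happly z F0).
  by exists F'; apply: homP.
Qed.
End Mes.

(* Ext^(m+1)(X, -) = 0 for all m >= n. *)
Definition Pd n X (a : lmodst X) : Prop :=
  forall m, (n <= m)%N -> forall Y (b : lmodst Y), HV m (homb a b).

Lemma Pd_mono n n' X (a : lmodst X) : (n <= n')%N -> Pd n a -> Pd n' a.
Proof. by move=> nn' V m n'm; apply: V; apply: leq_trans n'm. Qed.

Section PdMes.
Variables (X' X X'' : lmodType k) (a' : lmodst X') (a : lmodst X) (a'' : lmodst X'').
Variables (i : hom X' X) (p : hom X X'').
Hypothesis E : mod_ses a' a a'' i p.

Lemma Pd_sub n : Pd n a -> Pd n.+1 a'' -> Pd n a'.
Proof.
by move=> V V'' m nm Y b; apply: (HV_coker (mod_ses_contra E b)); [apply: V|apply: V''].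
Qed.

Lemma Pd_quo n : Pd n a' -> Pd n.+1 a -> Pd n.+1 a''.
Proof.
by move=> V' V [//|m] nm Y b; apply: (HV_ker (mod_ses_contra E b)); [apply: V'|apply: V].
Qed.

Lemma Pd_ext n : Pd n a' -> Pd n a'' -> Pd n a.
Proof.
by move=> V' V'' m nm Y b; apply: (HV_ext (mod_ses_contra E b)); [apply: V''|apply: V'].
Qed.

(** The identity of X'' is an invariant of Hom(X'', X''), and it lifts because Ext^1(X'', X') =
    0. *)
Lemma Pd0_section : Pd 0 a'' -> exists f, mlin a'' a f /\ forall z, p (f z) = z.
Proof.
move=> V; have [|f [f_inv pf]] := inv_lift (mod_ses_cov E a'') (V 0%N isT _ a') (z := idh X'').
  by apply/mlinP.
by exists f; split; [apply/mlinP|move=> z; apply: (happly z pf)].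
Qed.
End PdMes.

Lemma Pd_retract n X T (a : lmodst X) (b : lmodst T) i p :
  mlin a b i -> mlin b a p -> (forall x, p (i x) = x) -> Pd n b -> Pd n a.
Proof.
move=> ilin plin pi V m nm Y c; apply: HV_retract (hpre Y p) (hpre Y i) _ _ _ (V m nm Y c).
- by split=> g F; apply: homP => x //=; rewrite plin.
- by split=> g F; apply: homP => x //=; rewrite ilin.
- by move=> F; apply: homP => x /=; rewrite pi.
Qed.

(** The maps j and g |-> g u0 exhibit U as a summand of G. This serves both G itself and Ge. *)
Lemma Pd0_free U (a : lmodst U) (j : hom U G) u0 :
  (forall g u, j (lm a g u) = kmul g (j u)) -> (forall u, lm a (j u) u0 = u) -> Pd 0 a.
Proof.
move=> jl ju0 m _ Y b; apply: HV_rcoind.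
have lam2 (F : hom G (hom U Y)) (c : k) u u' :
    - F (j (c *: u + u')) u0 = c *: (- F (j u) u0) + - F (j u') u0.
  by linz.
have lam1 (c : k) (F F' : hom G (hom U Y)) u :
    - (c *: F + F') (j u) u0 = c *: (- F (j u) u0) + - F' (j u) u0.
  by linz.
exists (hom2 lam2 lam1); split=> g F; apply: homP => u /=; first by rewrite linE.
by rewrite ?linE jl /= ju0; zmod.
Qed.

Definition regm : lmodst G := Lmodst (@kmulA _ G) (@kmul1l _ G).
Lemma Pd_reg : Pd 0 regm.
Proof. by apply: (@Pd0_free _ _ (idh G) kone) => // u; apply: kmul1r. Qed.

Section TensMod.
Variables (U V : lmodType k) (a : lmodst U).

Definition tensm_act_fun (g : G) : hom (ktens U V) (ktens U V) :=
  klift (hcomp (tn U V) (lm a g)).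
Lemma tensm_actE g u v : tensm_act_fun g (tn U V u v) = tn U V (lm a g u) v.
Proof. exact: kliftE. Qed.
Fact tensm_act_lin (c : k) g h :
  tensm_act_fun (c *: g + h) = c *: tensm_act_fun g + tensm_act_fun h.
Proof.
by apply: homP; apply: ktens_ext => u v; rewrite tensm_actE !homE !tensm_actE !linE.
Qed.
Definition tensm_act : hom G (hom (ktens U V) (ktens U V)) := Hom tensm_act_lin.
Lemma tensm_tn g u v : tensm_act g (tn U V u v) = tn U V (lm a g u) v.
Proof. exact: kliftE. Qed.
Fact tensm_A g h x : tensm_act g (tensm_act h x) = tensm_act (kmul g h) x.
Proof.
elim/ktens_ind: x => [|u v|x y IHx IHy]; first by rewrite !hom_0.
  by rewrite !tensm_tn lmA.
by rewrite !hom_D IHx IHy.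
Qed.
Fact tensm_1 x : tensm_act kone x = x.
Proof.
elim/ktens_ind: x => [|u v|x y IHx IHy]; first by rewrite !hom_0.
  by rewrite tensm_tn lm1.
by rewrite !hom_D IHx IHy.
Qed.
Definition tensm : lmodst (ktens U V) := Lmodst tensm_A tensm_1.

(** Hom(U (x)_k V, Y) is Hom(V, Hom(U, Y)) with V as a mere parameter space, so [HV_param]
    applies. *)
Lemma Pd_tens n : Pd n a -> Pd n tensm.
Proof.
move=> Va m nm Y b.
have i_lin (c : k) (F F' : hom (ktens U V) Y) : hswap (hcomp (hpost V (c *: F + F')) (tn U V)) =
    c *: hswap (hcomp (hpost V F) (tn U V)) + hswap (hcomp (hpost V F') (tn U V)).
  by apply: homP => v; apply: homP => u.
have p_lin (c : k) (F F' : hom V (hom U Y)) : klift (hswap (c *: F + F')) =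
    c *: klift (hswap F) + klift (hswap F').
  by apply: homP; apply: ktens_ext => u v; rewrite !homE !kliftE.
apply: HV_retract (Hom i_lin) (Hom p_lin) _ _ _ (HV_param V (Va m nm Y b)).
- split=> g F; apply: homP => v; apply: homP => u //.
  exact: (congr1 F (tensm_tn g u v)).
- split=> g F; apply: homP; apply: ktens_ext => u v.
    by rewrite [RHS]/= [LHS]kliftE [X in _ = lm b g X]kliftE.
  by rewrite [RHS](congr1 _ (tensm_tn g u v)) [LHS]kliftE [RHS]kliftE.
- by move=> F; apply: homP; apply: ktens_ext => u v; apply: kliftE.
Qed.
End TensMod.

Lemma cover_mlin X (a : lmodst X) : mlin (tensm X regm) a (klift (lm a)).
Proof.
move=> g0; apply: (ktens_ext (f := hcomp (klift (lm a)) (lm (tensm X regm) g0))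
  (g := hcomp (lm a g0) (klift (lm a)))) => h x.
by rewrite !hcompE tensm_tn !kliftE lmA.
Qed.
Lemma cover_surj X (a : lmodst X) x : exists t, klift (lm a) t = x.
Proof. by exists (tn G X kone x); rewrite kliftE lm1. Qed.

Section SubQuo.
Variables (X : lmodType k) (a : lmodst X) (S : subsp X).
Hypothesis Sa : forall g x, S x -> S (lm a g x).

Definition subm : lmodst (sub S).
refine (@Lmodst _ (sub_act Sa) _ _).
- abstract (by move=> g h x; apply: sub_inj; apply: lmA).
- abstract (by move=> x; apply: sub_inj; apply: lm1).
Defined.

(** The quotient is realised on the complement [ker q] of S, where g acts by its action on X
    followed by the projection along S. *)
Lemma quom_exists : exists (Z : lmodType k) (c : lmodst Z) (p : hom X Z),
  mod_ses subm a c (sub_hom S) p.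
Proof.
have [q [qS qid]] := lin_proj S.
have p_ker x : ker q (x - q x) by rewrite /= hom_B (qid (q x)) // subrr.
have p_lin (c : k) x y : mksub (p_ker (c *: x + y)) = c *: mksub (p_ker x) + mksub (p_ker y).
  by apply: sub_inj; rewrite /= hom_lin; linz.
pose p := Hom p_lin : hom X (sub (ker q)).
have pS x : S x -> p x = 0 by move=> Sx; apply: sub_inj; rewrite /= qid ?subrr.
have pval z : p (sub_val z) = z.
  by apply: sub_inj; rewrite /= (subP z : q _ = 0) subr0.
have Sp x : S (x - sub_val (p x)).
  by rewrite [sub_val _]/= opprB addrC subrK.
have pg g x : p (lm a g (sub_val (p x))) = p (lm a g x).
  apply/eqP; rewrite -subr_eq0 -opprB oppr_eq0 -!hom_B; apply/eqP/pS.
  exact/Sa/Sp.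
have cA g h z : hcomp (hpost _ p) (hcomp (hpre _ (sub_hom (ker q))) (lm a)) g
   (hcomp (hpost _ p) (hcomp (hpre _ (sub_hom (ker q))) (lm a)) h z) =
   hcomp (hpost _ p) (hcomp (hpre _ (sub_hom (ker q))) (lm a)) (kmul g h) z.
  by rewrite -[LHS]/(p (lm a g (sub_val (p (lm a h (sub_val z)))))) pg lmA.
have c1 z : hcomp (hpost _ p) (hcomp (hpre _ (sub_hom (ker q))) (lm a)) kone z = z.
  by rewrite -[LHS]/(p (lm a kone (sub_val z))) lm1 pval.
exists (sub (ker q)), (Lmodst cA c1), p; split=> //.
- by move=> g x; rewrite -[RHS]/(p (lm a g (sub_val (p x)))) pg.
- by move=> x x0; apply: sub_inj.
- by move=> z; exists (sub_val z).
- by move=> x; apply: pS; apply: subP.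
- move=> x px; have Sx : S x by have := Sp x; rewrite px subr0.
  by exists (mksub Sx).
Qed.
End SubQuo.

Lemma ker_mod_ses X T (a : lmodst X) (b : lmodst T) (p : hom T X) (plin : mlin b a p) :
  (forall x, exists t, p t = x) ->
  exists (K : lmodType k) (c : lmodst K) (i : hom K T), mod_ses c b a i p.
Proof.
move=> p1; have Sb g t : ker p t -> ker p (lm b g t).
  by move=> /= pt; rewrite plin pt hom_0.
exists (sub (ker p)), (subm Sb), (sub_hom (ker p)); split=> //.
- by move=> x x0; apply: sub_inj.
- by move=> x; apply: (subP x).
- by move=> x px; exists (mksub (S := ker p) px).
Qed.
End Modules.

(** * Strongly stratifying ideals and global dimension *)

Section Gldim.
Variables (k : fieldType) (G A B : kalg k) (P Q : lmodType k) (H : peirce_data G A B P Q).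
Hypothesis Tor_vanish : forall n Y, HV n (balb H Y).
Hypothesis tens_vanish : forall Y (F : hom P (hom Q Y)), invt (balb H Y) F ->
  forall p q, kmul (pd_e H) (jP H p) = 0 -> kmul (jQ H q) (pd_e H) = 0 -> F p q = 0.
Local Notation e := (pd_e H).
Local Notation "x ** y" := (kmul x y) (at level 40, left associativity).
Let rAM := rAM tens_vanish.

Definition pullm X (a : lmodst A X) : lmodst G X.
refine (@Lmodst _ G _ (hcomp (lm a) (rA H)) _ _).
- abstract (by move=> g h x; rewrite !hcompE lmA rAM).
- abstract (by move=> x; rewrite hcompE (rA1 tens_vanish) lm1).
Defined.

Section EPart.
Variables (Y : lmodType k) (b : lmodst G Y).
Fact epart0 : lm b e 0 = 0. Proof. exact: hom_0. Qed.
Fact epart_lin (c : k) x y : lm b e x = x -> lm b e y = y ->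
  lm b e (c *: x + y) = c *: x + y.
Proof. by move=> ex ey; rewrite hom_lin ex ey. Qed.
Definition epart : subsp Y := Subsp epart0 epart_lin.

Fact epart_act (c : B) y : epart y -> epart (hcomp (lm b) (jB H) c y).
Proof. by move=> _; rewrite /= lmA e_jB. Qed.
Definition epartm : lmodst B (sub epart).
refine (@Lmodst _ B _ (sub_act epart_act) _ _).
- abstract (by move=> c d y; apply: sub_inj; rewrite /= lmA jBM).
- abstract (by move=> y; apply: sub_inj; rewrite /= jB1; apply: (subP y)).
Defined.
End EPart.

Definition Qm : lmodst B Q.
refine (@Lmodst _ B _ (Q_lB H) _ _).
- abstract (by move=> c d q; apply: (jQ_inj (H := H)); rewrite !jQ_lB kmulA jBM).
- abstract (by move=> q; apply: (jQ_inj (H := H)); rewrite jQ_lB jB1 e_jQ).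
Defined.

(** Evaluation at e turns a G-linear map Ge -> Hom(Q, Y) into a map Q -> eY, with inverse z |-> ((p,
    q) |-> p z(q)). The B-cohomology is therefore Ext over B of eG with values in eY. *)
Lemma HV_lin_hom n Y (b : lmodst G Y) :
  HV n (homb Qm (epartm b)) -> HV n (invb (commb_sym (mod_comm H (lmA b)))).
Proof.
set t := invb _ => V.
have i2 (F : hom P (hom Q Y)) (F_inv : invs (dblb H (mod_lA (lmA b))) F) q :
    epart b (F (rP H kone) q).
  have /(happly q) /= := happly (rP H kone) (F_inv e).
  rewrite /= => ->; congr (F _ _); apply: (jP_inj (H := H)).
  by rewrite !jPK !kmul1l !pd_ee.
have i1 F F_inv (c : k) q q' : mksub (i2 F F_inv (c *: q + q')) =
    c *: mksub (i2 F F_inv q) + mksub (i2 F F_inv q').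
  by apply: sub_inj; rewrite /= hom_lin.
pose i0 (F : sub (invs (dblb H (mod_lA (lmA b))))) : hom Q (sub (epart b)) :=
  Hom (i1 (sub_val F) (subP F)).
have i_lin (c : k) F F' : i0 (c *: F + F') = c *: i0 F + i0 F'.
  by apply: homP => q; apply: sub_inj.
have p2 (z : hom Q (sub (epart b))) p (c : k) q q' :
    lm b (jP H p) (sub_val (z (c *: q + q'))) =
    c *: lm b (jP H p) (sub_val (z q)) + lm b (jP H p) (sub_val (z q')).
  by rewrite (hom_lin z) subsp_lin hom_lin.
have p1 (z : hom Q (sub (epart b))) (c : k) p p' q :
    lm b (jP H (c *: p + p')) (sub_val (z q)) =
    c *: lm b (jP H p) (sub_val (z q)) + lm b (jP H p') (sub_val (z q)).
  by rewrite !hom_lin.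
have p_inv z : invs (dblb H (mod_lA (lmA b))) (hom2 (p2 z) (p1 z)).
  move=> g; apply: homP => p; apply: homP => q /=.
  by rewrite lmA -[rP H _]/(P_lG H g p) jP_lG.
have p_lin (c : k) z z' : mksub (p_inv (c *: z + z')) = c *: mksub (p_inv z) + mksub (p_inv z').
  by apply: sub_inj; apply: homP => p; apply: homP => q; rewrite /= hom_lin.
apply: HV_retract (Hom i_lin) (Hom p_lin) _ _ _ V.
- split=> c F; apply: homP => q; apply: sub_inj => /=.
    have /(happly q) /= -> := happly (rP H kone) (subP F (jB H c)).
    congr (sub_val F _ _); apply: (jP_inj (H := H)).
    by rewrite !jPK !kmul1l e_jB !jB_e.
  by [].
- split=> c z; apply: sub_inj; apply: homP => p; apply: homP => q //=.
  by rewrite lmA -[rP H _]/(P_rB H c p) jP_rB.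
- move=> F; apply: sub_inj; apply: homP => p; apply: homP => q /=.
  have /(happly q) /= -> := happly (rP H kone) (subP F (jP H p)).
  congr (sub_val F _ _); apply: (jP_inj (H := H)).
  by rewrite !jPK !kmul1l !jP_e.
Qed.

(** In the sequence with middle term Hom(G, Y), the middle is acyclic and the balanced maps have the
    cohomology of Ext_B(eG, eY). The connecting map costs one degree. *)
Lemma Pd_A d : (forall X (a : lmodst B X), Pd d a) -> Pd d.+1 (pullm (regm A)).
Proof.
move=> VB [//|m] dm Y b.
have [|||p E] := @bal_ses _ _ _ _ _ _ H tens_vanish Y _ (mod_lA (lmA b))
  (mod_l_lin H (lm b)) (homb (pullm (regm A)) b) (homb (regm G) b).
- by split=> g F; apply: homP => x //=; rewrite rAM.
- by move=> g F p0; apply: homP.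
- move=> g F p0; apply: homP => q /=.
  by rewrite -[rP H _]/(P_lG H g p0) jP_lG kmulA.
apply: (HV_ker E); last exact: Pd_reg.
apply: (HV_bal_of_lin Tor_vanish); apply: HV_lin_hom; exact: VB.
Qed.

(** Induction on j along the covers A (x)_k X -> X, whose dimension over G is at most that of A; for
    j = 0 the cover splits. *)
Lemma Pd_pull c j X (a : lmodst A X) :
  Pd c (pullm (regm A)) -> Pd j a -> Pd (j + c) (pullm a).
Proof.
move=> Vc; elim: j X a => [|j IHj] X a Va.
  have [K [z [i E]]] := ker_mod_ses (cover_mlin a) (@cover_surj _ _ _ a).
  have [s [slin ps]] := Pd0_section E Va.
  apply: Pd_retract (Pd_tens X Vc); last exact: ps.
    by move=> g x; apply: slin.
  by move=> g x; apply: (mod_ses_p E).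
have [K [z [i E]]] := ker_mod_ses (cover_mlin a) (@cover_surj _ _ _ a).
have Eg : mod_ses (pullm z) (tensm X (pullm (regm A))) (pullm a) i (klift (lm a)).
  by case: E => ilin plin i0 p1 pi ex; split=> // g x; [apply: ilin|apply: plin].
apply: (Pd_quo Eg); last by apply: (Pd_mono _ (Pd_tens X Vc)); rewrite -addSn leq_addl.
by apply: IHj; apply: (Pd_sub E) => //; apply: (Pd_mono _ (Pd_tens X (@Pd_reg _ A))).
Qed.

(** If e acts as zero then g acts as f g f, so the module is pulled back from A. *)
Lemma Pd_killed d : (forall X (a : lmodst A X), Pd d (pullm a)) ->
  forall X (b : lmodst G X), (forall x, lm b e x = 0) -> Pd d b.
Proof.
move=> VA X b be.
have bf g x : lm b (jA H (rA H g)) x = lm b g x.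
  have be' h : lm b (h ** e) x = 0 by rewrite -lmA be hom_0.
  rewrite jAK (hom_B (kmul (_ ** g))) kmul1r (hom_B (lm b)) homDE homNE be' subr0.
  by rewrite (hom_B kmul) homDE homNE (hom_B (lm b)) homDE homNE -lmA lm1 -lmA be subr0.
have aA g h x : hcomp (lm b) (jA H) g (hcomp (lm b) (jA H) h x) = hcomp (lm b) (jA H) (g ** h) x.
  by rewrite !hcompE lmA jAM.
have a1 x : hcomp (lm b) (jA H) kone x = x.
  by rewrite hcompE -(rA1 tens_vanish) bf lm1.
by apply: (Pd_retract (i := idh X) (p := idh X) _ _ _ (VA X (Lmodst aA a1))) => // g x;
  rewrite /= bf.
Qed.

Definition Pm : lmodst G P.
refine (@Lmodst _ G _ (P_lG H) _ _).
- abstract (by move=> g h p; apply: (jP_inj (H := H)); rewrite !jP_lG kmulA).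
- abstract (by move=> p; apply: (jP_inj (H := H)); rewrite jP_lG kmul1l).
Defined.
Lemma Pd_P : Pd 0 Pm.
Proof.
apply: (Pd0_free (j := jP H) (u0 := rP H kone)) => [g p|p]; first exact: jP_lG.
by apply: (jP_inj (H := H)); rewrite jP_lG jPK kmul1l jP_e.
Qed.

(** The image of p contains eX, so the cokernel is killed by e and has dimension at most d; the
    image has dimension at most r + 1, being the quotient of a projective module by the kernel. The
    bound on the kernel is assumed for every module presenting it, as callers do not see the one
    built here. *)
Lemma Pd_compare d r T X (b : lmodst G T) (a : lmodst G X) (p : hom T X) :
  (forall Z (c : lmodst G Z), (forall z, lm c e z = 0) -> Pd d c) ->
  mlin b a p -> (forall x, exists t, p t = lm a e x) -> Pd 0 b ->
  (forall K (c : lmodst G K) (i : hom K T), mlin c b i -> (forall x, p (i x) = 0) ->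
     (forall x, i x = 0 -> x = 0) -> (forall t, p t = 0 -> exists x, i x = t) -> Pd r c) ->
  (d <= r.+1)%N -> Pd r.+1 a.
Proof.
move=> Vd plin pe Vb VK dr.
have Sb g t : ker p t -> ker p (lm b g t).
  by move=> /= pt; rewrite plin pt hom_0.
have Sa g x : im p x -> im p (lm a g x).
  by move=> [t <-]; exists (lm b g t); rewrite plin.
have q1 t : im p (p t) by exists t.
have q_lin (c : k) t t' : mksub (q1 (c *: t + t')) = c *: mksub (q1 t) + mksub (q1 t').
  by apply: sub_inj; rewrite /= hom_lin.
have E1 : mod_ses (subm Sb) b (subm Sa) (sub_hom (ker p)) (Hom q_lin).
  split=> //.
  - by move=> g t; apply: sub_inj; rewrite /= plin.
  - by move=> x x0; apply: sub_inj.
  - by move=> z; have [t pt] := subP z; exists t; apply: sub_inj.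
  - by move=> x; apply: sub_inj; exact: (subP x : p (sub_val x) = 0).
  - move=> t /(congr1 (@sub_val _ _ _)) pt; by exists (mksub (S := ker p) pt).
have [Z [c [q E2]]] := quom_exists Sa.
have Vsub : Pd r (subm Sb).
  apply: (VK _ _ (sub_hom (ker p))) => //; first by move=> x; apply: (subP x).
    by move=> x x0; apply: sub_inj.
  by move=> t pt; exists (mksub (S := ker p) pt).
apply: (Pd_ext E2).
  by apply: (Pd_quo E1) => //; apply: Pd_mono Vb.
apply: (Pd_mono dr); apply: Vd => z; have [x <-] := mod_ses_surj E2 z.
rewrite -(mod_ses_p E2); have [t pt] := pe x.
exact: (mod_ses_pi E2 (mksub (S := im p) (ex_intro _ t pt))).
Qed.

Section EPartMap.
Variables (X Y : lmodType k) (a : lmodst G X) (b : lmodst G Y) (f : hom X Y).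
Hypothesis flin : mlin a b f.
Fact epart_map_subproof x : epart a x -> epart b (f x).
Proof. by move=> /= ex; rewrite -flin ex. Qed.
Fact epart_map_lin (c : k) (x y : sub (epart a)) :
  mksub (epart_map_subproof (subP (c *: x + y))) =
  c *: mksub (epart_map_subproof (subP x)) + mksub (epart_map_subproof (subP y)).
Proof. by apply: sub_inj; rewrite /= hom_lin. Qed.
Definition epart_map : hom (sub (epart a)) (sub (epart b)) := Hom epart_map_lin.
Lemma epart_map_mlin : mlin (epartm a) (epartm b) epart_map.
Proof. by move=> c x; apply: sub_inj; rewrite /= flin. Qed.
End EPartMap.

(** Multiplication by e is an exact functor. Surjectivity of p is needed only onto eX, so p itself
    need not be surjective. *)
Lemma epart_mod_ses K T X (c : lmodst G K) (b : lmodst G T) (a : lmodst G X)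
    (i : hom K T) (p : hom T X) (ilin : mlin c b i) (plin : mlin b a p) :
  (forall x, exists t, p t = lm a e x) -> (forall x, p (i x) = 0) ->
  (forall x, i x = 0 -> x = 0) -> (forall t, p t = 0 -> exists x, i x = t) ->
  mod_ses (epartm c) (epartm b) (epartm a) (epart_map ilin) (epart_map plin).
Proof.
move=> pe pi i0 ex; split; try exact: epart_map_mlin.
- by move=> x /(congr1 (@sub_val _ _ _)) /= /i0 x0; apply: sub_inj.
- move=> z; have [t pt] := pe (sub_val z).
  have et : epart b (lm b e t) by rewrite /= lmA pd_ee.
  exists (mksub et); apply: sub_inj; rewrite /= plin pt lmA pd_ee.
  exact: (subP z).
- by move=> x; apply: sub_inj; rewrite /= pi.
- move=> t /(congr1 (@sub_val _ _ _)) /= /ex [x ix].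
  have ex' : epart c x.
    apply/eqP; rewrite -subr_eq0; apply/eqP/i0.
    by rewrite hom_B ilin ix (subP t : lm b e _ = _) subrr.
  by exists (mksub ex'); apply: sub_inj.
Qed.

Section GeTens.
Variables (V : lmodType k).
Let T := tensm V Pm.
(** The e-part of Ge (x)_k V is eGe (x)_k V, which is free over B; the maps [i] and [r] make it a
    retract. *)
Lemma Pd_epart_tens : Pd 0 (epartm T).
Proof.
have [i iE] : exists i : hom (ktens B V) (sub (epart T)),
    forall b v, sub_val (i (tn B V b v)) = tn P V (rP H (jB H b)) v.
  pose i0 := klift (hcomp (tn P V) (hcomp (rP H) (jB H))).
  have i0E b v : i0 (tn B V b v) = tn P V (rP H (jB H b)) v by exact: kliftE.
  have i0e x : epart T (i0 x).
    apply: (ktens_ext (f := hcomp (lm T e) i0) (g := i0)) => b v.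
    rewrite hcompE i0E tensm_tn; congr (tn P V _ _); apply: (jP_inj (H := H)).
    by rewrite jP_lG !jPK kmulA e_jB.
  have i_lin (c : k) x y : mksub (i0e (c *: x + y)) = c *: mksub (i0e x) + mksub (i0e y).
    by apply: sub_inj; rewrite [LHS]hom_lin.
  by exists (Hom i_lin) => b v; rewrite -i0E.
have [r rE] : exists r : hom (ktens P V) (ktens B V),
    forall p v, r (tn P V p v) = tn B V (rB H (jP H p)) v.
  exists (klift (hcomp (tn B V) (hcomp (rB H) (jP H)))) => p v; exact: kliftE.
apply: (Pd_retract (i := hcomp r (sub_hom _)) (p := i) _ _ _ (Pd_tens V (@Pd_reg _ B))).
- move=> b x; rewrite -[LHS]/(r (lm T (jB H b) (sub_val x))).
  rewrite -[RHS]/(lm (tensm V (regm B)) b (r (sub_val x))).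
  apply: (ktens_ext (f := hcomp r (lm T (jB H b)))
    (g := hcomp (lm (tensm V (regm B)) b) r)) => p v.
  rewrite !hcompE tensm_tn !rE tensm_tn; congr (tn B V _ _); apply: (jB_inj (H := H)).
  by rewrite jP_lG jBM !jBK !kmulA jB_e e_jB.
- move=> b x; apply: sub_inj; rewrite -[RHS]/(lm T (jB H b) (sub_val (i x))).
  apply: (ktens_ext (f := hcomp (hcomp (sub_hom _) i) (lm (tensm V (regm B)) b))
    (g := hcomp (lm T (jB H b)) (hcomp (sub_hom _) i))) => c v.
  rewrite !hcompE tensm_tn ![sub_hom _ _]iE tensm_tn; congr (tn P V _ _); apply: (jP_inj (H := H)).
  by rewrite jP_lG !jPK jBM kmulA.
- move=> x; apply: sub_inj; rewrite -[RHS](subP x : lm T e _ = _).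
  apply: (ktens_ext (f := hcomp (hcomp (sub_hom _) i) r) (g := lm T e)) => p v.
  rewrite !hcompE rE [sub_hom _ _]iE tensm_tn; congr (tn P V _ _); apply: (jP_inj (H := H)).
  by rewrite jP_lG jPK jBK -!kmulA pd_ee jP_e.
Qed.
End GeTens.

Section Counit.
Variables (X : lmodType k) (a : lmodst G X).
Let V := sub (epart a).
Let T := tensm V Pm.
Definition counit : hom (ktens P V) X :=
  klift (hcomp (hpre X (sub_hom (epart a))) (hcomp (lm a) (jP H))).
Lemma counitE p v : counit (tn P V p v) = lm a (jP H p) (sub_val v).
Proof. exact: kliftE. Qed.
Lemma counit_mlin : mlin T a counit.
Proof.
move=> g; apply: (ktens_ext (f := hcomp counit (lm T g)) (g := hcomp (lm a g) counit)) => p v.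
by rewrite !hcompE tensm_tn !counitE lmA jP_lG.
Qed.
Lemma counit_surj x : exists t, counit t = lm a e x.
Proof.
have ex : epart a (lm a e x) by rewrite /= lmA pd_ee.
by exists (tn P V (rP H kone) (mksub ex)); rewrite counitE /= jPK kmul1l lmA pd_ee.
Qed.
End Counit.

(* X is compared with Ge (x)_k eX, whose e-part is a free B-module: the kernel *)
(* has an e-part of smaller dimension, the cokernel is killed by e and comes   *)
(* from an A-module. If eX is projective, Ge (x)_k eX is replaced by the       *)
(* summand defined by a splitting of its e-part over eX.                       *)
Lemma Pd_epart d j X (a : lmodst G X) :
  (forall Z (c : lmodst G Z), (forall z, lm c e z = 0) -> Pd d c) ->
  Pd j (epartm a) -> Pd (j + d).+1 a.
Proof.
move=> Vd; elim: j X a => [|j IHj] X a Va; last first.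
  apply: (Pd_compare Vd (@counit_mlin X a) (@counit_surj X a) (Pd_tens _ Pd_P)).
    move=> K c i ilin pi i0 ex; apply: IHj.
    have E := epart_mod_ses ilin (@counit_mlin X a) (@counit_surj X a) pi i0 ex.
    by apply: (Pd_sub E) => //; apply: Pd_mono (Pd_epart_tens _).
  by do 2!apply: leqW; apply: leq_addl.
set V := sub (epart a); set T := tensm V Pm; pose p := @counit X a.
have [s [slin ps]] : exists s : hom V (sub (epart T)),
    mlin (epartm a) (epartm T) s /\ forall v, p (sub_val (s v)) = sub_val v.
  have Sb g t : ker p t -> ker p (lm T g t).
    by move=> pt; apply: (etrans (@counit_mlin X a g t)); rewrite (pt : counit a t = 0) hom_0.
  have [||||s [slin ps]] := Pd0_section (epart_mod_ses (c := subm Sb) (i := sub_hom (ker p)) _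
    (@counit_mlin X a) (@counit_surj X a) _ _ _) Va.
  - by [].
  - by move=> x; apply: (subP x).
  - by move=> x x0; apply: sub_inj.
  - by move=> t pt; exists (mksub (S := ker p) pt).
  by exists s; split=> // v; rewrite -[in RHS](ps v).
(* F is the G-linear map p (x) v |-> p s(v). It is idempotent because s splits the counit on
   e-parts, and its image, the fixed points S, is the projective summand that replaces T. *)
pose F := klift (hcomp (hpre _ (hcomp (sub_hom _) s)) (hcomp (lm T) (jP H))) : hom (ktens P V) (ktens P V).
have FE q v : F (tn P V q v) = lm T (jP H q) (sub_val (s v)) by exact: kliftE.
have F_lin : mlin T T F.
  move=> g; apply: (ktens_ext (f := hcomp F (lm T g)) (g := hcomp (lm T g) F)) => q v.
  by rewrite !hcompE tensm_tn !FE lmA jP_lG.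
have [ep epE] : exists ep : hom X V, forall x, sub_val (ep x) = lm a e x.
  have h x : epart a (lm a e x) by rewrite /= lmA pd_ee.
  have h_lin (c : k) x y : mksub (h (c *: x + y)) = c *: mksub (h x) + mksub (h y).
    by apply: sub_inj; rewrite [LHS]hom_lin.
  by exists (Hom h_lin).
have Fe t : F (lm T e t) = sub_val (s (ep (p t))).
  apply: (ktens_ext (f := hcomp F (lm T e))
    (g := hcomp (sub_hom _) (hcomp s (hcomp ep p)))) => q v.
  rewrite !hcompE tensm_tn FE [p _]counitE.
  have -> : ep (lm a (jP H q) (sub_val v)) = lm (epartm a) (rB H (jP H q)) v.
    apply: sub_inj; rewrite epE -[RHS]/(lm a (jB H (rB H (jP H q))) (sub_val v)).
    by rewrite lmA jBK -kmulA jP_e.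
  by rewrite slin -[RHS]/(lm T (jB H (rB H (jP H q))) (sub_val (s v))) jP_lG jBK -kmulA jP_e.
have Fs v : F (sub_val (s v)) = sub_val (s v).
  rewrite -{1}(subP (s v) : lm T e _ = _) Fe ps; congr (sub_val (s _)).
  by apply: sub_inj; rewrite epE; apply: (subP v).
have FF t : F (F t) = F t.
  apply: (ktens_ext (f := hcomp F F) (g := F)) => q v.
  by rewrite hcompE FE F_lin Fs.
pose S := ker (F - idh _).
have SP t : S t <-> F t = t.
  by split=> [/= /eqP|/= ->]; rewrite ?subrr // subr_eq0 => /eqP.
have Sg g t : S t -> S (lm T g t) by rewrite !SP F_lin => ->.
have SF t : S (F t) by rewrite SP.
have SF_lin (c : k) t t' : mksub (SF (c *: t + t')) = c *: mksub (SF t) + mksub (SF t').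
  by apply: sub_inj; rewrite [LHS]hom_lin.
have Vsub : Pd 0 (subm Sg).
  apply: (Pd_retract (i := sub_hom S) (p := Hom SF_lin) _ _ _ (Pd_tens V Pd_P)) => //.
  - by move=> g t; apply: sub_inj; apply: F_lin.
  - by move=> t; apply: sub_inj; apply/SP/subP.
apply: (Pd_compare (p := hcomp p (sub_hom S)) Vd _ _ Vsub) => //.
- by move=> g t; apply: (@counit_mlin X a).
- move=> x; have Ss : S (sub_val (s (ep x))) by rewrite SP.
  by exists (mksub Ss); rewrite hcompE [p _]ps epE.
(* An element z of S in the kernel satisfies e z = F(e z) = s(e p(z)) = 0, so the kernel is killed
   by e and the bound d applies to it. *)
- move=> K c i ilin pi i0 ex; apply: Vd => z; apply: i0; apply: sub_inj.
  rewrite ilin -[LHS]/(lm T e (sub_val (i z))) -[RHS]/(0 : ktens P V).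
  have /SP <- : S (lm T e (sub_val (i z))) by apply: (Sg); apply: subP.
  by rewrite Fe -[p _]/(hcomp p (sub_hom S) (i z)) pi !hom_0.
Qed.
End Gldim.

Definition fin_extdim (k : fieldType) (G : kalg k) : Prop :=
  exists d, forall X (a : lmodst G X), Pd d a.

Lemma fin_extdim_strat (k : fieldType) (G A B : kalg k) (P Q : lmodType k)
    (H : peirce_data G A B P Q) :
  (forall n Y, HV n (balb H Y)) ->
  (forall Y (F : hom P (hom Q Y)), invt (balb H Y) F -> forall p q,
     kmul (pd_e H) (jP H p) = 0 -> kmul (jQ H q) (pd_e H) = 0 -> F p q = 0) ->
  fin_extdim A -> fin_extdim B -> fin_extdim G.
Proof.
(* The dimension of A over G is at most b + 1, hence that of A-modules at most a + (b + 1);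
   comparison through the e-part adds b + 1. *)
move=> Tor tens [a VA] [b VB]; exists (b + (a + b.+1)).+1 => X x.
apply: (Pd_epart (H := H)) => // Z c; apply: (Pd_killed (tens_vanish := tens)) => W z.
exact/Pd_pull/VA/(Pd_A Tor tens).
Qed.

(** * Comparison with Tor, Hochschild homology and global dimension *)

Section AcyclicResolution.
Variables (k : fieldType) (G : kalg k).

Record acyclic_res (Z : lmodType k) (z : bimod G Z) (X : nat -> lmodType k)
    (s : forall i, bimod G (X i)) (d : forall i, hom (X i) (X i.+1)) (u : hom Z (X 0)) :
    Prop := AcyclicRes {
  ar_d : forall i, bmap (s i) (s i.+1) (d i);
  ar_u : bmap z (s 0) u;
  ar_inj : forall x, u x = 0 -> x = 0;
  ar_du : forall x, d 0 (u x) = 0;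
  ar_exact0 : forall x, d 0 x = 0 -> exists y, u y = x;
  ar_dd : forall i x, d i.+1 (d i x) = 0;
  ar_exact : forall i x, d i.+1 x = 0 -> exists y, d i y = x;
  ar_acyclic : forall i n, HV n (s i)
}.

(** Dimension shifting: Z is replaced by the cokernel of Z -> X_0, which is ker d_1 and is resolved
    by the shifted sequence. [HV m] is degree m + 1, hence exactness of the invariants at index m +
    1. *)
Lemma HV_acyclic_res m Z (z : bimod G Z) X (s : forall i, bimod G (X i)) d u :
  acyclic_res z s d u ->
  HV m z <-> forall x, invt (s m.+1) x -> d m.+1 x = 0 -> exists y, invt (s m) y /\ d m y = x.
Proof.
elim: m Z z X s d u => [|m IHm] Z z X s d u Rs.
all: have [sd su u0 du ex0 dd ex ac] := Rs.
all: have Sl a x : ker (d 1) x -> ker (d 1) (la (s 1) a x)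
  by move=> /= x0; rewrite (sd 1).1 x0 hom_0.
all: have Sr a x : ker (d 1) x -> ker (d 1) (ra (s 1) a x)
  by move=> /= x0; rewrite (sd 1).2 x0 hom_0.
all: have p_lin (c : k) x y : mksub (S := ker (d 1)) (dd 0 (c *: x + y)) =
    c *: mksub (S := ker (d 1)) (dd 0 x) + mksub (S := ker (d 1)) (dd 0 y)
  by apply: sub_inj; rewrite /= hom_lin.
all: pose w := sub_bimod Sl Sr.
all: have E : ses z (s 0) w u (Hom p_lin).
1,3: split=> //; [by split=> a x; apply: sub_inj; [apply: (sd 0).1|apply: (sd 0).2]
  |by move=> x; have [y dy] := ex _ _ (subP x); exists y; apply: sub_inj
  |by move=> x; apply: sub_inj; apply: du
  |by move=> x /(congr1 (@sub_val _ _ _)) /= /ex0].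
- split=> [V x x_inv dx|lift].
    have [|y [y_inv dy]] := inv_lift E V (z := mksub (S := ker (d 1)) dx).
      by move=> a; apply: sub_inj; apply: x_inv.
    by exists y; split=> //; apply: (congr1 (@sub_val _ _ _) dy).
  apply: (HV0_ker E); first exact: ac.
  move=> x x_inv; have [|y [y_inv dy]] := lift (sub_val x) _ (subP x).
    by move=> a; apply: (congr1 (@sub_val _ _ _) (x_inv a)).
  by exists y; split=> //; apply: sub_inj.
- rewrite -(IHm _ w (fun i => X i.+1) (fun i => s i.+1) (fun i => d i.+1) (sub_hom _)).
    split=> V; first by apply: (HV_coker E) => //; apply: ac.
    by apply: (HV_ker E) => //; apply: ac.
  split=> //.
  - by move=> x x0; apply: sub_inj.
  - by move=> x; apply: (subP x).
  - by move=> x dx; exists (mksub (S := ker (d 1)) dx).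
  - by move=> i; apply: ex.
Qed.
End AcyclicResolution.

(** Enveloping algebras and corners are given as bare rings; their k-algebra structure is a central
    ring map from k. *)
Record algstr (k : fieldType) (R : pzRingType) := Algstr {
  eta :> k -> R;
  etaD : forall a b, eta (a + b) = eta a + eta b;
  etaM : forall a b, eta (a * b) = eta a * eta b;
  eta1 : eta 1 = 1;
  etaC : forall a x, eta a * x = x * eta a
}.

Definition algstrc (k : fieldType) (R : pzRingType) (E : algstr k R) : algstr k R^c.
refine (@Algstr k R^c E (etaD E) _ (eta1 E) _).
- abstract (by move=> a b; rewrite mulrC etaM).
- abstract (by move=> a x; rewrite -[RHS]/((E a : R) * x) etaC).
Defined.

Definition kmod (k : fieldType) (R : pzRingType) (E : algstr k R) (M : lmodType R) : Type := M.
Section KMod.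
Variables (k : fieldType) (R : pzRingType) (E : algstr k R) (M : lmodType R).
Local Notation KM := (kmod E M).
HB.instance Definition _ := GRing.Zmodule.on KM.
Definition kmod_scale (c : k) (x : KM) : KM := E c *: (x : M).
Fact kmod_scaleA a b x : kmod_scale a (kmod_scale b x) = kmod_scale (a * b) x.
Proof. by rewrite /kmod_scale scalerA etaM. Qed.
Fact kmod_scale1 : left_id 1 kmod_scale.
Proof. by move=> x; rewrite /kmod_scale eta1 scale1r. Qed.
Fact kmod_scaleDr : right_distributive kmod_scale +%R.
Proof. by move=> a x y; rewrite /kmod_scale; apply: (@scalerDr R M). Qed.
Fact kmod_scaleDl x : {morph kmod_scale^~ x : a b / a + b}.
Proof. by move=> a b; rewrite /kmod_scale etaD; apply: (@scalerDl R M). Qed.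
HB.instance Definition _ := GRing.Zmodule_isLmodule.Build k KM
  kmod_scaleA kmod_scale1 kmod_scaleDr kmod_scaleDl.
Lemma kmod_scaleE (c : k) (x : KM) : c *: x = E c *: (x : M) :> M.
Proof. by []. Qed.
End KMod.

Section RingAlg.
Variables (k : fieldType) (R : pzRingType) (E : algstr k R).
Local Notation KR := (kmod E R^o).
Lemma kreg_scaleE (c : k) (x : KR) : c *: x = (E c * (x : R)) :> R.
Proof. by []. Qed.

Definition ring_mul : hom KR (hom KR KR).
refine (@hom2 _ _ _ _ (fun x y : KR => ((x : R) * (y : R) : R) : KR) _ _).
- abstract (by move=> x c y z; rewrite !kreg_scaleE mulrDr !mulrA etaC).
- abstract (by move=> c x y z; rewrite !kreg_scaleE mulrDl !mulrA).
Defined.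
Definition kalg_of : kalg k := @KAlg k KR ring_mul (1 : R) (@mulrA R) (@mul1r R) (@mulr1 R).

Section OfMod.
Variable M : lmodType R.
Definition kmod_act : hom kalg_of (hom (kmod E M) (kmod E M)).
refine (@hom2 _ _ _ _ (fun (a : KR) (x : kmod E M) => ((a : R) *: (x : M) : M) : kmod E M) _ _).
- abstract (by move=> a c x y; rewrite !kmod_scaleE scalerDr !scalerA etaC).
- abstract (by move=> c a b x; rewrite kreg_scaleE !kmod_scaleE scalerDl !scalerA).
Defined.
Definition lmod_of : lmodst kalg_of (kmod E M) :=
  @Lmodst _ kalg_of _ kmod_act (@scalerA R M) (@scale1r R M).
End OfMod.

Lemma lmod_ofE (M : lmodType R) (t : kalg_of) (x : kmod E M) :
  lm (lmod_of M) t x = (t : R) *: (x : M).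
Proof. by []. Qed.

Definition rmod (X : lmodType k) (a : lmodst kalg_of X) : Type := X.
Section ToMod.
Variables (X : lmodType k) (a : lmodst kalg_of X).
HB.instance Definition _ := GRing.Zmodule.on (rmod a).
Definition rmod_scale (r : R) (x : rmod a) : rmod a := lm a (r : kalg_of) (x : X).
Fact rmod_scaleA r r' x : rmod_scale r (rmod_scale r' x) = rmod_scale (r * r') x.
Proof. exact: lmA. Qed.
Fact rmod_scale1 : left_id 1 rmod_scale.
Proof. exact: lm1. Qed.
Fact rmod_scaleDr : right_distributive rmod_scale +%R.
Proof. by move=> r x y; apply: hom_D. Qed.
Fact rmod_scaleDl x : {morph rmod_scale^~ x : r r' / r + r'}.
Proof. by move=> r r'; rewrite /rmod_scale (hom_D (lm a)). Qed.
HB.instance Definition _ := GRing.Zmodule_isLmodule.Build R (rmod a)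
  rmod_scaleA rmod_scale1 rmod_scaleDr rmod_scaleDl.
End ToMod.

Definition khom (M N : lmodType R) (f : {linear M -> N}) : hom (kmod E M) (kmod E N).
refine (@Hom _ _ _ (fun x : kmod E M => f x : kmod E N) _).
abstract (by move=> c x y; rewrite kmod_scaleE linearP).
Defined.
End RingAlg.

Section MkLinear.
Variables (R : pzRingType) (M N : lmodType R) (f : M -> N).
Definition mklinear_fun (_ : linear f) : M -> N := f.
HB.instance Definition _ (h : linear f) :=
  GRing.isLinear.Build R M N *:%R (mklinear_fun h) h.
Definition mklinear (h : linear f) : {linear M -> N} := mklinear_fun h.
End MkLinear.

Section ProjSection.
Variables (k : fieldType) (R : pzRingType) (E : algstr k R) (P : lmodType R).
Local Notation G := (kalg_of E).

Definition free_cover := rmod (tensm (kmod E P) (regm G)).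

Definition fcover (x : free_cover) : P := klift (lm (lmod_of E P)) x.
Fact fcover_lin : linear fcover.
Proof.
move=> r x y; rewrite [LHS]hom_D; congr (_ + _).
exact: (cover_mlin (lmod_of E P) (r : G) x).
Qed.
HB.instance Definition _ := GRing.isLinear.Build R free_cover P *:%R fcover fcover_lin.

Lemma fcover_surj : surjective fcover.
Proof. exact: (@cover_surj _ _ _ (lmod_of E P)). Qed.

Lemma fcover_scaleE (c : k) (t : ktens G (kmod E P)) :
  (E c : R) *: (t : free_cover) = c *: t.
Proof.
change (tensm_act (kmod E P) (regm G) (E c : G) t = c *: t).
elim/ktens_ind: t => [|b z|u v IHu IHv]; first by rewrite hom_0 scaler0.
  by rewrite tensm_tn -homZE -hom_Z.
by rewrite hom_D scalerDr IHu IHv.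
Qed.

(** The identity of P is lifted along the canonical cover R (x)_k P -> P; the splitting is k-linear
    because k acts through R. *)
Lemma proj_section : projective P -> exists s : hom (kmod E P) (ktens G (kmod E P)),
  mlin (lmod_of E P) (tensm (kmod E P) (regm G)) s /\ forall x, klift (lm (lmod_of E P)) (s x) = x.
Proof.
move=> projP.
have [s sP] := projP _ _ (fcover : {linear free_cover -> P}) (idfun : {linear P -> P}) fcover_surj.
have s_lin (c : k) (x y : kmod E P) : (s (c *: x + y) : ktens G (kmod E P)) =
    c *: (s x : ktens G (kmod E P)) + s y.
  by rewrite kmod_scaleE linearP -fcover_scaleE.
exists (Hom s_lin); split=> [r x|x]; last exact: sP.
exact: (linearZZ s (r : R) (x : P)).
Qed.

(** A lift is chosen k-linearly on 1 (x) P by [lin_lift] and extended R-linearly. *)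
Lemma fcover_proj : projective free_cover.
Proof.
move=> X Y g f g1.
have f0_lin (c : k) (x y : kmod E P) : (f (tn G (kmod E P) kone (c *: x + y)) : kmod E Y) =
    c *: (f (tn G (kmod E P) kone x) : kmod E Y) + f (tn G (kmod E P) kone y).
  by rewrite hom_lin -fcover_scaleE linearP.
have [|l lP] := @lin_lift _ _ _ _ (khom E g) (Hom f0_lin).
  by move=> z; apply: g1.
pose h0 := klift (hswap (hcomp (hswap (lm (lmod_of E X))) l)).
have h0E b z : h0 (tn G (kmod E P) b z) = (b : R) *: (l z : X) by exact: kliftE.
have h0_lin : linear (h0 : free_cover -> X).
  move=> r x y; rewrite [LHS]hom_D; congr (_ + _).
  apply: (ktens_ext (f := hcomp h0 (lm (tensm _ (regm G)) (r : G)))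
    (g := hcomp (lm (lmod_of E X) (r : G)) h0)) => b z.
  by rewrite !hcompE tensm_tn !h0E; apply/esym/(@scalerA R X).
exists (mklinear h0_lin) => t; change (g (h0 t) = f t).
elim/ktens_ind: (t : ktens G (kmod E P)) => [|b z|u v IHu IHv].
- by rewrite hom_0 [LHS]linear0; apply/esym/(linear0 f).
- rewrite h0E linearZZ [g (l z)]lP -[RHS]/(f (tn G (kmod E P) b z)).
  rewrite -[in RHS](kmul1r b) -[tn _ _ _ _](tensm_tn (regm G)).
  by rewrite -[LHS](linearZZ f (b : R)).
- by rewrite hom_D [LHS]linearD IHu IHv; apply/esym/(linearD f).
Qed.
End ProjSection.

Lemma proj_Pd0 (k : fieldType) (R : pzRingType) (E : algstr k R) (P : lmodType R) :
  projective P -> Pd 0 (lmod_of E P).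
Proof.
move=> /(proj_section E) [s [slin ps]].
apply: Pd_retract slin _ ps (Pd_tens _ (@Pd_reg _ _)) => g x.
exact: (cover_mlin (lmod_of E P)).
Qed.

Section ResolutionExists.
Variables (k : fieldType) (R : pzRingType) (E : algstr k R) (M : lmodType R).

Definition rker (X Y : lmodType R) (f : {linear X -> Y}) : subsp X.
refine (@Subsp _ _ (fun x => f x = 0) (linear0 f) _).
abstract (by move=> c x y fx fy; rewrite linearP fx fy scaler0 addr0).
Defined.

Definition syzygy (X : lmodType R) : lmodType R :=
  sub (rker (@fcover k R E X : {linear free_cover E X -> X})).
Fixpoint syzygies n : lmodType R := if n is n'.+1 then syzygy (syzygies n') else M.

Definition syz_val (X : lmodType R) (x : free_cover E (syzygy X)) : free_cover E X :=
  sub_val (fcover x).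
Fact syz_val_lin X : linear (@syz_val X).
Proof. by move=> c x y; rewrite /syz_val linearP. Qed.
HB.instance Definition _ X :=
  GRing.isLinear.Build R _ _ *:%R (@syz_val X) (@syz_val_lin X).

Lemma syz_exact X (x : free_cover E X) :
  fcover x = 0 <-> exists y, syz_val y = x.
Proof.
split=> [x0|[y <-]]; last exact: (subP (fcover y)).
have [y yP] := @fcover_surj _ _ E _
  (mksub (S := rker (@fcover k R E X : {linear _ -> _})) x0 : syzygy X).
by exists y; rewrite /syz_val yP.
Qed.

(** Vanishing of Tor asserts the existence of a resolution, so one has to be exhibited when coming
    back from cohomology. *)
Definition free_resolution : proj_resolution M.
refine (@ProjResolution R M (fun n => free_cover E (syzygies n))
  (fun n => @syz_val (syzygies n)) (@fcover k R E M) _ _ _ _).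
- abstract (by move=> n; apply: fcover_proj).
- abstract (exact: fcover_surj).
- abstract (exact: syz_exact).
- abstract (move=> n x; rewrite -syz_exact; change (sub_val (fcover x) = 0 <-> fcover x = 0);
  split=> [x0|->//];
  exact: (@sub_inj _ _ _ _ 0 x0)).
Defined.
End ResolutionExists.

Section Balanced.
Variables (k : fieldType) (R : pzRingType) (E : algstr k R).
Local Notation G := (kalg_of E).
Local Notation KR M := (kmod (algstrc E) M).
Local Notation KL N := (kmod E N).

Definition ract (M : lmodType R^c) : hom G (hom (KR M) (KR M)).
refine (@hom2 _ _ _ _ (fun (b : G) (m : KR M) => (((b : R) : R^c) *: (m : M) : M) : KR M) _ _).
- abstract (by move=> b c x y; rewrite !kmod_scaleE scalerDr !scalerA etaC).
- abstract (by move=> c a b x; rewrite kreg_scaleE !kmod_scaleE scalerDl !scalerA etaC).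
Defined.

Section BalM.
Variables (M : lmodType R^c) (N : lmodType R) (Y : lmodType k).
Local Notation D := (hom (KR M) (hom (KL N) Y)).
Definition balM_la := pre_act (hom (KL N) Y) (ract M).
Definition balM_ra := pt_act (KR M) (pre_act Y (lm (lmod_of E N))).
Definition balM : bimod G D.
refine (@Bimod _ G _ balM_la balM_ra _ _ _).
- abstract (by move=> a b F; apply: homP => m; congr (F _); apply: (@scalerA R^c M)).
- abstract (by move=> a b F; apply: homP => m; apply: homP => n; congr (F _ _);
  apply: (@scalerA R N)).
- abstract (by move=> a b F; apply: homP => m; apply: homP => n).
Defined.
Lemma balMP (F : D) : invt balM F <->
  forall (b : R) (m : M) (n : N), F ((b : R^c) *: m) n = F m (b *: n).
Proof.
split=> [F_inv b m n|F_bal b]; first exact: (happly (n : KL N) (happly (m : KR M) (F_inv (b : G)))).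
by apply: homP => m; apply: homP => n; apply: F_bal.
Qed.
End BalM.

Definition bten (M : lmodType R^c) (N : lmodType R) : Type := tensor M N.
Section BTen.
Variables (M : lmodType R^c) (N : lmodType R).
HB.instance Definition _ := GRing.Zmodule.on (bten M N).

Fact bscale_balanced (c : k) : @balanced R M N (bten M N)
  (fun m n => tens (((E c : R) : R^c) *: m) n).
Proof.
split=> [m m' n|m n n'|a m n]; first by rewrite scalerDr [LHS]tensDl.
  by rewrite [LHS]tensDr.
by rewrite scalerA (etaC (algstrc E) c a : _ = _ :> R^c) -scalerA tensZ.
Qed.
Definition bscale (c : k) (x : bten M N) : bten M N :=
  @tens_lift R M N (bten M N) (fun m n => tens (((E c : R) : R^c) *: m) n) x.
Lemma bscaleE c m n : bscale c (tens m n) = tens (((E c : R) : R^c) *: m) n.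
Proof. exact: tens_liftE (bscale_balanced c) _ _. Qed.
Lemma bscaleDr : right_distributive bscale +%R.
Proof. by move=> c x y; exact: tens_liftD (bscale_balanced c) _ _. Qed.
Lemma bscale0 c : bscale c 0 = 0.
Proof. exact: tens_lift0 (bscale_balanced c). Qed.
Lemma bscaleA a b x : bscale a (bscale b x) = bscale (a * b) x.
Proof.
elim/tens_ind: x => [|u v|x y IHx IHy]; rewrite ?bscale0 ?bscaleE //.
  by rewrite scalerA (etaM (algstrc E) a b : _ = _ :> R^c).
by rewrite !bscaleDr IHx IHy.
Qed.
Lemma bscale1 : left_id 1 bscale.
Proof.
elim/tens_ind=> [|u v|x y IHx IHy]; rewrite ?bscale0 ?bscaleE ?eta1 ?scale1r //.
by rewrite bscaleDr IHx IHy.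
Qed.
Lemma bscaleDl x : {morph bscale^~ x : a b / a + b}.
Proof.
move=> a b; elim/tens_ind: x => [|u v|x y IHx IHy]; rewrite ?bscale0 ?bscaleE ?addr0 //.
  by rewrite (etaD (algstrc E) a b : _ = _ :> R^c) scalerDl [LHS]tensDl.
by rewrite !bscaleDr IHx IHy addrACA.
Qed.
HB.instance Definition _ := GRing.Zmodule_isLmodule.Build k (bten M N)
  bscaleA bscale1 bscaleDr bscaleDl.

Definition btn : hom (KR M) (hom (KL N) (bten M N)).
refine (@hom2 _ _ _ _ (fun (m : KR M) (n : KL N) => tens (m : M) (n : N) : bten M N) _ _).
- abstract (by move=> m c n n'; rewrite [LHS]tensDr kmod_scaleE -tensZ -bscaleE).
- abstract (by move=> c m m' n; rewrite [LHS]tensDl kmod_scaleE -bscaleE).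
Defined.

Lemma bten_ext (Y : lmodType k) (f g : hom (bten M N) Y) :
  (forall m n, f (btn m n) = g (btn m n)) -> forall x, f x = g x.
Proof.
move=> fg; elim/tens_ind=> [|u v|x y IHx IHy]; [by rewrite !hom_0|exact: fg|].
by rewrite !hom_D IHx IHy.
Qed.

Lemma blift_exists (Y : lmodType k) (F : hom (KR M) (hom (KL N) Y)) :
  invt (balM M N Y) F -> exists f : hom (bten M N) Y, forall m n, f (btn m n) = F m n.
Proof.
move/balMP=> F_bal.
have bal : @balanced R M N Y (fun m n => F m n).
  by split=> [m m' n|m n n'|a m n]; rewrite ?(hom_D F) ?(hom_D (F m)) // F_bal.
have f_lin (c : k) x y : tens_lift (fun (m : M) (n : N) => F m n) (c *: x + y : bten M N) =
    c *: tens_lift (fun (m : M) (n : N) => F m n) x + tens_lift (fun (m : M) (n : N) => F m n) y.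
  rewrite (tens_liftD bal); congr (_ + _); elim/tens_ind: x => [|u v|x x' IHx IHx'].
  - by rewrite scaler0 !(tens_lift0 bal) scaler0.
  - rewrite [X in tens_lift _ X]bscaleE !(tens_liftE bal).
    by rewrite -[_ *: u]/(c *: (u : KR M)) hom_Z.
  - by rewrite scalerDr !(tens_liftD bal) scalerDr IHx IHx'.
by exists (Hom f_lin) => m n; apply: (tens_liftE bal).
Qed.
End BTen.

Lemma bmapl_exists (M M' : lmodType R^c) (N : lmodType R) (f : {linear M -> M'}) :
  exists h : hom (bten M N) (bten M' N), (forall x, h x = tens_mapl f x) /\
    forall m n, h (btn M N m n) = btn M' N (khom (algstrc E) f m) n.
Proof.
have [|h hP] := @blift_exists M N _ (hcomp (btn M' N) (khom (algstrc E) f)).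
  by apply/balMP => b m n; rewrite /= linearZZ; apply: tensZ.
exists h; split=> // x; have bal := @tens_mapl_balanced R M M' N f.
elim/tens_ind: x => [|u v|x y IHx IHy].
- by rewrite hom_0 [RHS](tens_lift0 bal).
- by rewrite [RHS](tens_liftE bal) -[LHS]/(h (btn M N u v)) hP.
- by rewrite hom_D [RHS](tens_liftD bal) IHx IHy.
Qed.

Section Exactness.
Variables (M2 M1 M0 : lmodType R^c) (d1 : {linear M2 -> M1}) (d0 : {linear M1 -> M0}).
Variable N : lmodType R.

Definition tens_exact := forall x : tensor M1 N, tens_mapl d0 x = 0 ->
  exists y : tensor M2 N, tens_mapl d1 y = x.
Definition bal_exact (Y : lmodType k) := forall F : hom (KR M1) (hom (KL N) Y),
  invt (balM M1 N Y) F -> hpre _ (khom (algstrc E) d1) F = 0 ->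
  exists F', invt (balM M0 N Y) F' /\ hpre _ (khom (algstrc E) d0) F' = F.

(** Balanced maps are linear maps on the tensor product, and Hom(-, Y) preserves exactness by
    [lin_factor]. *)
Lemma tens_bal_exact Y : tens_exact -> bal_exact Y.
Proof.
move=> ex F F_bal Fd1; have [f fP] := blift_exists F_bal.
have [h1 [h1E h1t]] := bmapl_exists N d1; have [h0 [h0E h0t]] := bmapl_exists N d0.
have [x|g gP] := @lin_factor _ _ _ _ h0 f.
  rewrite h0E => /ex [y <-]; rewrite -h1E.
  apply: (bten_ext (f := hcomp f h1) (g := 0)) => m n.
  by rewrite hcompE h1t fP; apply: (happly n (happly m Fd1)).
exists (hcomp (hpost _ g) (btn M0 N)); split.
  by apply/balMP => b m n; congr (g _); apply: tensZ.
by apply: homP => m; apply: homP => n; rewrite -fP gP h0t.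
Qed.

(** A cycle that is no boundary is detected by a functional vanishing on boundaries ([lin_sep]);
    exactness of the dual factors this functional through d0, which kills the cycle. *)
Lemma bal_tens_exact : (forall x, d0 (d1 x) = 0) -> bal_exact k^o -> tens_exact.
Proof.
move=> dd ex x; have [h1 [h1E h1t]] := bmapl_exists N d1.
have [h0 [h0E h0t]] := bmapl_exists N d0; rewrite -h0E => h0x.
have [[y yP]|nox] := pselect (exists y, h1 y = x); first by exists y; rewrite -h1E.
exfalso; have [f [fim fx]] := lin_sep (S := im h1) nox; apply: fx.
have [||F' [F'_bal F'E]] := ex (hcomp (hpost _ f) (btn M1 N)).
- by apply/balMP => b m n; congr (f _); apply: tensZ.
- apply: homP => m; apply: homP => n; rewrite -[LHS]/(f (btn M1 N (khom (algstrc E) d1 m) n)) -h1t.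
  by apply: fim; exists (btn M2 N m n).
have [f' f'P] := blift_exists F'_bal.
rewrite (bten_ext (f := f) (g := hcomp f' h0)) => [|m n]; first by rewrite hcompE h0x hom_0.
by rewrite hcompE h0t f'P; apply/esym/(happly n (happly m F'E)).
Qed.
End Exactness.
End Balanced.

(** Hom(-, Z) turns a projective resolution into an exact sequence of vector spaces in the other
    direction, whatever the compatible bimodule structures are. *)
Lemma res_acyclic (k : fieldType) (G : kalg k) (S : pzRingType) (E : algstr k S) (M : lmodType S)
    (P : proj_resolution M) (Z : lmodType k) (z : bimod G (hom (kmod E M) Z))
    (s : forall i, bimod G (hom (kmod E (P i)) Z)) :
  (forall i, bmap (s i) (s i.+1) (hpre Z (khom E (res_diff P i)))) ->
  bmap z (s 0) (hpre Z (khom E (res_aug P))) -> (forall i n, HV n (s i)) ->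
  acyclic_res z s (fun i => hpre Z (khom E (res_diff P i))) (hpre Z (khom E (res_aug P))).
Proof.
move=> sd su ac; split=> //.
- by move=> F F0; apply: homP => x; have [y <-] := res_aug_surj P x;
  exact: (happly (y : kmod E (P 0)) F0).
- move=> F; apply: homP => x /=; rewrite (_ : res_aug P _ = 0) ?hom_0 //.
  by apply/res_exact0; exists x.
- move=> F F0; have [x x0|f fP] := @lin_factor _ _ _ _ (khom E (res_aug P)) F.
    have [y <-] := (@res_exact0 _ _ P x).1 x0.
    exact: (happly (y : kmod E (P 1)) F0).
  by exists f; apply: homP => x; rewrite fP.
- move=> i F; apply: homP => x /=; rewrite (_ : res_diff P i _ = 0) ?hom_0 //.
  by apply/res_exactS; exists x.
- move=> i F F0; have [x x0|f fP] := @lin_factor _ _ _ _ (khom E (res_diff P i)) F.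
    have [y <-] := (@res_exactS _ _ P i x).1 x0.
    exact: (happly (y : kmod E (P i.+2)) F0).
  by exists f; apply: homP => x; rewrite fP.
Qed.

Section TorBridge.
Variables (k : fieldType) (R : pzRingType) (E : algstr k R).
Local Notation G := (kalg_of E).
Local Notation KR M := (kmod (algstrc E) M).
Local Notation KL N := (kmod E N).

Fact conv_lin (c : k) (x y : kalg_of (algstrc E)) :
  (c *: x + y : kalg_of (algstrc E)) = c *: (x : G) + (y : G).
Proof. by rewrite -[c *: x]/((E c : R^c) * (x : R^c)) -[_ * _]/((x : R) * E c) -etaC. Qed.
Definition conv : hom (kalg_of (algstrc E)) G :=
  @Hom _ (kalg_of (algstrc E)) G (fun x => x) conv_lin.

(** The section P -> R (x)_k P makes Hom(P, Z) a summand of the coinduced Hom(R, Hom(P, Z)). *)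
Lemma proj_balM n (P : lmodType R^c) (N : lmodType R) Y : projective P -> HV n (balM E P N Y).
Proof.
move=> /(proj_section (algstrc E)) [s [slin ps]]; apply: HV_lcoind.
set Z := hom (KL N) Y.
pose lam0 (F : hom G (hom (KR P) Z)) : hom (KR P) Z := hcomp (klift (hcomp F conv)) s.
have lam_lin (c : k) F F' : lam0 (c *: F + F') = c *: lam0 F + lam0 F'.
  apply: homP => p; apply: (ktens_ext (f := klift (hcomp (c *: F + F') conv))
    (g := c *: klift (hcomp F conv) + klift (hcomp F' conv))) => b x.
  by rewrite !homE !kliftE.
exists (Hom lam_lin); split=> [F|a F|a F]; apply: homP => p.
- rewrite -[in RHS](ps p).
  apply: (ktens_ext (f := klift (hcomp (hswap (la (balM E P N Y)) F) conv))
    (g := hcomp F (klift (lm (lmod_of (algstrc E) P))))) => b x.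
  by rewrite hcompE !kliftE.
- rewrite -[RHS]/(klift (hcomp F conv) (s (lm (lmod_of (algstrc E) P) a p))) slin.
  apply: (ktens_ext (f := klift (hcomp (hcomp F (hswap kmul a)) conv))
    (g := hcomp (klift (hcomp F conv))
      (lm (tensm (KR P) (regm (kalg_of (algstrc E)))) (a : kalg_of (algstrc E))))) => b x.
  by rewrite hcompE tensm_tn !kliftE.
- apply: (ktens_ext (f := klift (hcomp (hcomp (ra (balM E P N Y) a) F) conv))
    (g := hcomp (pre_act Y (lm (lmod_of E N)) a) (klift (hcomp F conv)))) => b x.
  by rewrite hcompE !kliftE.
Qed.

Lemma Tor_HV (M : lmodType R^c) (N : lmodType R) m :
  Tor_eq0 M N m.+1 -> forall Y, HV m (balM E M N Y).
Proof.
move=> [P Pex] Y.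
have A : acyclic_res (balM E M N Y) (fun i => balM E (P i) N Y)
    (fun i => hpre _ (khom (algstrc E) (res_diff P i))) (hpre _ (khom (algstrc E) (res_aug P))).
  apply: res_acyclic => [i|//|i n].
  - by split=> b F; apply: homP => m' //=; rewrite linearZZ.
  - by split=> b F; apply: homP => m' //=; rewrite linearZZ.
  by apply: proj_balM; apply: res_proj.
apply/(HV_acyclic_res m A) => F F_inv Fd.
exact: (tens_bal_exact Pex F_inv Fd).
Qed.
End TorBridge.

(** Applied with S the converse of the enveloping algebra of G: both actions of G on Hom(X, Y) come
    from elements of S acting on X, [ev] turns cochains on G into cochains on S, and the section of
    X in S (x)_k X provides the averaging map. *)
Lemma lcoind_of_section (k : fieldType) (S G : kalg k) (X Y : lmodType k) (a : lmodst S X)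
    (s : hom X (ktens S X)) (t : bimod G (hom X Y))
    (ev : hom (hom G (hom X Y)) (hom S (hom X Y))) :
  mlin a (tensm X (regm S)) s -> (forall x, klift (lm a) (s x) = x) ->
  (forall f g x, ev (hswap (la t) f) g x = f (lm a g x)) ->
  (forall b, exists h, (forall f x, la t b f x = f (lm a h x)) /\
     forall F g x, ev (hcomp F (hswap kmul b)) g x = ev F (kmul h g) x) ->
  (forall b, exists h, (forall f x, ra t b f x = f (lm a h x)) /\
     forall F g x, ev (hcomp (ra t b) F) g x = ev F (kmul h g) x) ->
  lcoind t.
Proof.
move=> slin ps e1 e2 e3; pose lam0 F : hom X Y := hcomp (klift (ev F)) s.
have lam0_lin (c : k) F F' : lam0 (c *: F + F') = c *: lam0 F + lam0 F'.
  apply: homP => p; apply: (ktens_ext (f := klift (ev (c *: F + F')))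
    (g := c *: klift (ev F) + klift (ev F'))) => g x.
  by rewrite !homE !kliftE hom_lin.
exists (Hom lam0_lin); split=> [F|b F|b F]; apply: homP => p.
- rewrite -[in RHS](ps p); apply: (ktens_ext (f := klift (ev (hswap (la t) F)))
    (g := hcomp F (klift (lm a)))) => g x.
  by rewrite hcompE !kliftE.
- have [h [h1 h2]] := e2 b; rewrite h1 -[RHS]/(klift (ev F) (s (lm a h p))) slin.
  apply: (ktens_ext (f := klift (ev (hcomp F (hswap kmul b))))
    (g := hcomp (klift (ev F)) (lm (tensm X (regm S)) h))) => g x.
  by rewrite hcompE tensm_tn !kliftE h2.
- have [h [h1 h2]] := e3 b; rewrite h1 -[RHS]/(klift (ev F) (s (lm a h p))) slin.
  apply: (ktens_ext (f := klift (ev (hcomp (ra t b) F)))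
    (g := hcomp (klift (ev F)) (lm (tensm X (regm S)) h))) => g x.
  by rewrite hcompE tensm_tn !kliftE h2.
Qed.

Section EnvelopingBimodule.
Variables (k : fieldType) (L : falgType k).
Local Notation Le := (enveloping L).

Definition falg_algstr : algstr k L.
refine (@Algstr k L (fun c => c%:A) _ _ (scale1r 1) _).
- abstract (by move=> a b; rewrite scalerDl).
- abstract (by move=> a b; rewrite -scalerAl mul1r scalerA).
- abstract (by move=> a x; rewrite -scalerAl mul1r -scalerAr mulr1).
Defined.

Definition env_algstr : algstr k Le.
refine (@Algstr k Le (fun c => etens c%:A 1) _ _ _ _).
- abstract (by move=> a b; rewrite scalerDl etensDl).
- abstract (by move=> a b; rewrite etensM mulr1 -scalerAl mul1r scalerA).
- abstract (by rewrite scale1r).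
- abstract (move=> c; elim/etens_ind=> [|a b|x y IHx IHy];
  [by rewrite mulr0 mul0r|by rewrite !etensM -scalerAl -scalerAr !mul1r !mulr1
  |by rewrite mulrDr mulrDl IHx IHy]).
Defined.

Local Notation G := (kalg_of falg_algstr).
Local Notation KR M := (kmod (algstrc env_algstr) M).
Local Notation KL N := (kmod env_algstr N).
Local Notation ract x m := ((x : Le^c) *: m).

Lemma etens_scale (M : lmodType Le^c) (c : k) a b (m : M) :
  ract (etens (c *: a) b) m = (c *: (ract (etens a b) m : KR M)).
Proof.
rewrite kmod_scaleE scalerA; congr (_ *: _).
by rewrite -[RHS]/(etens a b * etens c%:A 1) etensM mul1r -scalerAr mulr1.
Qed.
Lemma etens_scale' (M : lmodType Le^c) (c : k) a b (m : M) :
  ract (etens a (c *: b)) m = (c *: (ract (etens a b) m : KR M)).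
Proof. by rewrite -etensZ etens_scale. Qed.
Lemma falg_scaleE (c : k) (x : G) : (c *: x : G) = (c *: (x : L)) :> L.
Proof. by rewrite kreg_scaleE /= -scalerAl mul1r. Qed.

Lemma etens0l b : etens (0 : L) b = 0.
Proof. by apply: (addrI (etens (0 : L) b)); rewrite -etensDl !addr0. Qed.

Section Bim.
Variable M : lmodType Le^c.
Local Notation D := (hom (KR M) k^o).
Definition hh_actl : hom G (hom (KR M) (KR M)).
refine (@hom2 _ _ _ _ (fun (g : G) (m : KR M) => (ract (etens (g : L) 1) (m : M) : KR M)) _ _).
- abstract (by move=> g c m m'; rewrite !kmod_scaleE scalerDr !scalerA
    (etaC (algstrc env_algstr) c (etens _ 1) : _ = _ :> Le^c)).
- abstract (by move=> c g g' m; rewrite falg_scaleE etensDl scalerDl etens_scale).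
Defined.
Definition hh_actr : hom G (hom (KR M) (KR M)).
refine (@hom2 _ _ _ _ (fun (g : G) (m : KR M) => (ract (etens 1 (g : L)) (m : M) : KR M)) _ _).
- abstract (by move=> g c m m'; rewrite !kmod_scaleE scalerDr !scalerA
    (etaC (algstrc env_algstr) c (etens 1 _) : _ = _ :> Le^c)).
- abstract (by move=> c g g' m; rewrite falg_scaleE etensDr scalerDl etens_scale').
Defined.
Lemma ractA (x y : Le) (m : M) : ract x (ract y m) = ract (y * x) m.
Proof. exact: (@scalerA Le^c M). Qed.

Definition hhb_la := pre_act k^o hh_actl.
Definition hhb_ra := pre_act k^o hh_actr.
Definition hhb : bimod G D.
refine (@Bimod _ G _ hhb_la hhb_ra _ _ _).
- abstract (by move=> a b F; apply: homP => m; rewrite /= ractA etensM mulr1).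
- abstract (by move=> a b F; apply: homP => m; rewrite /= ractA etensM mulr1).
- abstract (by move=> a b F; apply: homP => m; rewrite /= !ractA !etensM !mulr1 !mul1r).
Defined.

Lemma hhbP (F : D) : invt hhb F <->
  forall (g : L) (m : M), F (ract (etens g 1) m) = F (ract (etens 1 g) m).
Proof.
split=> [F_inv g m|F_bal g]; first exact: (happly (m : KR M) (F_inv (g : G))).
by apply: homP => m; apply: F_bal.
Qed.

Local Notation BD := (hom (KR M) (hom (KL (left_reg L)) k^o)).

(** As L is cyclic over its enveloping algebra, a balanced form on M x L is determined by its values
    at (m, 1). Those values are exactly the functionals on M invariant under the two actions;
    [bal_to_hh] is the inverse. *)
Lemma hh_to_bal F : invt hhb F -> exists B : BD,
  invt (balM env_algstr M (left_reg L) k^o) B /\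
  forall (m : M) (x : L), B m x = F (ract (etens x 1) m).
Proof.
move/hhbP=> F_inv.
have B2 (m : KR M) (c : k) (x x' : KL (left_reg L)) :
    F (ract (etens ((c *: x + x' : KL (left_reg L)) : L) 1) (m : M)) =
    c *: F (ract (etens (x : L) 1) (m : M)) + F (ract (etens (x' : L) 1) (m : M)).
  rewrite kmod_scaleE [_ *: (x : left_reg L)]left_actE mulr1 -scalerAl mul1r.
  by rewrite etensDl scalerDl etens_scale hom_lin.
have B1 (c : k) (m m' : KR M) (x : KL (left_reg L)) :
    F (ract (etens (x : L) 1) (c *: m + m' : M)) =
    c *: F (ract (etens (x : L) 1) (m : M)) + F (ract (etens (x : L) 1) (m' : M)).
  by rewrite -[ract _ _]/(hh_actl (x : G) (c *: m + m')) !hom_lin.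
exists (hom2 B2 B1); split=> //; apply/balMP => t m x /=.
elim/etens_ind: t => [|a b|u v IHu IHv].
- by rewrite !scale0r scaler0 etens0l scale0r.
- rewrite ractA etensM mul1r [etens a b *: _]left_actE.
  have := F_inv b (ract (etens (a * (x : L)) 1) m).
  by rewrite !ractA !etensM !mulr1 => ->.
- rewrite !(scalerDl (R := Le^c)) !(scalerDl (R := Le)) scalerDr etensDl scalerDl.
  by rewrite !hom_D IHu IHv.
Qed.

Lemma bal_to_hh (B : BD) : invt (balM env_algstr M (left_reg L) k^o) B ->
  exists F, invt hhb F /\ forall m : M, F m = B m (1 : L).
Proof.
move/balMP=> B_bal.
exists (hswap B (1 : L)); split=> //; apply/hhbP => g m.
rewrite -[LHS]/(B (ract (etens g 1) m) (1 : L)) -[RHS]/(B (ract (etens 1 g) m) (1 : L)).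
by rewrite !B_bal ![_ *: (1 : left_reg L)]left_actE !mul1r !mulr1.
Qed.
End Bim.

Section Acyclic.
Variables (P : lmodType Le^c).
Local Notation Ge := (kalg_of (algstrc env_algstr)).

Local Notation D := (hom (KR P) k^o).

Section EnvEval.
Variable F : hom G D.
(** A cochain on L extended to a (x) b: F is evaluated at a, then at the element x moved by 1 (x)
    b. *)
Definition env_eval (t : Ge) (x : KR P) : k^o :=
  etens_lift (fun a b => F (a : G) (hh_actr P (b : G) x) : k^o) (t : Le).
Fact env_bal (x : KR P) : [/\
  forall a a' b : L, F ((a + a' : L) : G) (hh_actr P (b : G) x) =
    F (a : G) (hh_actr P (b : G) x) + F (a' : G) (hh_actr P (b : G) x),
  forall a b b' : L, F (a : G) (hh_actr P ((b + b' : L) : G) x) =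
    F (a : G) (hh_actr P (b : G) x) + F (a : G) (hh_actr P (b' : G) x)
  & forall (c : k) (a b : L), F ((c *: a : L) : G) (hh_actr P (b : G) x) =
    F (a : G) (hh_actr P ((c *: b : L) : G) x)].
Proof.
split=> [a a' b|a b b'|c a b].
- by rewrite (hom_D F).
- by rewrite (hom_D (hh_actr P)) homDE hom_D.
- by rewrite -!falg_scaleE !(hom_Z, homZE).
Qed.
Lemma env_evalE (a b : L) x : env_eval (etens a b) x = F (a : G) (hh_actr P (b : G) x).
Proof. by have [h1 h2 h3] := env_bal x;
  exact: (@etens_liftE k L k^o (fun a b => F (a : G) (hh_actr P (b : G) x)) h1 h2 h3 a b). Qed.
Lemma env_evalD t t' x : env_eval (t + t') x = env_eval t x + env_eval t' x.
Proof. by have [h1 h2 h3] := env_bal x;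
  exact: (@etens_liftD k L k^o (fun a b => F (a : G) (hh_actr P (b : G) x)) h1 h2 h3 t t'). Qed.
Lemma env_eval0 x : env_eval 0 x = 0.
Proof. by have [h1 h2 h3] := env_bal x;
  exact: (@etens_lift0 k L k^o (fun a b => F (a : G) (hh_actr P (b : G) x)) h1 h2 h3). Qed.
Fact env_eval2 t (c : k) x x' : env_eval t (c *: x + x') = c *: env_eval t x + env_eval t x'.
Proof.
elim/etens_ind: t => [|a b|u v IHu IHv]; first by rewrite !env_eval0 scaler0 addr0.
  by rewrite !env_evalE !hom_lin.
by rewrite !env_evalD IHu IHv scalerDr addrACA.
Qed.
Fact env_eval1 (c : k) t t' x : env_eval (c *: t + t') x = c *: env_eval t x + env_eval t' x.
Proof.
rewrite env_evalD; congr (_ + _); rewrite -[c *: t]/((t : Le) * etens c%:A 1).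
elim/etens_ind: (t : Le) => [|a b|u v IHu IHv].
- by rewrite mul0r env_eval0 scaler0.
- by rewrite etensM mul1r -scalerAr mulr1 !env_evalE -falg_scaleE hom_Z.
- by rewrite mulrDl !env_evalD IHu IHv scalerDr.
Qed.
Definition env_hom : hom Ge D := hom2 env_eval2 env_eval1.
End EnvEval.

Fact env_hom_lin (c : k) (F F' : hom G D) : env_hom (c *: F + F') = c *: env_hom F + env_hom F'.
Proof.
apply: homP => t; apply: homP => x; rewrite !homE.
elim/etens_ind: (t : Le) => [|a b|u v IHu IHv]; first by rewrite !hom_0 !homE scaler0 addr0.
  by rewrite ![env_hom _ _ _]env_evalE !homE.
by rewrite !(hom_D (env_hom _)) !homDE IHu IHv scalerDr addrACA.
Qed.
Definition env_homh : hom (hom G D) (hom Ge D) := Hom env_hom_lin.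
End Acyclic.
End EnvelopingBimodule.

Section HochschildBridge.
Variables (k : fieldType) (L : falgType k).
Local Notation Le := (enveloping L).
Local Notation env_algstr := (env_algstr L).
Local Notation G := (kalg_of (falg_algstr L)).
Local Notation KR M := (kmod (algstrc env_algstr) M).
Local Notation KL N := (kmod env_algstr N).
Local Notation ract x m := ((x : Le^c) *: m).
Local Notation Ge := (kalg_of (algstrc env_algstr)).

Lemma hhb_laE (P : lmodType Le^c) (a : G) (f : hom (KR P) k^o) (x : KR P) :
  la (hhb P) a f x = f (ract (etens (a : L) 1) (x : P)).
Proof. by []. Qed.
Lemma hhb_raE (P : lmodType Le^c) (a : G) (f : hom (KR P) k^o) (x : KR P) :
  ra (hhb P) a f x = f (ract (etens 1 (a : L)) (x : P)).
Proof. by []. Qed.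

Lemma proj_hhb (P : lmodType Le^c) n : projective P -> HV n (hhb P).
Proof.
move=> /(proj_section (algstrc env_algstr)) [s [slin ps]]; apply: HV_lcoind.
have evE F (b c : L) x : env_homh P F (etens b c : Ge) x = F (b : G) (hh_actr P (c : G) x).
  exact: env_evalE.
apply: (lcoind_of_section (ev := env_homh P) slin ps) => [f t x|a|a].
- rewrite lmod_ofE; elim/etens_ind: (t : Le) => [|b c|u v IHu IHv].
  + by rewrite (hom_0 (env_homh P _)) scale0r hom_0.
  + by rewrite evE hhb_laE ractA etensM !mul1r.
  + by rewrite (hom_D (env_homh P _)) homDE IHu IHv scalerDl (hom_D f).
- exists (etens (a : L) 1 : Ge); split=> [f x|F t x]; first by rewrite hhb_laE lmod_ofE.
  rewrite -[kmul _ _]/((t : Le) * etens (a : L) 1).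
  elim/etens_ind: (t : Le) => [|b c|u v IHu IHv].
  + by rewrite mul0r !(hom_0 (env_homh P _)).
  + by rewrite etensM mul1r !evE.
  + by rewrite mulrDl !(hom_D (env_homh P _)) !homDE IHu IHv.
- exists (etens 1 (a : L) : Ge); split=> [f x|F t x]; first by rewrite hhb_raE lmod_ofE.
  rewrite -[kmul _ _]/((t : Le) * etens 1 (a : L)).
  elim/etens_ind: (t : Le) => [|b c|u v IHu IHv].
  + by rewrite mul0r !(hom_0 (env_homh P _)).
  + by rewrite etensM mulr1 !evE [LHS](hhb_raE a (F b)) ractA etensM mul1r.
  + by rewrite mulrDl !(hom_D (env_homh P _)) !homDE IHu IHv.
Qed.

Section Resolution.
Variable P : proj_resolution (right_reg L).

Lemma hhb_acyclic : acyclic_res (hhb (right_reg L)) (fun i => hhb (P i))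
  (fun i => hpre _ (khom (algstrc env_algstr) (res_diff P i)))
  (hpre _ (khom (algstrc env_algstr) (res_aug P))).
Proof.
apply: res_acyclic => [i||i n].
- by split=> b F; apply: homP => m //=; rewrite linearZZ.
- by split=> b F; apply: homP => m //=; rewrite linearZZ.
- by apply: proj_hhb; apply: res_proj.
Qed.

Lemma HV_bal_exact m : HV m (hhb (right_reg L)) <->
  bal_exact env_algstr (res_diff P m.+1) (res_diff P m) (left_reg L) k^o.
Proof.
rewrite (HV_acyclic_res m hhb_acyclic); split=> ex.
  move=> B B_bal Bd; have [F [F_inv FB]] := bal_to_hh B_bal.
  have BF x (y : L) : B x y = F (ract (etens y 1) x).
    rewrite FB; move/balMP: B_bal => ->.
    by rewrite [_ *: (1 : left_reg L)]left_actE !mulr1.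
  have [|F' [F'_inv F'F]] := ex F F_inv.
    apply: homP => x; rewrite -[LHS]/(F (res_diff P m.+1 x)) FB.
    exact: (happly ((1 : L) : KL (left_reg L)) (happly (x : KR (P m.+2)) Bd)).
  have [B' [B'_bal B'F]] := hh_to_bal F'_inv; exists B'; split=> //.
  apply: homP => x; apply: homP => y; rewrite BF -F'F.
  by rewrite -[LHS]/(B' (res_diff P m x) y) B'F -linearZZ.
move=> F F_inv Fd; have [B [B_bal BF]] := hh_to_bal F_inv.
have [|B' [B'_bal B'B]] := ex B B_bal.
  apply: homP => x; apply: homP => y.
  rewrite -[LHS]/(B (res_diff P m.+1 x) y) BF -linearZZ.
  exact: (happly (ract (etens (y : L) 1) (x : P m.+2) : KR (P m.+2)) Fd).
have [F' [F'_inv F'B]] := bal_to_hh B'_bal; exists F'; split=> //.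
apply: homP => x; rewrite -[LHS]/(F' (res_diff P m x)) F'B.
rewrite -[LHS]/(hpre _ (khom (algstrc env_algstr) (res_diff P m)) B' x (1 : L)) B'B BF.
by rewrite scale1r.
Qed.
End Resolution.

(** From left to right any resolution serves, and from right to left the free one is used. Degree m
    + 1 matches [HV m]. *)
Lemma HH_HV_hhb m : HH_eq0 L m.+1 <-> HV m (hhb (right_reg L)).
Proof.
split=> [[P Pex]|V].
  by apply/(HV_bal_exact P) => F F_bal Fd; apply: (tens_bal_exact Pex).
exists (free_resolution (algstrc env_algstr) (right_reg L)).
set P := free_resolution _ _.
apply: (bal_tens_exact (E := env_algstr) (d1 := res_diff P m.+1) (d0 := res_diff P m)).
  by move=> x; apply/res_exactS; exists x.
exact/(HV_bal_exact P).
Qed.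

(** The right regular module over the enveloping algebra is L itself, with the two k-structures
    identified by [u] and [v], so its dual is the dual bimodule of L. *)
Lemma HH_HV m : HH_eq0 L m.+1 <-> HV m (dualb G).
Proof.
have u_lin (c : k) (x y : KR (right_reg L)) : ((c *: x + y : KR (right_reg L)) : L) =
    (c *: ((x : L) : G) + ((y : L) : G) : G).
  rewrite kmod_scaleE [_ *: (x : right_reg L)]right_actE mul1r.
  by rewrite -scalerAr mulr1 falg_scaleE.
pose u : hom (KR (right_reg L)) G :=
  @Hom k (KR (right_reg L)) G (fun x => ((x : L) : G)) u_lin.
have v_lin (c : k) (x y : G) : ((c *: x + y : G) : L) =
    (c *: ((x : L) : KR (right_reg L)) + ((y : L) : KR (right_reg L)) : KR (right_reg L)).
  by rewrite (u_lin c x y).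
pose v : hom G (KR (right_reg L)) :=
  @Hom k G (KR (right_reg L)) (fun x => ((x : L) : KR (right_reg L))) v_lin.
have uv : bmap (dualb G) (hhb (right_reg L)) (hpre _ u).
  split=> g F; apply: homP => x; rewrite /= ?[_ *: (x : right_reg L)]right_actE.
    by rewrite mul1r.
  by rewrite mulr1.
have vu : bmap (hhb (right_reg L)) (dualb G) (hpre _ v).
  split=> g F; apply: homP => x; congr (F _); rewrite [LHS]right_actE.
    by rewrite mul1r.
  by rewrite mulr1.
rewrite HH_HV_hhb; split; first by apply: (HV_retract uv vu) => F; apply: homP.
by apply: (HV_retract vu uv) => F; apply: homP.
Qed.

(** The shift by one degree turns the strict bound N < m into N <= m. *)
Lemma finite_HH_HV : finite_HH L <-> exists N, forall m, (N <= m)%N -> HV m (dualb G).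
Proof.
split=> [[N NP]|[N NP]]; exists N => m Nm; first by apply/HH_HV/NP.
by case: m Nm => // m Nm; apply/HH_HV/NP.
Qed.
End HochschildBridge.

Section GldimBridge.
Variables (k : fieldType) (R : pzRingType) (E : algstr k R).
Local Notation G := (kalg_of E).

Lemma proj_dim_Pd d (M : lmodType R) : proj_dim_le M d -> Pd d (lmod_of E M).
Proof.
move=> [P P0] m dm Y b.
have A : acyclic_res (homb (lmod_of E M) b) (fun i => homb (lmod_of E (P i)) b)
    (fun i => hpre _ (khom E (res_diff P i))) (hpre _ (khom E (res_aug P))).
  apply: res_acyclic => [i||i n].
  - by split=> g F; apply: homP => x //=; rewrite linearZZ.
  - by split=> g F; apply: homP => x //=; rewrite linearZZ.
  - by apply: proj_Pd0 => //; apply: res_proj.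
apply/(HV_acyclic_res m A) => F _ _; exists 0; split.
  by move=> g; rewrite !hom_0.
by apply: homP => x; rewrite (P0 m.+1 dm x) !hom_0.
Qed.

(** Every module over [kalg_of E] is an R-module, and its k-structure is the one induced by E, since
    the action is k-linear and unital. *)
Lemma finite_gldim_extdim : finite_gldim R -> fin_extdim G.
Proof.
move=> [d dP]; exists d => X a; have V := proj_dim_Pd (dP (rmod a)).
have scE (c : k) (x : kmod E (rmod a)) : c *: x = c *: (x : X).
  rewrite kmod_scaleE -[LHS]/(lm a (E c : G) x).
  have -> : (E c : G) = c *: kone by rewrite kreg_scaleE [RHS]mulr1.
  by rewrite hom_Z homZE lm1.
have u_lin (c : k) (x y : X) : (c *: x + y : X) = c *: (x : kmod E (rmod a)) + (y : kmod E (rmod a)).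
  by rewrite scE.
have v_lin (c : k) (x y : kmod E (rmod a)) : (c *: x + y : kmod E (rmod a)) = c *: (x : X) + (y : X).
  by rewrite scE.
by apply: (Pd_retract (i := @Hom k X (kmod E (rmod a)) (fun x => x) u_lin)
  (p := @Hom k (kmod E (rmod a)) X (fun x => x) v_lin) _ _ _ V).
Qed.

Lemma syzygy_mod_ses (M : lmodType R) : exists i p,
  mod_ses (lmod_of E (syzygy E M)) (lmod_of E (free_cover E M)) (lmod_of E M) i p /\ 
  forall x, p x = @fcover _ _ E M x.
Proof.
have i_lin : linear (fun x : syzygy E M => sub_val x) by [].
exists (khom E (mklinear i_lin)), (khom E (@fcover _ _ E M : {linear _ -> _})).
split=> //; split=> [||x x0|z|x|x x0].
- by move=> g x.
- by move=> g x; apply: (linearZZ (@fcover _ _ E M : {linear _ -> _})).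
- exact: sub_inj.
- exact: (@fcover_surj _ _ E M).
- exact: (subP x).
- by exists (mksub (S := rker (@fcover _ _ E M : {linear _ -> _})) x0).
Qed.

(** The canonical free cover of M splits, so M is a summand of a projective module. *)
Lemma Pd0_projective (M : lmodType R) : Pd 0 (lmod_of E M) -> projective M.
Proof.
move=> V; have [i [p [Em pE]]] := syzygy_mod_ses M.
have [s [slin ps]] := Pd0_section Em V.
move=> X Y g f g1.
have fc_lin : linear (fun x => f (@fcover _ _ E M x)) by move=> r x y; rewrite !linearP.
have [h hP] := fcover_proj (mklinear fc_lin) g1.
have h_lin : linear (fun x : M => h (s x)).
  move=> r x y; rewrite -linearP; congr (h _); rewrite -[RHS]/(_ + (s y)) (hom_D s); congr (_ + _).
  exact: (slin (r : G) x).
exists (mklinear h_lin) => x; rewrite [LHS]hP -[RHS]/(f x) -[in RHS](ps x) pE.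
by [].
Qed.

Definition zero_mod (M : lmodType R) : lmodType R.
refine (sub (@Subsp R M (fun x => x = 0) erefl _)).
abstract (by move=> c x y -> ->; rewrite scaler0 addr0).
Defined.
Lemma zero_modP (M : lmodType R) (x : zero_mod M) : x = 0.
Proof. by apply: sub_inj; apply: (subP x). Qed.

Lemma projective_dim0 (M : lmodType R) : projective M -> proj_dim_le M 0.
Proof.
move=> projM; pose P (n : nat) := if n is 0 then M else zero_mod M.
have z_lin (X Y : lmodType R) : linear (fun _ : X => 0 : Y).
  by move=> r x y; rewrite scaler0 addr0.
have id_lin : linear (fun x : M => x) by [].
have zproj : projective (zero_mod M).
  move=> X Y g f _; exists (mklinear (z_lin (zero_mod M) X)) => p.
  by rewrite (zero_modP p) !linear0.
have Pproj n : projective (P n) by case: n.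
have id_surj : surjective (mklinear id_lin) by move=> x; exists x.
have ex0 (x : M) : mklinear id_lin x = 0 <-> exists y : zero_mod M, mklinear (z_lin (zero_mod M) M) y = x.
  by split=> [x0|[y <-]]; [exists 0; rewrite [RHS]x0|].
have exS n (x : P n.+1) : mklinear (z_lin (P n.+1) (P n)) x = 0 <->
    exists y : P n.+2, mklinear (z_lin (P n.+2) (P n.+1)) y = x.
  by split=> [_|//]; exists 0; apply/esym/zero_modP.
exists (@ProjResolution R M P (fun n => mklinear (z_lin (P n.+1) (P n))) (mklinear id_lin)
  Pproj id_surj ex0 exS).
by move=> [//|n] _ x; apply: zero_modP.
Qed.

Lemma proj_dim_syzygy d (M : lmodType R) :
  proj_dim_le (syzygy E M) d -> proj_dim_le M d.+1.
Proof.
move=> [Q Q0]; pose P (n : nat) : lmodType R := if n is n'.+1 then Q n' else free_cover E M.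
have d0_lin : linear (fun x : Q 0 => sub_val (res_aug Q x)).
  by move=> r x y; rewrite linearP.
pose D (n : nat) : {linear P n.+1 -> P n} :=
  match n with 0 => mklinear d0_lin | n'.+1 => res_diff Q n' end.
have Pproj n : projective (P n).
  by case: n => [|n]; [apply: fcover_proj|apply: res_proj].
have ex0 (x : P 0) : @fcover _ _ E M x = 0 <-> exists y, D 0 y = x.
  split=> [x0|[y <-]]; last exact: (subP (res_aug Q y)).
  have [y yP] := res_aug_surj Q (mksub (S := rker (@fcover _ _ E M : {linear _ -> _})) x0).
  by exists y; rewrite [LHS](congr1 (@sub_val _ _ _) yP).
have exS n x : D n x = 0 <-> exists y, D n.+1 y = x.
  case: n x => [|n] x; last exact: res_exactS.
  rewrite -res_exact0; split=> [x0|x0]; first exact: (@sub_inj _ _ _ _ 0 x0).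
  by rewrite [LHS](congr1 (@sub_val _ _ _) x0).
exists (@ProjResolution R M P D (@fcover _ _ E M : {linear _ -> _}) Pproj
  (@fcover_surj _ _ E M) ex0 exS).
by move=> [//|n] dn x; apply: Q0.
Qed.

(** Each syzygy lowers the Ext-dimension by one; after d of them the module is projective, and the
    resolution is assembled backwards. *)
Lemma Pd_proj_dim d (M : lmodType R) : Pd d (lmod_of E M) -> proj_dim_le M d.
Proof.
elim: d M => [|d IHd] M V; first exact/projective_dim0/Pd0_projective.
apply: proj_dim_syzygy; apply: IHd; have [i [p [Em _]]] := syzygy_mod_ses M.
apply: (Pd_sub Em) => //; apply: (Pd_mono _ (proj_Pd0 (fcover_proj (P := M)))) => //.
Qed.

Lemma extdim_finite_gldim : fin_extdim G -> finite_gldim R.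
Proof. by move=> [d dP]; exists d => M; apply: Pd_proj_dim. Qed.
End GldimBridge.

(** * Corners *)

Section CornerAlgstr.
Variables (k : fieldType) (R : pzRingType) (E : algstr k R) (e : idem R).

Fact corner_eta_subproof c : (e : R) * E c \in in_peirce e e.
Proof. by rewrite unfold_in /in_peirce mulrA idemP -mulrA etaC mulrA idemP. Qed.
Definition corner_eta (c : k) : corner e := Peirce (corner_eta_subproof c).

Definition corner_algstr : algstr k (corner e).
refine (@Algstr k (corner e) corner_eta _ _ _ _).
- abstract (by move=> a b; apply: val_inj; rewrite /= etaD mulrDr).
- abstract (by move=> a b; apply: val_inj; rewrite /= etaM [RHS]mulrA;
    have /= -> := peirce_r (corner_eta a); rewrite mulrA).
- abstract (by apply: val_inj; rewrite /= eta1 mulr1).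
- abstract (by move=> c x; apply: val_inj;
    rewrite /= [RHS]mulrA peirce_r -mulrA etaC mulrA peirce_l).
Defined.
End CornerAlgstr.

Section PeirceData.
Variables (k : fieldType) (R : pzRingType) (E : algstr k R) (e : idem R).
Local Notation f := (idemC e).
Local Notation one := (idem1 R).
Local Notation G := (kalg_of E).
Local Notation KP := (kmod (algstrc (corner_algstr E e)) (rpeirce one e)).
Local Notation KQ := (kmod (corner_algstr E e) (lpeirce e one)).

Section Corner.
Variable g : idem R.
Local Notation C := (kalg_of (corner_algstr E g)).
Fact corner_val_lin (c : k) (x y : C) :
  (peirce_val (c *: x + y) : G) = c *: (peirce_val x : G) + peirce_val y.
Proof. by rewrite kreg_scaleE /= -mulrA etaC mulrA peirce_l -etaC. Qed.
Definition corner_val : hom C G := @Hom k C G (fun x => peirce_val x : G) corner_val_lin.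
Fact corner_cut_subproof (x : R) : (g : R) * x * (g : R) \in in_peirce g g.
Proof. by rewrite unfold_in /in_peirce !mulrA idemP -mulrA idemP. Qed.
Fact corner_cut_lin (c : k) (x y : G) :
  (Peirce (corner_cut_subproof (c *: x + y)) : C) =
  c *: (Peirce (corner_cut_subproof x) : C) + (Peirce (corner_cut_subproof y) : C).
Proof.
apply: val_inj; rewrite [RHS]corner_val_lin kreg_scaleE /= kreg_scaleE mulrDr mulrDl !mulrA.
by rewrite (etaC E c (g : R)).
Qed.
Definition corner_cut : hom G C :=
  @Hom k G C (fun x => Peirce (corner_cut_subproof x) : C) corner_cut_lin.
End Corner.

Fact KP_scaleE (c : k) (x y : KP) :
  peirce_val (c *: x + y) = E c * peirce_val x + peirce_val y.
Proof. by rewrite kmod_scaleE /= mulrA peirce_r -etaC. Qed.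
Fact KQ_scaleE (c : k) (x y : KQ) :
  peirce_val (c *: x + y) = E c * peirce_val x + peirce_val y.
Proof. by rewrite kmod_scaleE /= -etaC -mulrA peirce_l. Qed.

Definition KP_val : hom KP G := @Hom k KP G (fun x => peirce_val x : G) KP_scaleE.
Definition KQ_val : hom KQ G := @Hom k KQ G (fun x => peirce_val x : G) KQ_scaleE.

Fact KP_cut_subproof (x : R) : x * (e : R) \in in_peirce one e.
Proof. by rewrite unfold_in /in_peirce mul1r -mulrA idemP. Qed.
Fact KQ_cut_subproof (x : R) : (e : R) * x \in in_peirce e one.
Proof. by rewrite unfold_in /in_peirce mulr1 mulrA idemP. Qed.
Definition KP_cut : hom G KP.
refine (@Hom k G KP (fun x => Peirce (KP_cut_subproof x) : KP) _).
abstract (by move=> c x y; apply: val_inj; rewrite [RHS]KP_scaleE /= kreg_scaleE mulrDl mulrA).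
Defined.
Definition KQ_cut : hom G KQ.
refine (@Hom k G KQ (fun x => Peirce (KQ_cut_subproof x) : KQ) _).
abstract (by move=> c x y; apply: val_inj; rewrite [RHS]KQ_scaleE /= kreg_scaleE mulrDr !mulrA etaC).
Defined.

Local Notation A := (kalg_of (corner_algstr E f)).
Local Notation B := (kalg_of (corner_algstr E e)).

Definition peirce_dec : peirce_data G A B KP KQ.
refine (@PeirceData k G A B KP KQ (e : R) (corner_val f) (corner_cut f)
  (corner_val e) (corner_cut e) KP_val KP_cut KQ_val KQ_cut _ _ _ _ _ _ _ _ _ _ _ _).
- exact: (idemP e).
- by move=> a; apply: val_inj; apply: peirceP.
- by move=> a; apply: val_inj; apply: peirceP.
- by move=> a; apply: val_inj; apply: peirce_r.
- by move=> a; apply: val_inj; apply: peirce_l.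
- by [].
- by [].
- by [].
- by [].
- by [].
- by [].
- by [].
Defined.

Hypothesis e_strat : strongly_stratifying e.

(** The two bimodule structures differ only by multiplications with e on elements that already
    absorb it, so the identity maps form a retract. *)
Lemma peirce_dec_Tor n Y : HV n (balb peirce_dec Y).
Proof.
have [TorE _ _] := e_strat.
have := Tor_HV (corner_algstr E e) (TorE n.+1 isT) Y.
apply: (HV_retract (i := idh _) (p := idh _)) => //.
- split=> b F; apply: homP => p; last first.
    apply: homP => q; rewrite [RHS]/=; congr (F p _); apply: val_inj.
    by rewrite /= mulrA peirce_l.
  rewrite [RHS]/=; congr (F _); apply: val_inj.
  by rewrite /= -mulrA peirce_r.
- split=> b F; apply: homP => p; last first.
    apply: homP => q; rewrite [RHS]/=; congr (F p _); apply: val_inj.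
    by rewrite /= mulrA peirce_l.
  rewrite [RHS]/=; congr (F _); apply: val_inj.
  by rewrite /= -mulrA peirce_r.
Qed.

Fact incl_l_subproof (x : rpeirce f e) : peirce_val x \in in_peirce one e.
Proof. by rewrite unfold_in /in_peirce mul1r peirce_r. Qed.
Fact incl_r_subproof (x : lpeirce e f) : peirce_val x \in in_peirce e one.
Proof. by rewrite unfold_in /in_peirce mulr1 peirce_l. Qed.

(** F restricts to a balanced map on fRe x eRf, which factors through a zero tensor product. *)
Lemma peirce_dec_tens Y (F : hom KP (hom KQ Y)) : invt (balb peirce_dec Y) F ->
  forall p q, kmul (pd_e peirce_dec) (jP peirce_dec p) = 0 ->
  kmul (jQ peirce_dec q) (pd_e peirce_dec) = 0 -> F p q = 0.
Proof.
have [_ tens0 _] := e_strat.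
move=> F_inv p q ep qe.
pose il (x : rpeirce f e) : KP := Peirce (incl_l_subproof x).
pose ir (x : lpeirce e f) : KQ := Peirce (incl_r_subproof x).
have il_D x y : il (x + y) = il x + il y by apply: val_inj.
have ir_D x y : ir (x + y) = ir x + ir y by apply: val_inj.
pose phi (x : rpeirce f e) (y : lpeirce e f) := F (il x) (ir y).
have phiB : @balanced (corner e) (rpeirce f e) (lpeirce e f) Y phi.
  split=> [m m' n|m n n'|b m n]; rewrite /phi.
  - by rewrite il_D hom_D.
  - by rewrite ir_D hom_D.
  have := happly (ir n) (happly (il m) (F_inv (b : B))).
  rewrite [LHS]/= [RHS]/= => Fb.
  transitivity (F (KP_cut (peirce_val m * peirce_val b)) (ir n)).
    by congr (F _ _); apply: val_inj; rewrite /= -mulrA peirce_r.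
  by rewrite [LHS]Fb; congr (F _ _); apply: val_inj; rewrite /= mulrA peirce_l.
have pf : peirce_val p \in in_peirce f e.
  rewrite unfold_in /in_peirce -mulrA peirce_r mulrBl mul1r.
  by rewrite [X in _ - X]ep subr0.
have qf : peirce_val q \in in_peirce e f.
  rewrite unfold_in /in_peirce peirce_l mulrBr mulr1.
  by rewrite [X in _ - X]qe subr0.
have := tens_liftE phiB (Peirce pf) (Peirce qf).
rewrite (tens0 (tens _ _)) (tens_lift0 phiB) => phi0.
by rewrite [RHS]phi0 /phi; congr (F _ _); apply: val_inj.
Qed.

(* HH_m(H) is dual to H^m(H; Hom(H, k)). *)
Definition finHH (H : kalg k) : Prop := exists N, forall m, (N <= m)%N -> HV m (dualb H).

Lemma finHH_strat : finHH G -> finHH A /\ finHH B.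
Proof.
case=> N HN; have VA m : (N <= m)%N -> HV m (dualb A).
  by move=> Nm; apply: (HV_dualA peirce_dec_tens); apply: HN.
split; exists N => // m Nm.
apply: (HV_dualB peirce_dec_Tor peirce_dec_tens); first exact: HN.
by apply: VA; apply: leqW.
Qed.

Lemma fin_extdim_step : fin_extdim A -> fin_extdim B -> fin_extdim G.
Proof. exact: (fin_extdim_strat peirce_dec_Tor peirce_dec_tens). Qed.
End PeirceData.

(** * Isomorphic algebras and nested corners *)

Section Iso.
Variable k : fieldType.

Definition kmulmap (G H : kalg k) (j : hom G H) : Prop :=
  forall a b, j (kmul a b) = kmul (j a) (j b).

Definition kiso (G H : kalg k) : Prop := exists (j : hom G H) (r : hom H G),
  [/\ kmulmap j, kmulmap r, forall a, r (j a) = a & forall b, j (r b) = b].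

Lemma kiso_sym G H : kiso G H -> kiso H G.
Proof. by case=> j [r [? ? ? ?]]; exists r, j. Qed.

Lemma finHH_iso G H : kiso G H -> finHH G -> finHH H.
Proof.
case=> j [r [jM rM rj jr]] [N HN]; exists N => m /HN.
apply: (HV_retract_alg rM jM jr (u := hpre _ j) (v := hpre _ r)).
- by move=> a F; apply: homP => x /=; rewrite jM.
- by move=> a F; apply: homP => x /=; rewrite jM.
- by move=> a F; apply: homP => x /=; rewrite rM.
- by move=> a F; apply: homP => x /=; rewrite rM.
- by move=> F; apply: homP => a /=; rewrite jr.
Qed.

Lemma kmulmap_one (G H : kalg k) (j : hom G H) (r : hom H G) :
  kmulmap j -> (forall b, j (r b) = b) -> j kone = kone.
Proof. by move=> jM jr; rewrite -[LHS]kmul1r -[X in kmul _ X]jr -jM kmul1l jr. Qed.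

Lemma fin_extdim_iso G H : kiso G H -> fin_extdim G -> fin_extdim H.
Proof.
case=> j [r [jM rM rj jr]] [d Hd]; exists d => X a m dm Y b.
have j1 := kmulmap_one jM jr.
have pullA Z (c : lmodst H Z) (g h : G) z :
    hcomp (lm c) j g (hcomp (lm c) j h z) = hcomp (lm c) j (kmul g h) z.
  by rewrite !hcompE jM; apply: lmA.
have pull1 Z (c : lmodst H Z) z : hcomp (lm c) j kone z = z.
  by rewrite hcompE j1; apply: lm1.
have := Hd X (Lmodst (pullA X a) (pull1 X a)) m dm Y (Lmodst (pullA Y b) (pull1 Y b)).
apply: (HV_retract_alg rM jM jr (u := idh _) (v := idh _)) => //.
- by move=> g F; apply: homP => x.
- by move=> g F; apply: homP => x.
- by move=> h F; apply: homP => x /=; rewrite jr.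
- by move=> h F; apply: homP => x /=; rewrite jr.
Qed.

(* [i] identifies [G] with the corner g K g. *)
Definition is_corner (K G : kalg k) (i : hom G K) (g : K) : Prop :=
  [/\ kmulmap i, forall x, i x = 0 -> x = 0, forall x, kmul (kmul g (i x)) g = i x
    & forall y, kmul (kmul g y) g = y -> exists x, i x = y].

Lemma hom_inj (U V : lmodType k) (i : hom U V) :
  (forall x, i x = 0 -> x = 0) -> injective i.
Proof.
move=> i0 x y xy; apply/eqP; rewrite -subr_eq0; apply/eqP/i0.
by rewrite hom_B xy subrr.
Qed.

(** Used to compare corners of corners with corners of L: the carrier types differ, but the images
    in K coincide. *)
Lemma corner_iso (K G H : kalg k) i j (g : K) :
  @is_corner K G i g -> @is_corner K H j g -> kiso G H.
Proof.
suff half G' H' i' j' : @is_corner K G' i' g -> @is_corner K H' j' g ->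
    exists2 f : hom G' H', kmulmap f & forall x, j' (f x) = i' x.
  move=> Gi Hj; have [f fM ff] := half _ _ _ _ Gi Hj.
  have [f' f'M ff'] := half _ _ _ _ Hj Gi.
  have [_ i0 _ _] := Gi; have [_ j0 _ _] := Hj.
  exists f, f'; split=> // x.
    by apply: (hom_inj i0); rewrite ff' ff.
  by apply: (hom_inj j0); rewrite ff ff'.
move=> [iM i0 ig iS] [jM j0 jg jS].
have ex x : exists y, j' y = i' x by apply: jS; apply: ig.
have [f ff] := choice ex.
have f_lin (c : k) x y : f (c *: x + y) = c *: f x + f y.
  by apply: (hom_inj j0); rewrite ff !hom_lin !ff.
exists (Hom f_lin); last by move=> x; apply: ff.
by move=> a b; apply: (hom_inj j0); rewrite jM !ff iM.
Qed.

Lemma is_corner_comp (K G H : kalg k) i j (g : K) (h : G) :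
  kmul h h = h -> kmul g g = g -> @is_corner K G i g -> @is_corner G H j h ->
  @is_corner K H (hcomp i j) (i h).
Proof.
move=> hh gg [iM i0 ig iS] [jM j0 jh jS]; split=> [a b|x|x|y hy].
- by rewrite !hcompE jM iM.
- by move=> /i0 /j0.
- by rewrite !hcompE -!iM jh.
have gh : kmul g (i h) = i h by rewrite -[in LHS]ig !kmulA gg ig.
have hg : kmul (i h) g = i h by rewrite -[in LHS]ig -!kmulA gg !kmulA ig.
have [|x xy] := iS y.
  by rewrite -hy !kmulA gh -kmulA hg.
have [|z zx] := jS x.
  by apply: (hom_inj i0); rewrite !iM xy.
by exists z; rewrite hcompE zx.
Qed.

Lemma corner_val_is_corner (R : pzRingType) (E : algstr k R) (g : idem R) :
  is_corner (corner_val E g) (g : R).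
Proof.
split=> [a b|x x0|x|y gy] //.
- exact: val_inj.
- exact: (peirceP (x : corner g)).
have yP : (y : R) \in in_peirce g g by apply/eqP.
by exists (Peirce yP).
Qed.
End Iso.

(** * Primitive idempotents and local algebras *)

Section Local.
Variables (k : fieldType) (A : falgType k).
Hypothesis idem01 : forall a : A, is_idempotent a -> a = 0 \/ a = 1.

Lemma annihilating_poly (a : A) : exists2 p : {poly k}, p != 0 & horner_alg a p = 0.
Proof.
pose d := (\dim {:A}).
pose X := [tuple a ^+ (i : 'I_d.+1) | i < d.+1].
have nf : ~~ free X.
  apply/negP; rewrite /free size_tuple => /eqP dX.
  by have := dimvS (subvf <<X>>%VS); rewrite dX ltnn.
apply: contrapT => no; case/negP: nf; apply/freeP => c c0 i.
apply: contrapT => ci; apply: no; exists (\poly_(i < d.+1) c (inord i)).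
  apply/eqP => /(congr1 (fun p : {poly k} => p`_i)).
  by rewrite coef_poly ltn_ord inord_val coef0.
rewrite poly_def raddf_sum /= -[RHS]c0; apply: eq_bigr => j _.
by rewrite linearZ /= rmorphXn /= horner_algX inord_val nth_mktuple mulr_algl.
Qed.

(* Fitting: if p(a) = 0 with p = X^n q and u q + v X^(n+1) = 1, then           *)
(* v(a) a^(n+1) is idempotent.                                                *)
Lemma left_unit_or_nilpotent (a : A) : (exists b, b * a = 1) \/ exists n, a ^+ n = 0.
Proof.
have [p p0 pa] := annihilating_poly a.
have [n [q q0 pE]] := multiplicity_XsubC p 0.
move: q0; rewrite p0 /= => q0; rewrite subr0 in pE.
have cop : coprimep q ('X ^+ n.+1) by apply: coprimep_expr; rewrite coprimepX.
have /Bezout_eq1_coprimepP[[u v] /= uv] := cop.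
have H0 (w : {poly k}) : horner_alg a (w * (q * 'X^(n.+1))) = 0.
  by rewrite exprSr [q * _]mulrA -pE rmorphM rmorphM /= pa mul0r mulr0.
have HX (m : nat) : horner_alg a 'X^m = a ^+ m by rewrite rmorphXn /= horner_algX.
have [|e0|e1] := idem01 (a := horner_alg a (v * 'X^(n.+1))).
- rewrite /is_idempotent; apply/eqP; rewrite -rmorphM -subr_eq0 -rmorphB /=.
  rewrite (_ : _ - _ = - (v * u) * (q * 'X^(n.+1))) ?H0 //.
  rewrite -[X in _ - X]mulr1 -mulrBr -[X in _ - X]uv opprD addrCA subrr addr0.
  by rewrite mulrN mulNr mulrACA ['X^_ * q]mulrC.
- right; exists n.+1; rewrite -HX -[X in horner_alg a X]mul1r -uv mulrDl -mulrA rmorphD [X in X + _]H0 add0r.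
  by rewrite rmorphM [X in X * _]e0 mul0r.
- left; exists (horner_alg a (v * 'X^n)).
  by rewrite -[X in _ * X](horner_algX a) -rmorphM -mulrA -exprSr.
Qed.

Lemma left_ideal_unit (I : {vspace A}) b x : left_ideal I -> x \in I -> b * x = 1 -> I = fullv.
Proof.
move=> II xI bx; apply/eqP; rewrite eqEsubv subvf /=; apply/subvP => y _.
by rewrite -[y]mulr1 -bx mulrA; apply: II.
Qed.

Lemma left_ideal_add (I J : {vspace A}) : left_ideal I -> left_ideal J -> left_ideal (I + J)%VS.
Proof.
move=> II JI a _ /memv_addP[x xI [y yJ ->]].
by rewrite mulrDr memv_add ?II ?JI.
Qed.

(** A proper left ideal of largest dimension is maximal; the zero ideal shows that there is a proper
    one. *)
Lemma exists_maximal_left_ideal : exists I : {vspace A}, maximal_left_ideal I.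
Proof.
pose P d := `[< exists I : {vspace A}, [/\ left_ideal I, I <> fullv & \dim I = d] >].
have exP : exists d, P d.
  exists 0; apply/asboolP; exists 0%VS; split; last by rewrite dimv0.
    by move=> a x; rewrite !memv0 => /eqP ->; rewrite mulr0.
  move=> E; have := memvf (1 : A); rewrite -E memv0 => /eqP E1.
  by move: (oner_neq0 A); rewrite E1 eqxx.
have ubP d : P d -> (d <= \dim {:A})%N.
  by move=> /asboolP[I [_ _ <-]]; apply: dimvS (subvf I).
case: (ex_maxnP exP ubP) => d /asboolP[I [II I1 dI]] dmax.
exists I; split=> // J JI IJ.
have [->|/eqP J1] := eqVneq J fullv; [by right|left].
have dJ : (\dim J <= d)%N by apply: dmax; apply/asboolP; exists J.
by apply/esym/eqP; rewrite eqEdim IJ dI.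
Qed.

(** If I and J are different maximal left ideals, then 1 = x + y with x in I and y in J. As x is not
    left invertible it is nilpotent, so y = 1 - x is left invertible and J is not proper. *)
Lemma local_of_idem01 : local_algebra A.
Proof.
have [I mI] := exists_maximal_left_ideal; exists I; split=> // J mJ.
have [II I1 Imax] := mI; have [JI J1 Jmax] := mJ.
have [IJ|IJ] := Imax _ (left_ideal_add II JI) (addvSl I J).
  by have [|//|//] := Jmax I II; rewrite -[X in (_ <= X)%VS]IJ addvSr.
have : 1 \in (I + J)%VS by rewrite IJ memvf.
case/memv_addP => x xI [y yJ xy].
case: (left_unit_or_nilpotent x) => [[b bx]|[n xn]].
  by case: I1; apply: left_ideal_unit II xI bx.
(* The left inverse of 1 - x is the finite geometric series in x. *)
case: J1; apply: (left_ideal_unit (b := \sum_(i < n) x ^+ i)) JI yJ _.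
have -> : y = 1 - x by rewrite xy addrAC subrr add0r.
rewrite mulrBr mulr1 mulr_suml -(big_mkord xpredT (fun i => x ^+ i)).
rewrite -(big_mkord xpredT (fun i => x ^+ i * x)) -sumrB.
rewrite (eq_bigr (fun i => - (x ^+ i.+1 - x ^+ i))); last by move=> i _; rewrite exprSr opprB.
by rewrite sumrN telescope_sumr // xn expr0 sub0r opprK.
Qed.
End Local.

Section CornerAlgebra.
Variables (k : fieldType) (L : falgType k) (g : L).
Hypothesis g_prim : primitive_idempotent g.
Local Notation K := (kalg_of (falg_algstr L)).

(** The corner gLg is realised as a subalgebra of L with unit g, hence as a finite dimensional
    algebra to which the assumption on local algebras can be applied. *)
Definition corner_vspace : {vspace L} := limg (amulr g \o amull g)%VF.

Lemma mem_corner x : x \in corner_vspace -> g * x * g = x.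
Proof.
have [gg _ _] := g_prim.
case/memv_imgP => y _ ->; rewrite comp_lfunE !lfunE /=.
by rewrite !mulrA gg -mulrA gg.
Qed.

Lemma corner_mem x : g * x * g = x -> x \in corner_vspace.
Proof.
move=> gx; apply/memv_imgP; exists x; first exact: memvf.
by rewrite comp_lfunE !lfunE.
Qed.

Lemma corner_is_aspace : is_aspace corner_vspace.
Proof.
have [gg g0 _] := g_prim.
have gl x : x \in corner_vspace -> g * x = x.
  by move=> /mem_corner <-; rewrite !mulrA gg.
have gr x : x \in corner_vspace -> x * g = x.
  by move=> /mem_corner <-; rewrite -mulrA gg.
apply/andP; split.
  apply/has_algidP; exists g; split; first by apply: corner_mem; rewrite !gg.
    exact/eqP.
  by move=> x xU; rewrite gl ?gr.
apply/prodvP => x y xU yU; apply: corner_mem.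
by rewrite mulrA gl // -mulrA gr.
Qed.
Definition corner_aspace : {aspace L} := ASpace corner_is_aspace.
Local Notation A := (subvs_of corner_aspace).

Lemma algid_corner : algid corner_aspace = g.
Proof.
have [gg _ _] := g_prim.
have gU : g \in corner_aspace by apply: corner_mem; rewrite !gg.
by rewrite -[LHS](mem_corner (memv_algid corner_aspace)) -mulrA (algidl gU) gg.
Qed.

(** An idempotent a of gLg gives the orthogonal decomposition g = a + (g - a), so primitivity forces
    a = 0 or a = g. *)
Lemma corner_falg_local : local_algebra A.
Proof.
have [gg g0 gmin] := g_prim.
apply: local_of_idem01 => a aa.
have aaL : vsval a * vsval a = vsval a by rewrite -[in RHS]aa.
have ga : g * vsval a = vsval a by rewrite -algid_corner algidl ?subvsP.
have ag : vsval a * g = vsval a by rewrite -algid_corner algidr ?subvsP.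
have [|||||a0|a1] := gmin (vsval a) (g - vsval a).
- exact: aaL.
- by rewrite /is_idempotent mulrBr !mulrBl gg ga ag aaL subrr subr0.
- by rewrite mulrBr ag aaL subrr.
- by rewrite mulrBl ga aaL subrr.
- by rewrite addrC subrK.
- by left; apply: val_inj.
- right; apply: val_inj; rewrite [RHS]algid_corner.
  by apply/esym/eqP; rewrite -subr_eq0 a1.
Qed.

Fact corner_falg_lin (c : k) (x y : kalg_of (falg_algstr A)) :
  (vsval (c *: x + y) : K) = c *: (vsval x : K) + vsval y.
Proof.
rewrite !kreg_scaleE /= mulr_algl -scalerAl.
exact: (congr1 (fun u : L => c *: u + vsval y) (algidl (subvsP x))).
Qed.
Definition corner_falg_val : hom (kalg_of (falg_algstr A)) K :=
  @Hom _ _ K (fun x : kalg_of (falg_algstr A) => vsval x : K) corner_falg_lin.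

Lemma corner_falg_is_corner : is_corner corner_falg_val g.
Proof.
split=> [a b|x x0|x|y gy] //.
- exact: val_inj.
- exact/mem_corner/subvsP.
have yU : y \in corner_aspace by apply: corner_mem.
by exists (Subvs yU).
Qed.
End CornerAlgebra.

(** * Induction along the chain *)

Section Chain.
Variables (k : fieldType)
  (Han_local : forall A : falgType k, local_algebra A -> Han_conjecture A)
  (L : falgType k).
Local Notation E := (falg_algstr L).
Local Notation K := (kalg_of E).

(** Any algebra that sits in L as the corner at g is isomorphic to the local subalgebra gLg, and
    both finiteness conditions are invariant under isomorphism. *)
Lemma Han_corner (g : L) (G : kalg k) (i : hom G K) :
  primitive_idempotent g -> is_corner i (g : K) -> finHH G -> fin_extdim G.
Proof.
move=> g_prim Gi GH.
have iso := corner_iso Gi (corner_falg_is_corner g_prim).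
apply: (fin_extdim_iso (kiso_sym iso)); apply: finite_gldim_extdim.
apply: (Han_local (corner_falg_local g_prim)).
exact/finite_HH_HV/(finHH_iso iso GH).
Qed.

Variables (n : nat) (e : complete_idempotents L n).
Hypotheses (e_primitive : forall i : 'I_n, primitive_idempotent (e i))
  (e_chain : strongly_costratifying_chain e).
Local Notation T i := (kalg_of (corner_algstr E (tail_idem e i))).

Lemma tail0 : tail e 0 = 1.
Proof. exact: ci_sum. Qed.

Lemma tailS (i : 'I_n) : tail e i = e i + tail e i.+1.
Proof.
rewrite /tail (bigD1 i) //=; congr (_ + _); apply: eq_bigl => j.
by rewrite [RHS]ltn_neqAle andbC [j == i]eq_sym.
Qed.

Lemma tail_n : tail e n = 0.
Proof. by apply: big1 => j; rewrite leqNgt ltn_ord. Qed.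

(** Induction on the number m + 1 of idempotents in the tail. A tail with one idempotent is a corner
    at a primitive idempotent; otherwise the stratifying ideal at [tail e i.+1] splits off the
    corner at [e i] and leaves a shorter tail. *)
Lemma Han_tail m i : (i + m.+1)%N = n -> finHH (T i) -> fin_extdim (T i).
Proof.
elim: m i => [|m IHm] i im TH.
  have i_n : (i < n)%N by rewrite -im addn1.
  apply: (Han_corner (e_primitive (Ordinal i_n)) _ TH (i := corner_val E (tail_idem e i))).
  have := corner_val_is_corner E (tail_idem e i).
  by rewrite /= (tailS (Ordinal i_n)) /= -[X in tail e X]addn1 im tail_n addr0.
have i1n : (i.+1 < n)%N by rewrite -im !addnS !ltnS leq_addr.
have i_n := ltnW i1n.
have strat := e_chain i1n; have [TA TB] := finHH_strat strat TH.
have tt j : kmul (tail e j : K) (tail e j : K) = tail e j by apply: tail_idem_proof.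
have cornerC (g : idem (corner (tail_idem e i))) :
    is_corner (hcomp (corner_val E (tail_idem e i)) (corner_val (corner_algstr E (tail_idem e i)) g))
      (@peirce_val L (tail_idem e i) (tail_idem e i) (idem_val g) : K).
  exact: (is_corner_comp (idemP g : kmul (idem_val g : T i) (idem_val g : T i) = _) (tt i)
    (corner_val_is_corner _ _) (corner_val_is_corner _ _)).
apply: (fin_extdim_step strat).
  apply: (Han_corner (e_primitive (Ordinal i_n)) _ TA).
  (* The unit of this corner is [tail e i], so the complement of [tail e i.+1] in it is [e i]. *)
  have := cornerC (idemC (corner_tailS_idem e i)).
  by rewrite /= (tailS (Ordinal i_n)) /= addrK; apply.
(* The corner at [tail e i.+1] taken inside the corner at [tail e i] is the corner of L at
   [tail e i.+1], to which the induction hypothesis applies. *)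
have iso := corner_iso (cornerC (corner_tailS_idem e i)) (corner_val_is_corner E (tail_idem e i.+1)).
apply: (fin_extdim_iso (kiso_sym iso)); apply: IHm; first by rewrite addSnnS.
exact: finHH_iso TB.
Qed.
End Chain.

Theorem corollary5p14 (k : fieldType)
    (Han_local : forall A : falgType k, local_algebra A -> Han_conjecture A)
    (L : falgType k) (n : nat) (e : complete_idempotents L n)
    (e_primitive : forall i : 'I_n, primitive_idempotent (e i))
    (e_chain : strongly_costratifying_chain e) :
  Han_conjecture L.
Proof.
move=> /finite_HH_HV LH; apply: (extdim_finite_gldim (E := falg_algstr L)).
have iso : kiso (kalg_of (corner_algstr (falg_algstr L) (tail_idem e 0))) (kalg_of (falg_algstr L)).
  apply: (corner_iso (j := idh _) (corner_val_is_corner (falg_algstr L) (tail_idem e 0))).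
  by rewrite /= tail0; split=> // [x|y _]; [rewrite kmul1l kmul1r|exists y].
apply: (fin_extdim_iso iso); apply: (Han_tail Han_local e_primitive e_chain (m := n.-1)).
  (* The set of idempotents is not empty: for n = 0 the sum would be 0, while 1 is nonzero in L. *)
  rewrite add0n prednK // lt0n; apply/eqP => n0.
  have := ci_sum e; rewrite big1 => [/esym/eqP|[i i_n] _]; last by exfalso; rewrite n0 in i_n.
  by rewrite oner_eq0.
exact: finHH_iso (kiso_sym iso) LH.
Qed.
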